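(* Assume the setting and assumptions (i)–(iii) of the context. Then, for every $N\ge2$ and every initial configuration $(x_1^N(0),\dots,x_N^N(0))\in(\mathbb R^d)^N$, the $N$-particle SVGD system associated with the kernel $\widetilde k$ has a unique global classical solution. Moreover, there exists $C\in(0,\infty)$ (not depending on $N$, $T$ or the initial configuration) such that, for all $T>0$, $$\int_0^T\frac1N\sum_{i=1}^N\|x_i^N(t)\|^2\,dt\le CT+\frac CN\sum_{i=1}^NV(x_i^N(0)).$$ Further, under the random initialization in (iii), $$\sup_{N\ge2}\mathbb E\Big[\frac1N\sum_{i=1}^NV(x_i^N(0))\Big]<\infty.$$ The corresponding mean-field equation $\partial_t\mu_t+\nabla\cdot(v_{\mu_t}\mu_t)=0$ started from $\mu_0$ is globally defined in the weak continuity-equation sense and satisfies, for all $T>0$, $$\int_0^T\int_{\mathbb R^d}\|x\|^2\,\mu_t(dx)\,dt\le CT+C\int_{\mathbb R^d}V(x)\,\mu_0(dx)<\infty.$$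
   Context: **Setting.** $\pi(dx)\propto e^{-V(x)}dx$ is a probability measure on $\mathbb R^d$; $W_s$ is the Wasserstein-$s$ distance; $\mathsf{KL}$ is relative entropy. With the kernel $\widetilde k$ below, $v_\rho(x):=\int\{-\widetilde k(x,y)\nabla V(y)+\nabla_2\widetilde k(x,y)\}\rho(dy)$ ($\nabla_2$: gradient in the second argument). The $N$-particle SVGD system is $\dot x_i^N(t)=v_{\mu_t^N}(x_i^N(t))$, $1\le i\le N$, $\mu_t^N:=\frac1N\sum_i\delta_{x_i^N(t)}$. Weak solutions of $\partial_t\mu_t+\nabla\cdot(v_{\mu_t}\mu_t)=0$ are tested against $C_c^1(\mathbb R^d)$ functions. $\mathsf{KSD}(\rho\|\pi):=\big\|\int\{-\widetilde k(\cdot,x)\nabla V(x)+\nabla_2\widetilde k(\cdot,x)\}\rho(dx)\big\|_{\mathcal H^d}$, $\mathcal H^d$ the $\mathbb R^d$-valued RKHS of $\widetilde k$. **Exponent.** $\mathfrak r(d,\nu):=\frac{d}{3(4d+1)}\cdot\frac1{\frac{3d}2+\frac{11}6+\left(\frac83+\frac1d\right)\nu}\in(0,1)$. **Assumptions.** (i) $\widetilde k(u,v)=1+\langle u,v\rangle+\Psi(u-v)$ with $\Psi(z):=\frac{2^{1-(d/2+\nu)}}{\Gamma(d/2+\nu)}\|\Sigma z\|_2^\nu K_{-\nu}(\|\Sigma z\|_2)$, $\Sigma$ strictly positive definite, $\nu>3/2$, $K_{-\nu}$ the modified Bessel function of the second kind. (ii) $V$ is positive, $C^3$, and for some $L<\infty$: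 $\|\nabla V(x)\|\le L(1+\|x\|)$, $\|\nabla^2V(x)\|_{\rm op}\le L$. For some $a>0$, $\beta_0,\beta_1\ge0$: $-\langle x,\nabla V(x)\rangle+d\le-a\|x\|^2+\beta_1\|x\|+\beta_0$ for all $x$. Langevin contractivity: for $dZ_t=-\frac12\nabla V(Z_t)dt+dB_t$, $Z_0=x$ (solution $Z^x_t$), there are $\rho_s:[0,\infty)\to[0,\infty)$, $s=1,2$, with $W_s(\mathrm{Law}(Z_t^x),\mathrm{Law}(Z_t^y))\le\rho_s(t)\|x-y\|$ for all $x,y,t\ge0$, $\int_0^\infty\rho_1(t)dt<\infty$; this is assumed so that the following comparison applies: there is $C_{\rm KGM}<\infty$ with $W_2(\rho,\pi)\le C_{\rm KGM}\big(1\vee\mathsf{KSD}(\rho\|\pi)^{1-\mathfrak r}\big)\mathsf{KSD}(\rho\|\pi)^{\mathfrak r}$ for every probability measure $\rho$ with finite second moment. (iii) $P_0^N$, the joint law of the initial configuration, satisfies $\sup_N\frac1N\mathsf{KL}(P_0^N\|\pi^{\otimes N})<\infty$; there are positive constants $\alpha_{\rm init},\beta_{\rm init},c_{\rm init},C_{\rm init}$ with $\mathbb P\big(W_2(\mu_0^N,\mu_0)>c_{\rm init}N^{-\alpha_{\rm init}}\big)\le C_{\rm init}(\log N)^{-\beta_{\rm init}}$ for $N\ge1$ (the right side being $+\infty$ at $N=1$), where $\mu_0\in\mathcal P_2(\mathbb R^d)$ is deterministic with a density, $\int\|x\|^2d\mu_0<\infty$ and $\mathsf{KL}(\mu_0\|\pi)<\infty$.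 *)

(* Defs.v *)
From HB Require Import structures.
From mathcomp Require Import all_boot all_order all_algebra.
From mathcomp Require Import all_classical all_reals all_analysis.
Import Order.TTheory GRing.Theory Num.Theory.
Import numFieldNormedType.Exports.

Set Implicit Arguments.
Unset Strict Implicit.
Unset Printing Implicit Defensive.

Local Open Scope classical_set_scope.
Local Open Scope ring_scope.

(** The library norm [`|x|] on ['rV[R]_d] is the max norm: it is used only
    through the topology (and differentiability), which is the usual one.
    Lengths are measured with [enorm]. *)

Section euclidean.
Context {R : realType} {d : nat}.

Definition dotv (x y : 'rV[R]_d) : R := \sum_(i < d) x 0 i * y 0 i.

Definition enorm (x : 'rV[R]_d) : R := Num.sqrt (dotv x x).

Definition basis_vec (i : 'I_d) : 'rV[R]_d := delta_mx 0 i.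

Definition grad (f : 'rV[R]_d -> R) (x : 'rV[R]_d) : 'rV[R]_d :=
  \row_i 'D_(basis_vec i) f x.

Definition hess (f : 'rV[R]_d -> R) (x : 'rV[R]_d) : 'M[R]_d :=
  \matrix_(i, j) 'D_(basis_vec i) (fun y => grad f y 0 j) x.

Definition opnorm (A : 'M[R]_d) : R :=
  sup [set enorm (h *m A^T) | h in [set h | enorm h <= 1]].

Fixpoint Ck (n : nat) (f : 'rV[R]_d -> R) : Prop :=
  match n with
  | 0%N => continuous f
  | n'.+1 => (forall x, differentiable f x) /\
             forall i, Ck n' (fun x => grad f x 0 i)
  end.

Definition pos_def (A : 'M[R]_d) : Prop :=
  A^T = A /\ forall x : 'rV[R]_d, x != 0 -> 0 < dotv (x *m A^T) x.

End euclidean.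

Section borel.
Context {R : realType} {d : nat}.

Let G : set (set 'rV[R]_d) := open.

Let borel0 : <<s G >> set0. Proof. exact: sigma_algebra0. Qed.

Let borelC A : <<s G >> A -> <<s G >> (~` A).
Proof. exact: sigma_algebraC. Qed.

Let borel_bigcup (F : (set 'rV[R]_d)^nat) : (forall i, <<s G >> (F i)) ->
  <<s G >> (\bigcup_i F i).
Proof. exact: sigma_algebra_bigcup. Qed.

HB.instance Definition _ := @isMeasurable.Build (sigma_display G)
  'rV[R]_d <<s G >> borel0 borelC borel_bigcup.

End borel.

Section tuple_measure.
Context {dis : measure_display} {T : measurableType dis} {R : realType}.

Definition cons_pair n (x : n.-tuple T * T) : n.+1.-tuple T :=
  [the n.+1.-tuple T of x.2 :: x.1].

Lemma measurable_cons_pair n : measurable_fun setT (@cons_pair n).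
Proof. exact: (measurable_cons measurable_snd measurable_fst). Qed.

Section fix_m.
Variable m : {sigma_finite_measure set T -> \bar R}.

Definition tuple_measure_step n (mu : {measure set (n.-tuple T) -> \bar R}) :
  set (n.+1.-tuple T) -> \bar R := pushforward (mu \x m)%E (@cons_pair n).

HB.instance Definition _ n (mu : {measure set (n.-tuple T) -> \bar R}) :=
  Measure.copy (tuple_measure_step mu)
    (measure_function_pushforward__canonical__measure_function_Measure
      (mu \x m)%E (@measurable_cons_pair n)).

Fixpoint tuple_measure_rec (n : nat) : {measure set (n.-tuple T) -> \bar R} :=
  match n return {measure set (n.-tuple T) -> \bar R} with
  | 0%N => \d_([tuple] : 0.-tuple T)
  | n'.+1 => tuple_measure_step (tuple_measure_rec n')
  end.

Definition tuple_measure n : set (n.-tuple T) -> \bar R := tuple_measure_rec n.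

HB.instance Definition _ n := Measure.on (@tuple_measure n).

End fix_m.

Variable P : probability T R.

Lemma tuple_measure_setT n : tuple_measure P (n := n) setT = 1%E.
Proof.
elim: n => [|n IH]; first by rewrite /tuple_measure/= diracT.
rewrite /tuple_measure/= /tuple_measure_step /pushforward preimage_setT -setXTT.
rewrite product_measure1E// [X in (X * _)%E]IH mul1e.
exact: probability_setT.
Qed.

Definition tuple_prob n : set (n.-tuple T) -> \bar R := tuple_measure P (n := n).

HB.instance Definition _ n := Measure.on (@tuple_prob n).
HB.instance Definition _ n := Measure_isProbability.Build _ _ _
  (@tuple_prob n) (@tuple_measure_setT n).

End tuple_measure.

Section lebesgue_rV.
Context {R : realType} {d : nat}.

Definition row_of_tuple (t : d.-tuple (measurableTypeR R)) : 'rV[R]_d :=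
  \row_i tnth t i.

Lemma measurable_row_of_tuple : measurable_fun setT row_of_tuple.
Proof.
apply: (@measurability _ _ _ _ setT row_of_tuple open) => // _ [U oU <-].
rewrite setTI.
pose box (p : 'rV[rat]_d * nat) : set 'rV[R]_d :=
  [set v | forall i, `|ratr (p.1 0 i) - v 0 i| < p.2.+1%:R^-1].
have -> : row_of_tuple @^-1` U =
    \bigcup_(p in [set p | box p `<=` U]) (row_of_tuple @^-1` box p).
  apply/seteqP; split => [t Ut|t [p /= pU tp]]; last exact: pU.
  move: (oU); rewrite openE => /(_ _ Ut).
  rewrite /interior => /nbhs_ballP[e /= e0 eU].
  have [n ne] : exists n, n.+1%:R^-1 < e / 2.
    have := near_infty_natSinv_lt (PosNum (divr_gt0 e0 (ltr0n R 2))).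
    by case=> n _ /(_ n (leqnn n)) ?; exists n.
  have n0 : 0 < n.+1%:R^-1 :> R by rewrite invr_gt0.
  have qP i : exists q : rat,
      `|ratr q - row_of_tuple t 0 i| < n.+1%:R^-1 :> R.
    have : row_of_tuple t 0 i < row_of_tuple t 0 i + n.+1%:R^-1.
      by rewrite ltrDl.
    move=> /rat_in_itvoo[q]; rewrite in_itv/= => /andP[q1 q2]; exists q.
    by rewrite ger0_norm ?subr_ge0 ?ltW// ltrBlDl.
  have [q qE] := choice qP.
  exists (\row_i q i, n) => /=; last by move=> i; rewrite mxE.
  move=> v vb; apply: eU; split => //= i j; rewrite ord1.
  have := vb j; rewrite /= mxE => vj; have := qE j => qj.
  rewrite /ball/= (_ : _ - _ = (ratr (q j) - v 0 j) - (ratr (q j) - row_of_tuple t 0 j)).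
    rewrite (le_lt_trans (ler_normB _ _))// [ltRHS]splitr ltrD//;
      exact: lt_trans ne.
  by rewrite opprB [RHS]addrC subrKA.
rewrite bigcup_mkcond; apply: countable_bigcupT_measurable => [|p]; first exact: countableP.
case: ifPn => // _.
have -> : row_of_tuple @^-1` box p = \bigcap_(i in [set: 'I_d])
   ((fun t : d.-tuple (measurableTypeR R) => tnth t i) @^-1`
     [set x | `|ratr (p.1 0 i) - x| < p.2.+1%:R^-1]).
  apply/seteqP; split => t /= tp i => [_|]; have := tp i; rewrite /= mxE //.
  exact.
apply: fin_bigcap_measurable => // i _.
rewrite -[X in measurable X]setTI; apply: measurable_tnth => //.
apply: measurable_realfun.open_measurable.
rewrite (_ : [set _ | _] = @ball R R^o (ratr (p.1 0 i)) p.2.+1%:R^-1) //.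
exact: ball_open.
Qed.

Definition lebesgue_rV : set 'rV[R]_d -> \bar R :=
  pushforward (tuple_measure (@lebesgue_measure R) (n := d)) row_of_tuple.

HB.instance Definition _ := Measure.copy lebesgue_rV
  (measure_function_pushforward__canonical__measure_function_Measure
    (tuple_measure (@lebesgue_measure R) (n := d)) measurable_row_of_tuple).

End lebesgue_rV.

Section kernel.
Context {R : realType}.

Definition Gamma (s : R) : R :=
  \int[lebesgue_measure]_(t in `]0, +oo[) (t `^ (s - 1) * expR (- t)).

(** Modified Bessel function of the second kind, for [z > 0], by the classical
    integral representation
    K_s(z) = (1/2) (z/2)^s int_0^oo exp(-t - z^2/(4t)) t^(-s-1) dt
    (DLMF 10.32.10), valid for every real order [s]. *)
Definition besselK (s z : R) : R :=
  2^-1 * (z / 2) `^ s *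
  \int[lebesgue_measure]_(t in `]0, +oo[)
    (expR (- t - z ^+ 2 / (4 * t)) * t `^ (- s - 1)).

(** [r ^ nu * K_(-nu) r], extended by continuity at [r = 0] since [K_(-nu)]
    is singular there. *)
Definition bessel_profile (nu r : R) : R :=
  if r == 0 then lim ((fun r : R => r `^ nu * besselK (- nu) r) @ 0^'+)
  else r `^ nu * besselK (- nu) r.

Definition matern (d : nat) (nu : R) (Sigma : 'M[R]_d) (z : 'rV[R]_d) : R :=
  2 `^ (1 - (d%:R / 2 + nu)) / Gamma (d%:R / 2 + nu) *
  bessel_profile nu (enorm (z *m Sigma^T)).

Definition svgd_kernel (d : nat) (nu : R) (Sigma : 'M[R]_d)
    (u v : 'rV[R]_d) : R :=
  1 + dotv u v + matern nu Sigma (u - v).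

Definition r_exponent (d : nat) (nu : R) : R :=
  d%:R / (3 * (4 * d%:R + 1)) *
  (3 * d%:R / 2 + 11 / 6 + (8 / 3 + d%:R^-1) * nu)^-1.

End kernel.

(** By Moore-Aronszajn the structure [rkhs k] has, for a positive
    semidefinite [k], exactly one inhabitant up to the irrelevant values of
    [rkhs_dot] outside [rkhs_space]. *)

Record rkhs (R : realType) (T : Type) (k : T -> T -> R) := Rkhs {
  rkhs_space : set (T -> R);
  rkhs_dot : (T -> R) -> (T -> R) -> R;
  rkhs_space0 : rkhs_space (fun=> 0);
  rkhs_spaceD : forall f g, rkhs_space f -> rkhs_space g ->
    rkhs_space (fun x => f x + g x);
  rkhs_spaceZ : forall a f, rkhs_space f -> rkhs_space (fun x => a * f x);
  rkhs_dotC : forall f g, rkhs_space f -> rkhs_space g ->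
    rkhs_dot f g = rkhs_dot g f;
  rkhs_dotDl : forall f g h, rkhs_space f -> rkhs_space g -> rkhs_space h ->
    rkhs_dot (fun x => f x + g x) h = rkhs_dot f h + rkhs_dot g h;
  rkhs_dotZl : forall a f h, rkhs_space f -> rkhs_space h ->
    rkhs_dot (fun x => a * f x) h = a * rkhs_dot f h;
  rkhs_dot_ge0 : forall f, rkhs_space f -> 0 <= rkhs_dot f f;
  rkhs_dot_eq0 : forall f, rkhs_space f -> rkhs_dot f f = 0 -> f = (fun=> 0);
  rkhs_complete : forall u : nat -> T -> R, (forall n, rkhs_space (u n)) ->
    (forall e, 0 < e -> exists n0, forall m n, (n0 <= m)%N -> (n0 <= n)%N ->
       rkhs_dot (fun x => u m x - u n x) (fun x => u m x - u n x) < e) ->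
    exists2 f, rkhs_space f &
      (fun n => rkhs_dot (fun x => u n x - f x) (fun x => u n x - f x))
        @ \oo --> (0 : R);
  rkhs_kernel : forall x, rkhs_space (k x);
  rkhs_reproducing : forall f x, rkhs_space f -> rkhs_dot f (k x) = f x }.

Section distances.
Context {R : realType}.

Definition KL {dis : measure_display} {T : measurableType dis}
    (P Q : probability T R) : \bar R :=
  if `[< P `<< Q >] then
    (\int[P]_x
      (ln (fine (Radon_Nikodym (charge_of_finite_measure P) Q x)))%:E)%E
  else +oo%E.

Context {d : nat}.

Definition coupling (mu1 mu2 : set 'rV[R]_d -> \bar R)
    (g : probability ('rV[R]_d * 'rV[R]_d)%type R) : Prop :=
  forall A, measurable A ->
    g (fst @^-1` A) = mu1 A /\ g (snd @^-1` A) = mu2 A.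

Definition wasserstein (s : nat) (mu1 mu2 : set 'rV[R]_d -> \bar R) : \bar R :=
  poweR (ereal_inf
    [set (\int[g]_z (enorm (z.1 - z.2) ^+ s)%:E)%E | g in coupling mu1 mu2])
    s%:R^-1.

Definition second_moment (mu : set 'rV[R]_d -> \bar R) : \bar R :=
  (\int[mu]_x (enorm x ^+ 2)%:E)%E.

End distances.

Section svgd.
Context {R : realType} {d : nat}.

Definition empirical (N : nat) (x : N.-tuple 'rV[R]_d) :
    set 'rV[R]_d -> \bar R :=
  mscale (N%:R^-1)%:nng (msum (fun j => \d_(nth 0 x j)) N).

HB.instance Definition _ (N : nat) (x : N.-tuple 'rV[R]_d) :=
  Measure.on (empirical x).

Variables (V : 'rV[R]_d -> R) (k : 'rV[R]_d -> 'rV[R]_d -> R).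

Definition svgd_velocity (rho : set 'rV[R]_d -> \bar R) (x : 'rV[R]_d) :
    'rV[R]_d :=
  \row_i fine (\int[rho]_y
    (- k x y * grad V y 0 i + grad (k x) y 0 i)%:E)%E.

(** The integrand of the discrepancy is the velocity field, seen as an element
    of the d-fold product of the RKHS; the value is [+oo] if it is not one. *)
Definition KSD (H : rkhs k) (rho : set 'rV[R]_d -> \bar R) : \bar R :=
  let f i := fun x => svgd_velocity rho x 0 i in
  if `[< forall i, rkhs_space H (f i) >] then
    (Num.sqrt (\sum_(i < d) rkhs_dot H (f i) (f i)))%:E
  else +oo%E.

(** Classical solutions on [0, +oo[; the derivative at time 0 is one-sided. *)
Definition particle_solution (N : nat) (x0 : N.-tuple 'rV[R]_d)
    (x : R -> N.-tuple 'rV[R]_d) : Prop :=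
  x 0 = x0 /\
  forall t, 0 <= t -> forall i,
    (fun s => (s - t)^-1 *: (tnth (x s) i - tnth (x t) i))
      @ (within [set s | 0 <= s] t^')
      --> svgd_velocity (empirical (x t)) (tnth (x t) i).

Definition mean_field_solution (mu0 : probability 'rV[R]_d R)
    (mu : R -> probability 'rV[R]_d R) : Prop :=
  [/\ forall A, measurable A -> mu 0 A = mu0 A,
      forall t, 0 <= t -> (second_moment (mu t) < +oo)%E &
      forall phi : 'rV[R]_d -> R, Ck 1 phi ->
        compact (closure [set x | phi x != 0]) ->
        let flux s := \int[mu s]_x dotv (grad phi x) (svgd_velocity (mu s) x) in
        forall t, 0 <= t ->
          lebesgue_measure.-integrable `[0, t] (EFin \o flux) /\
          \int[mu t]_x phi x =
            \int[mu0]_x phi x + \int[lebesgue_measure]_(s in `[0, t]) flux s].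

End svgd.

Section langevin.
Context {R : realType} {d : nat}.

Definition gibbs (V : 'rV[R]_d -> R) (target : probability 'rV[R]_d R) :=
  exists2 Z : R, 0 < Z & forall A, measurable A ->
    target A = (\int[lebesgue_rV]_(x in A) (Z^-1 * expR (- V x))%:E)%E.

Definition has_density (mu : probability 'rV[R]_d R) :=
  exists f : 'rV[R]_d -> R,
    [/\ measurable_fun setT f, forall x, 0 <= f x &
        forall A, measurable A ->
          mu A = (\int[lebesgue_rV]_(x in A) (f x)%:E)%E].

(** Standard d-dimensional Brownian motion: the coordinates of the increments
    over successive time intervals are jointly independent centred Gaussians
    with variance the length of the interval ([normal_prob] takes a standard
    deviation). *)
Definition brownian {dis : measure_display} {Om : measurableType dis}
    (P : probability Om R) (B : R -> {RV P >-> 'rV[R]_d}) : Prop :=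
  [/\ forall w, B 0 w = 0,
      forall w, {within [set t | 0 <= t], continuous (fun t => B t w)} &
      forall (n : nat) (t : nat -> R), 0 <= t 0%N ->
        (forall j, t j < t j.+1) ->
        forall A : 'I_n -> 'I_d -> set (measurableTypeR R),
        (forall j i, measurable (A j i)) ->
        P [set w | forall j i, A j i ((B (t j.+1) w - B (t j) w) 0 i)] =
        (\prod_(j < n) \prod_(i < d)
          fine (normal_prob 0 (Num.sqrt (t j.+1 - t j)) (A j i)))%:E].

(** [dZ_t = - 1/2 grad V(Z_t) dt + dB_t], [Z_0 = x]: the noise is additive, so
    the Ito equation is the pathwise integral equation below. *)
Definition langevin_solution (V : 'rV[R]_d -> R) (x : 'rV[R]_d)
    {dis : measure_display} {Om : measurableType dis}
    (P : probability Om R) (B Z : R -> {RV P >-> 'rV[R]_d}) : Prop :=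
  [/\ brownian B,
      forall w, {within [set t | 0 <= t], continuous (fun t => Z t w)} &
      forall w t, 0 <= t -> forall i,
        Z t w 0 i = x 0 i
          - 2^-1 * \int[lebesgue_measure]_(s in `[0, t]) grad V (Z s w) 0 i
          + B t w 0 i].

Definition langevin_law (V : 'rV[R]_d -> R) (x : 'rV[R]_d) (t : R)
    (m : probability 'rV[R]_d R) : Prop :=
  exists (dis : measure_display) (Om : measurableType dis)
    (P : probability Om R) (B Z : R -> {RV P >-> 'rV[R]_d}),
    langevin_solution V x B Z /\
    forall A, measurable A -> m A = distribution P (Z t) A.

Definition langevin_contractive (V : 'rV[R]_d -> R) : Prop :=
  exists rho : nat -> R -> R,
    [/\ forall s t, s \in [:: 1; 2]%N -> 0 <= t -> 0 <= rho s t,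
        forall s x y t mx my, s \in [:: 1; 2]%N -> 0 <= t ->
          langevin_law V x t mx -> langevin_law V y t my ->
          (wasserstein s mx my <= (rho s t * enorm (x - y))%:E)%E &
        lebesgue_measure.-integrable `[0, +oo[ (EFin \o rho 1%N)].

End langevin.

(* Main.v *)
From HB Require Import structures.
Require Import Defs.
From mathcomp Require Import all_boot all_order all_algebra.
From mathcomp Require Import all_classical all_reals all_analysis.
From mathcomp Require Import measurable_realfun.
From mathcomp Require Import ring lra.
Import Order.TTheory GRing.Theory Num.Theory.
Import numFieldNormedType.Exports.

Local Open Scope classical_set_scope.
Local Open Scope ring_scope.

(** Both systems are instances of one flow. For a probability measure mu with finite second moment,
    consider maps X_t with X_0 = id and dX_t(x)/dt = int b(X_t(x), X_t(y)) mu(dy), where b(z, y) = -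
    k(z, y) grad V(y) + grad_2 k(z, y). If mu is the empirical measure of the initial configuration,
    the images of its atoms are the particles; if mu is the initial law, the images of mu solve the
    mean-field equation. Existence and estimates are therefore proved once, for a general mu
    ([svgd_flow]), with a constant that does not depend on mu, hence not on N.

    The estimates come from the energy int V(X_t) dmu. Its time derivative splits according to the
    three parts of the kernel ([dissipation_bound]). The constant part contributes minus a square.
    The Matern part contributes minus a quadratic form, nonnegative because the Matern kernel is a
    mixture of Gaussians ([psd_matern], [integral_psd]). The bilinear part contributes minus the sum
    of the squares of M_ji = int X_j (d_i V)(X) dmu. The terms with grad_2 k add the trace of M and
    an error of the order of the second moment. Now - M^2 + M <= c(kappa) - kappa M for every kappa,
    and the trace of M is int <X, grad V(X)> dmu, which confinement bounds from below by a multiple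
    of the second moment; a large kappa absorbs the error and leaves a derivative of at most C1 -
    int |X_t|^2 dmu. Integration in time, with V >= 0, gives the moment bounds ([moment_bound]).

    Global existence ([flow_exists]) has to overcome that the velocity is only locally Lipschitz in
    the map. A cutoff makes it Lipschitz and Picard iteration converges. The truncated flow still
    gains energy at most linearly in time, coercivity of V ([potential_coercive]) turns this into a
    bound on the second moment, and Gronwall's lemma bounds X_t; a cutoff radius equal to that bound
    is never exceeded. Uniqueness of the particle trajectories is Gronwall's lemma in a ball
    ([solves_unique]).

    The regularity of the Matern kernel rests on the same mixture: r^nu K_(-nu)(r) is an integral of
    exp(- r^2 / (4 t)) with weight e^(-t) t^(nu - 1) ([bessel_profileE]), and one derivative bound
    costs one factor 1/t.

    The initial energy is controlled by the entropy inequality ([entropy_inequality]) applied to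
    half the total energy: exp(V/2) is integrable under the target because exp(-V/2) is Lebesgue
    integrable, and this exponential moment tensorises. *)

(** * Elementary continuity *)

Section continuity.
Context {R : realType} {S : topologicalType}.

Lemma continuous_const {W : normedModType R} (c : W) : continuous (fun _ : S => c).
Proof. by move=> x; exact: cvg_cst. Qed.

Lemma continuous_add {W : normedModType R} (f g : S -> W) :
  continuous f -> continuous g -> continuous (fun x : S => f x + g x).
Proof. by move=> cf cg x; apply: cvgD; [exact: cf|exact: cg]. Qed.

Lemma continuous_sub {W : normedModType R} (f g : S -> W) :
  continuous f -> continuous g -> continuous (fun x : S => f x - g x).
Proof. by move=> cf cg x; apply: cvgB; [exact: cf|exact: cg]. Qed.

Lemma continuous_mul (f g : S -> R) :
  continuous f -> continuous g -> continuous (fun x : S => f x * g x : R).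
Proof. by move=> cf cg x; apply: cvgM; [exact: cf|exact: cg]. Qed.

Lemma continuous_comp_fun {V W : topologicalType} (g : V -> W) (f : S -> V) :
  continuous f -> continuous g -> continuous (fun x : S => g (f x)).
Proof. by move=> cf cg x; apply: continuous_comp; [exact: cf|exact: cg]. Qed.

End continuity.

(** * Max norm, Euclidean length and scalar product of row vectors *)

Section vectors.
Context {R : realType} {d : nat}.
Implicit Types x y z : 'rV[R]_d.

Lemma coord_norm_le x i : `|x 0 i| <= `|x|.
Proof.
rewrite [leRHS]/Num.Def.normr/= mx_normrE.
by apply: (le_bigmax _ (fun ij : 'I_1 * 'I_d => `|x ij.1 ij.2|) (0, i)).
Qed.

Lemma rV_subE x y i : (x - y) 0 i = x 0 i - y 0 i.
Proof. by rewrite !mxE. Qed.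

Lemma rV_norm_le x c : 0 <= c -> (forall i, `|x 0 i| <= c) -> `|x| <= c.
Proof.
move=> c0 xc; rewrite /Num.Def.normr/= mx_normrE (bigmax_le _ c0)//= => -[i j] _.
by rewrite /= ord1.
Qed.

Lemma enorm_sqr x : enorm x ^+ 2 = dotv x x.
Proof. by rewrite sqr_sqrtr// sumr_ge0// => i _; rewrite -expr2 sqr_ge0. Qed.

Lemma enorm_ge0 x : 0 <= enorm x.
Proof. exact: sqrtr_ge0. Qed.

Lemma coord_enorm_le x i : `|x 0 i| <= enorm x.
Proof.
rewrite -(@ler_pXn2r _ 2) ?nnegrE ?enorm_ge0// enorm_sqr /dotv (bigD1 i)//=.
rewrite real_normK ?num_real// -expr2 lerDl sumr_ge0// => j _.
by rewrite -expr2 sqr_ge0.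
Qed.

Lemma norm_le_enorm x : `|x| <= enorm x.
Proof. by apply: rV_norm_le; [exact: enorm_ge0|exact: coord_enorm_le]. Qed.

Lemma dotv_le x y : `|dotv x y| <= d%:R * (`|x| * `|y|).
Proof.
rewrite (le_trans (ler_norm_sum _ _ _))//.
rewrite (@le_trans _ _ (\sum_(i < d) `|x| * `|y|))//; last first.
  by rewrite sumr_const card_ord mulr_natl.
by apply: ler_sum => i _; rewrite normrM ler_pM// coord_norm_le.
Qed.

Lemma enorm_sqr_le x : enorm x ^+ 2 <= d%:R * `|x| ^+ 2.
Proof. by rewrite enorm_sqr expr2 (le_trans (ler_norm _))// dotv_le. Qed.

Lemma enorm_le x : enorm x <= d%:R * `|x|.
Proof.
rewrite -(@ler_pXn2r _ 2) ?nnegrE ?enorm_ge0 ?mulr_ge0//.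
rewrite (le_trans (enorm_sqr_le x))// exprMn ler_wpM2r ?sqr_ge0//.
by rewrite -natrX ler_nat; case: (d) => // n; rewrite expnS expn1 leq_pmulr.
Qed.

Lemma dotvDl x y z : dotv (x + y) z = dotv x z + dotv y z.
Proof. by rewrite -big_split; apply: eq_bigr => i _; rewrite mxE mulrDl. Qed.

Lemma dotvC x y : dotv x y = dotv y x.
Proof. by apply: eq_bigr => i _; rewrite mulrC. Qed.

Lemma dotvDr x y z : dotv x (y + z) = dotv x y + dotv x z.
Proof. by rewrite dotvC dotvDl !(dotvC x). Qed.

Lemma dotvZl a x y : dotv (a *: x) y = a * dotv x y.
Proof. by rewrite mulr_sumr; apply: eq_bigr => i _; rewrite mxE mulrA. Qed.

Lemma dotvZr a x y : dotv x (a *: y) = a * dotv x y.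
Proof. by rewrite dotvC dotvZl dotvC. Qed.

Lemma dotvNl x y : dotv (- x) y = - dotv x y.
Proof. by rewrite -scaleN1r dotvZl mulN1r. Qed.

Lemma dotvNr x y : dotv x (- y) = - dotv x y.
Proof. by rewrite dotvC dotvNl dotvC. Qed.

Lemma dotvBl x y z : dotv (x - y) z = dotv x z - dotv y z.
Proof. by rewrite dotvDl dotvNl. Qed.

Lemma dotvBr x y z : dotv x (y - z) = dotv x y - dotv x z.
Proof. by rewrite dotvDr dotvNr. Qed.

Lemma dotv_basis x i : dotv x (basis_vec i) = x 0 i.
Proof.
rewrite /dotv (bigD1 i)//= big1 ?addr0 => [|j ji]; rewrite /basis_vec mxE.
  by rewrite !eqxx mulr1.
by rewrite (negPf ji) andbF mulr0.
Qed.

Lemma norm_basis i : `|basis_vec i : 'rV[R]_d| <= 1.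
Proof.
apply: rV_norm_le => // j; rewrite mxE.
by case: (_ && _); rewrite ?normr1 ?normr0.
Qed.

Lemma row_sum_basis x : x = \sum_i x 0 i *: basis_vec i.
Proof. by rewrite [LHS]row_sum_delta. Qed.

Lemma cvg_rV {T : Type} (F : set_system T) {FF : Filter F} (f : T -> 'rV[R]_d)
    (l : 'rV[R]_d) :
  (forall i, f x 0 i @[x --> F] --> l 0 i) -> f x @[x --> F] --> l.
Proof.
move=> fl; apply/cvgrPdist_le => /= e e0.
have : \forall x \near F, forall i, `|l 0 i - f x 0 i| <= e.
  by apply: filter_forall => i; exact: ((cvgrPdist_le _ _).1 (fl i)).
apply: filterS => x xe; apply: rV_norm_le => [|i]; first exact: ltW.
by rewrite !mxE.
Qed.

Lemma continuous_rV {T : topologicalType} (f : T -> 'rV[R]_d) :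
  (forall i, continuous (fun x : T => f x 0 i : R)) -> continuous f.
Proof. by move=> fc x; apply: cvg_rV => i; exact: fc. Qed.

Lemma continuous_coord {T : topologicalType} (f : T -> 'rV[R]_d) i :
  continuous f -> continuous (fun x : T => f x 0 i : R).
Proof.
move=> fc x; apply: (@continuous_comp _ _ _ f (fun v : 'rV[R]_d => v 0 i)).
  exact: fc.
exact: coord_continuous.
Qed.

Lemma continuous_sum {T : topologicalType} (I : Type) (r : seq I)
    (f : I -> T -> R) :
  (forall i, continuous (f i)) -> continuous (fun x : T => \sum_(i <- r) f i x : R).
Proof.
move=> fc x; elim: r => [|i r IH].
  by under eq_fun do rewrite big_nil; exact: cvg_cst.
under eq_fun do rewrite big_cons.
by apply: cvgD => //; exact: fc.
Qed.

Lemma continuous_dotv {T : topologicalType} (f g : T -> 'rV[R]_d) :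
  continuous f -> continuous g -> continuous (fun x : T => dotv (f x) (g x) : R).
Proof.
move=> fc gc; apply: continuous_sum => i x.
by apply: cvgM; exact: continuous_coord.
Qed.

Lemma lip_continuous {V W : normedModType R} (f : V -> W) (A : R) :
  (forall u v : V, `|f u - f v| <= A * `|u - v|) -> continuous f.
Proof.
move=> fA x; apply/cvgrPdist_le => /= e e0.
have A0 : 0 < `|A| + 1 by rewrite ltr_wpDl.
near=> y; rewrite (le_trans (fA _ _))//.
rewrite (@le_trans _ _ ((`|A| + 1) * `|x - y|))//.
  by rewrite ler_wpM2r// (le_trans (ler_norm _))// lerDl.
rewrite -ler_pdivlMl//.
near: y; apply: cvgr_dist_le; first exact: cvg_id.
by rewrite mulr_gt0// invr_gt0.
Unshelve. all: by end_near. Qed.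

Lemma continuous_measurable_rV {f : 'rV[R]_d -> R} :
  continuous f -> measurable_fun [set: 'rV[R]_d] f.
Proof.
move=> cf; apply: (measurability _ (RGenOpens.measurableE R)) => //.
move=> _ [_ [a [b ->] <-]]; rewrite setTI.
apply: sub_sigma_algebra => /=; apply: open_comp => // x _; exact: cf.
Qed.

Lemma continuous_measurable_rV_rV (f : 'rV[R]_d -> 'rV[R]_d) :
  continuous f -> measurable_fun [set: 'rV[R]_d] f.
Proof.
move=> cf; apply: (@measurability _ _ _ _ setT f open) => //.
move=> _ [U oU <-]; rewrite setTI.
by apply: sub_sigma_algebra => /=; apply: open_comp => // x _; exact: cf.
Qed.

End vectors.

(** * One-dimensional calculus: increments, primitives, Gronwall *)

Section time.
Context {R : realType}.
Notation leb := (@lebesgue_measure R).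
Implicit Types (f g F G : R -> R) (a b t s : R).

(** Monotonicity of [G - F]. Derivatives are asked for only inside the interval because observables
    of the flow are differentiated only at positive times. *)
Lemma increment_le F G f g a b : a <= b ->
  {within `[a, b], continuous F} -> {within `[a, b], continuous G} ->
  (forall s, a < s < b -> is_derive s 1 F (f s)) ->
  (forall s, a < s < b -> is_derive s 1 G (g s)) ->
  (forall s, a < s < b -> f s <= g s) ->
  F b - F a <= G b - G a.
Proof.
move=> ab cF cG dF dG fg.
have dGF s : s \in `]a, b[ -> is_derive s 1 (G \- F) (g s - f s).
  by rewrite in_itv/= => sab; apply: is_deriveB; [exact: dG|exact: dF].
suff : (G \- F) a <= (G \- F) b by rewrite /=; lra.
apply: (@ger0_derive1_ndecr _ (G \- F) a b) => //.
- by move=> s /dGF[].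
- move=> s sab; rewrite derive1E; have [_ ->] := dGF s sab.
  by rewrite subr_ge0 fg//; move: sab; rewrite in_itv.
- by move=> s; apply: cvgB; [exact: cG|exact: cF].
Qed.

Lemma derivable_within F f a b :
  (forall s, a <= s <= b -> is_derive s 1 F (f s)) ->
  {within `[a, b], continuous F}.
Proof.
move=> dF; apply: derivable_within_continuous => s.
by rewrite in_itv/= => /dF[].
Qed.

Lemma abs_increment_le F G f g a b : a <= b ->
  (forall s, a <= s <= b -> is_derive s 1 F (f s)) ->
  (forall s, a <= s <= b -> is_derive s 1 G (g s)) ->
  (forall s, a <= s <= b -> `|f s| <= g s) ->
  `|F b - F a| <= G b - G a.
Proof.
move=> ab dF dG fg.
have W s : a < s < b -> a <= s <= b by move=> /andP[/ltW -> /ltW ->].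
have cF := derivable_within _ _ _ _ dF; have cG := derivable_within _ _ _ _ dG.
rewrite ler_norml; apply/andP; split; last first.
  apply: (increment_le F G f g) => // s sab; [exact/dF/W|exact/dG/W|].
  by have := fg _ (W _ sab); rewrite ler_norml => /andP[].
rewrite lerNl.
rewrite [leLHS](_ : _ = (- F) b - (- F) a); last by rewrite !fctE; lra.
apply: (increment_le (- F) G (fun s => - f s) g) => //.
- by move=> s; apply: cvgN; exact: cF.
- by move=> s /W /dF sab; exact: is_deriveN.
- by move=> s /W; exact: dG.
- by move=> s /W /fg; rewrite ler_norml lerNl => /andP[].
Qed.

(** Primitive vanishing at 0. Integration starts at -1 so that there is a two-sided derivative at 0
    as well; for nonnegative times this is the integral over [0, t]. *)
Definition prim f t :=
  \int[leb]_(s in `[-1, t]) f s - \int[leb]_(s in `[-1, 0]) f s.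

Lemma prim0 f : prim f 0 = 0.
Proof. exact: subrr. Qed.

Lemma continuous_itv_integrable f a b : continuous f ->
  leb.-integrable `[a, b] (EFin \o f).
Proof.
move=> cf; apply: continuous_compact_integrable; first exact: segment_compact.
exact: continuous_subspaceT.
Qed.

Lemma is_derive_prim f t : continuous f -> -1 < t -> is_derive t 1 (prim f) (f t).
Proof.
move=> cf t1.
have [|dP PE] := @continuous_FTC1_closed R f (-1) t (t + 1) _
  (continuous_itv_integrable _ _ _ cf) t1 (cf t).
  by rewrite ltrDl.
have -> : prim f = (fun t => \int[leb]_(s in `[-1, t]) f s) \-
    (fun=> \int[leb]_(s in `[-1, 0]) f s) by [].
rewrite -[f t]subr0; apply: is_deriveB.
by apply: DeriveDef; [exact: dP|rewrite -derive1E; exact: PE].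
Qed.

Lemma primE f t : continuous f -> 0 <= t ->
  prim f t = \int[leb]_(s in `[0, t]) f s.
Proof.
move=> cf t0; rewrite /prim (@Rintegral_itvB _ f (BLeft (-1)) (BRight t) 0).
- rewrite Rintegral_itv_obnd_cbnd//.
  apply: integrableS (continuous_itv_integrable f 0 t cf) => //.
  by apply: subset_itvr; rewrite bnd_simp.
- exact: continuous_itv_integrable.
- by rewrite bnd_simp; lra.
- by rewrite bnd_simp.
Qed.

Lemma is_derive_expRM c t :
  is_derive t 1 (fun s => expR (c * s)) (c * expR (c * t)).
Proof.
have h : is_derive t 1 (fun s : R => c * s) c.
  by rewrite -[X in is_derive _ _ _ X](mulr1 c); exact: is_deriveZ.
rewrite mulrC.
exact: (@is_derive1_comp _ expR (fun s => c * s) t (expR (c * t)) c).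
Qed.

Lemma gronwall u K A T : 0 < K -> continuous u ->
  (forall t, 0 <= t <= T -> u t <= A + K * prim u t) ->
  forall t, 0 <= t <= T -> u t <= A * expR (K * t).
Proof.
move=> K0 cu uK t /andP[t0 tT].
rewrite (le_trans (uK t _)) ?t0//.
(* Integrating factor: [E] is nonincreasing on [0, t], its derivative being - K exp(- K s) times the
   slack [A + K * prim u s - u s]. *)
pose E s := expR (- K * s) * (A + K * prim u s).
pose dE s := expR (- K * s) * (K * u s) +
  (A + K * prim u s) * (- K * expR (- K * s)).
have DE s : 0 <= s <= t -> is_derive s 1 E (dE s).
  move=> /andP[s0 st]; apply: (is_deriveM (is_derive_expRM (- K) s)).
  rewrite -[X in is_derive _ _ _ X]add0r; apply: is_deriveD.
  apply: is_deriveZ; apply: is_derive_prim => //; lra.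
have : E t - E 0 <= 0 - 0.
  apply: (increment_le E (fun=> 0) dE (fun=> 0) 0 t t0).
  - exact: derivable_within DE.
  - by move=> s; exact: cvg_cst.
  - by move=> s /andP[/ltW s0 /ltW st]; apply: DE; rewrite s0.
  - move=> s /andP[/ltW s0 /ltW st]; rewrite /dE.
    have := uK s; rewrite s0 (le_trans st tT) => /(_ isT) us.
    have -> : expR (- K * s) * (K * u s) +
      (A + K * prim u s) * (- K * expR (- K * s)) =
      - (expR (- K * s) * K * (A + K * prim u s - u s)) by ring.
    by rewrite oppr_le0 !mulr_ge0 ?expR_ge0 ?subr_ge0// ltW.
rewrite /E prim0 !mulr0 addr0 expR0 mul1r subr0 subr_le0 mulNr expRN => h.
by rewrite -ler_pdivrMr ?expR_gt0// mulrC.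
Qed.

End time.

(** * Domination and finite sums for real-valued integrals *)

Section integrals_in.
Context {dis : measure_display} {Om : measurableType dis} {R : realType}.
Variable mu : {measure set Om -> \bar R}.
Variables (D : set Om) (mD : measurable D).
Implicit Types f g : Om -> R.

Lemma integrable_dom_in f g : measurable_fun D f ->
  mu.-integrable D (EFin \o g) -> (forall x, D x -> `|f x| <= g x) ->
  mu.-integrable D (EFin \o f).
Proof.
move=> mf ig fg; apply: le_integrable ig => //.
  exact/measurable_EFinP.
by move=> x Dx /=; rewrite lee_fin (le_trans (fg x Dx))// ler_norm.
Qed.

Lemma Rintegral_abs_le_in f g : measurable_fun D f ->
  mu.-integrable D (EFin \o g) -> (forall x, D x -> `|f x| <= g x) ->
  `|\int[mu]_(x in D) f x| <= \int[mu]_(x in D) g x.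
Proof.
move=> mf ig fg; have fi := integrable_dom_in f g mf ig fg.
rewrite (le_trans (le_normr_Rintegral _ _))//; apply: le_Rintegral => //.
by have := integrable_norm fi.
Qed.

Lemma integrable_scale_in f c : mu.-integrable D (EFin \o f) ->
  mu.-integrable D (EFin \o (fun x => c * f x)).
Proof. exact: integrableZl. Qed.

Lemma integrable_add_in f g : mu.-integrable D (EFin \o f) ->
  mu.-integrable D (EFin \o g) ->
  mu.-integrable D (EFin \o (fun x => f x + g x)).
Proof. exact: integrableD. Qed.

Lemma integrable_sumr_in (I : Type) (r : seq I) (f : I -> Om -> R) :
  (forall i, mu.-integrable D (EFin \o f i)) ->
  mu.-integrable D (EFin \o (fun x => \sum_(i <- r) f i x)).
Proof.
move=> fi; elim: r => [|i r IH].
  rewrite (_ : _ \o _ = cst 0%E); first exact: integrable0.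
  by apply/funext => x /=; rewrite big_nil.
rewrite (_ : _ \o _ = EFin \o (fun x => f i x + \sum_(j <- r) f j x)).
  exact: integrable_add_in.
by apply/funext => x /=; rewrite big_cons.
Qed.

Lemma Rintegral_sumr_in (I : Type) (r : seq I) (f : I -> Om -> R) :
  (forall i, mu.-integrable D (EFin \o f i)) ->
  \int[mu]_(x in D) (\sum_(i <- r) f i x) = \sum_(i <- r) \int[mu]_(x in D) f i x.
Proof.
move=> fi; elim: r => [|i r IH].
  rewrite big_nil; under eq_Rintegral do rewrite big_nil.
  by rewrite Rintegral_cst// mul0r.
rewrite big_cons -IH -RintegralD//; last exact: integrable_sumr_in.
by apply: eq_Rintegral => x _; rewrite big_cons.
Qed.

End integrals_in.

Section integrals.
Context {dis : measure_display} {Om : measurableType dis} {R : realType}.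
Variable mu : {measure set Om -> \bar R}.
Implicit Types f g : Om -> R.

Lemma integrable_dom f g : measurable_fun setT f ->
  mu.-integrable setT (EFin \o g) -> (forall x, `|f x| <= g x) ->
  mu.-integrable setT (EFin \o f).
Proof. by move=> mf ig fg; apply: (integrable_dom_in mu setT measurableT f g). Qed.

Lemma Rintegral_le f g :
  mu.-integrable setT (EFin \o f) -> mu.-integrable setT (EFin \o g) ->
  (forall x, f x <= g x) -> \int[mu]_x f x <= \int[mu]_x g x.
Proof. by move=> fi gi fg; apply: le_Rintegral. Qed.

Lemma Rintegral_abs_le f g : measurable_fun setT f ->
  mu.-integrable setT (EFin \o g) -> (forall x, `|f x| <= g x) ->
  `|\int[mu]_x f x| <= \int[mu]_x g x.
Proof. by move=> mf ig fg; apply: Rintegral_abs_le_in. Qed.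

Lemma integrable_scale f c : mu.-integrable setT (EFin \o f) ->
  mu.-integrable setT (EFin \o (fun x => c * f x)).
Proof. exact: integrable_scale_in. Qed.

Lemma integrable_add f g : mu.-integrable setT (EFin \o f) ->
  mu.-integrable setT (EFin \o g) ->
  mu.-integrable setT (EFin \o (fun x => f x + g x)).
Proof. exact: integrable_add_in. Qed.

Lemma integrable_sumr (I : Type) (r : seq I) (f : I -> Om -> R) :
  (forall i, mu.-integrable setT (EFin \o f i)) ->
  mu.-integrable setT (EFin \o (fun x => \sum_(i <- r) f i x)).
Proof. exact: integrable_sumr_in. Qed.

Lemma Rintegral_sumr (I : Type) (r : seq I) (f : I -> Om -> R) :
  (forall i, mu.-integrable setT (EFin \o f i)) ->
  \int[mu]_x (\sum_(i <- r) f i x) = \sum_(i <- r) \int[mu]_x f i x.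
Proof. exact: Rintegral_sumr_in. Qed.

End integrals.

(** * Vector increments, geometric convergence and the weight 1 + |x| *)

Section vector_calculus.
Context {R : realType} {d : nat}.
Notation T := 'rV[R]_d.

Lemma vec_increment_le (F f : R -> T) (G g : R -> R) (a b : R) : a <= b ->
  (forall s i, a <= s <= b -> is_derive s 1 (fun u => F u 0 i) (f s 0 i)) ->
  (forall s, a <= s <= b -> is_derive s 1 G (g s)) ->
  (forall s, a <= s <= b -> `|f s| <= g s) ->
  `|F b - F a| <= G b - G a.
Proof.
move=> ab dF dG fg.
have h i : `|F b 0 i - F a 0 i| <= G b - G a.
  apply: (abs_increment_le (fun u => F u 0 i) G (fun u => f u 0 i) g a b ab _ dG).
  by move=> s sab; rewrite (le_trans (coord_norm_le _ _)) ?fg.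
apply: rV_norm_le => [|i]; last by rewrite !mxE.
suff : 0 - 0 <= G b - G a by rewrite subrr.
have z (s : R) : is_derive s 1 (fun _ : R => 0 : R) 0 by exact: is_derive_cst.
have W s : a < s < b -> a <= s <= b by move=> /andP[/ltW -> /ltW ->].
apply: (increment_le (fun=> 0) G (fun=> 0) g a b ab).
- by move=> s; exact: cvg_cst.
- exact: derivable_within dG.
- by move=> s /W; exact: dG.
- by move=> s /W /fg; exact: le_trans.
Qed.

(** Completeness through a geometric series: the tail after n steps is at most twice the bound on
    the n-th increment. *)
Lemma geometric_cvg (u : nat -> T) (C : R) :
  (forall n, `|u n.+1 - u n| <= C * 2^-1 ^+ n) ->
  exists l : T, u @ \oo --> l /\ forall n, `|l - u n| <= 2 * C * 2^-1 ^+ n.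
Proof.
move=> uC.
have C0 : 0 <= C by have := uC 0%N; rewrite expr0 mulr1; apply: le_trans.
have tail n k : `|u (n + k)%N - u n| <= 2 * C * 2^-1 ^+ n * (1 - 2^-1 ^+ k).
  elim: k => [|k IH]; first by rewrite addn0 !subrr normr0 mulr0.
  rewrite addnS -(subrKA (u (n + k)%N)) (le_trans (ler_normD _ _))//.
  rewrite (le_trans (lerD (uC _) IH))// exprD exprS.
  by rewrite le_eqVlt; apply/orP; left; apply/eqP; field.
have tail2 n m : (n <= m)%N -> `|u m - u n| <= 2 * C * 2^-1 ^+ n.
  move=> nm; rewrite -(subnKC nm) (le_trans (tail _ _))// ler_piMr//.
  by rewrite !mulr_ge0// exprn_ge0// invr_ge0.
have cv0 : 2 * C * 2^-1 ^+ n @[n --> \oo] --> (0 : R).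
  rewrite -(mulr0 (2 * C)); apply: cvgMr; apply: cvg_expr.
  by rewrite ger0_norm ?invr_ge0// invf_lt1// ltr1n.
have : cvg (u @ \oo).
  apply/cauchy_cvgP/cauchy_exP => e e0.
  have [N _ Ne] : \forall n \near \oo, 2 * C * 2^-1 ^+ n < e.
    exact: cvgr_lt cv0 _ e0.
  exists (u N); exists N => // n /= nN.
  by rewrite -ball_normE/= distrC (le_lt_trans (tail2 _ _ nN))// Ne/=.
move=> /cvg_ex[l ul]; exists l; split => // n.
have : `|u m - u n| @[m --> \oo] --> `|l - u n|.
  by apply: cvg_norm; apply: cvgB => //; exact: cvg_cst.
move=> h; apply: (cvgr_to_le h).
by exists n => // m; exact: tail2.
Qed.

Lemma locally_lip_continuous_at {V W : normedModType R} (f : V -> W) (A : R) (v : V) :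
  (forall u, `|u - v| <= 1 -> `|f u - f v| <= A * `|u - v|) ->
  {for v, continuous f}.
Proof.
move=> fA; apply/cvgrPdist_le => /= e e0.
have A0 : 0 < `|A| + 1 by rewrite ltr_wpDl.
near=> u; rewrite distrC.
have u1 : `|u - v| <= 1.
  by rewrite distrC; near: u; apply: cvgr_dist_le; first exact: cvg_id.
apply: (le_trans (fA _ u1)).
rewrite (@le_trans _ _ ((`|A| + 1) * `|u - v|))//.
  by rewrite ler_wpM2r// (le_trans (ler_norm _))// lerDl.
rewrite -ler_pdivlMl// distrC.
near: u; apply: cvgr_dist_le; first exact: cvg_id.
by rewrite mulr_gt0// invr_gt0.
Unshelve. all: by end_near. Qed.

(** Weight against which growth and distances of maps are measured; unlike the norm it is bounded
    below by 1, so one may divide by it. *)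
Definition wt (x : T) : R := 1 + `|x|.

Lemma wt_gt0 x : 0 < wt x. Proof. by rewrite ltr_wpDr. Qed.

Lemma wt_ge0 x : 0 <= wt x. Proof. exact/ltW/wt_gt0. Qed.

Lemma wt_ge1 x : 1 <= wt x. Proof. by rewrite lerDl. Qed.

Lemma norm_le_wt x : `|x| <= wt x. Proof. by rewrite lerDr. Qed.

Lemma wt_le_sqr x : wt x <= wt x ^+ 2.
Proof. by rewrite expr2 ler_peMr ?wt_ge0 ?wt_ge1. Qed.

Lemma continuous_wt : continuous wt.
Proof.
apply: (@lip_continuous _ _ _ _ 1) => x y.
by rewrite mul1r (_ : wt x - wt y = `|x| - `|y|) ?ler_dist_dist// /wt; ring.
Qed.

Lemma wt_lip x y : wt x <= wt y + `|x - y|.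
Proof. by rewrite /wt -addrA lerD2l addrC -{1}(subrK y x) ler_normD. Qed.

End vector_calculus.

(** * Integrals of functions of quadratic growth *)

Section second_moment.
Context {R : realType} {d : nat}.
Notation T := 'rV[R]_d.
Variable mu : probability T R.
Hypothesis mu2 : mu.-integrable setT (EFin \o (fun x : T => wt x ^+ 2)).

Lemma integrable_wt2 (f : T -> R) K : continuous f ->
  (forall x, `|f x| <= K * wt x ^+ 2) -> mu.-integrable setT (EFin \o f).
Proof.
move=> cf fK; apply: (integrable_dom mu f (fun x => K * wt x ^+ 2)) => //.
  exact: continuous_measurable_rV.
exact: integrable_scale.
Qed.

Lemma Rintegral_prob_cst (c : R) : \int[mu]_x c = c.
Proof.
by rewrite Rintegral_cst//; have /= -> := probability_setT mu; rewrite mulr1.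
Qed.

Lemma integrable_prob_cst (c : R) : mu.-integrable setT (EFin \o (fun _ : T => c)).
Proof. by apply: finite_measure_integrable_cst. Qed.

Lemma vec_integral_le (F : T -> T) (g : T -> R) : continuous F ->
  mu.-integrable setT (EFin \o g) -> (forall x, `|F x| <= g x) ->
  `|\row_i \int[mu]_x F x 0 i| <= \int[mu]_x g x.
Proof.
move=> cF ig Fg; apply: rV_norm_le => [|i].
  by apply: Rintegral_ge0 => x _; exact: le_trans (Fg x).
rewrite mxE; apply: Rintegral_abs_le => //.
  by apply: continuous_measurable_rV; exact: continuous_coord.
by move=> x; rewrite (le_trans (coord_norm_le _ _)).
Qed.

End second_moment.

(** * The velocity field created by a transported measure *)

Section velocity.
Context {R : realType} {d : nat}.
Notation T := 'rV[R]_d.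
Variables (mu : probability T R) (b : T -> T -> T) (Cb : R).
Hypothesis Cb0 : 0 < Cb.
Hypothesis mu2 : mu.-integrable setT (EFin \o (fun x : T => wt x ^+ 2)).
Hypothesis b_growth : forall z y, `|b z y| <= Cb * (wt z * wt y ^+ 2).
Hypothesis b_lip : forall z y z' y', `|b z y - b z' y'| <=
  Cb * (`|z - z'| * wt y ^+ 2 + `|y - y'| * (wt y + wt y') * wt z').

Lemma continuous_interaction z : continuous (b z).
Proof.
move=> v.
apply: (@locally_lip_continuous_at _ _ _ _ (Cb * ((2 * wt v + 1) * wt z))).
move=> u uv; rewrite (le_trans (b_lip _ _ _ _))// subrr normr0 mul0r add0r.
rewrite -!mulrA ler_pM2l// mulrC -!mulrA [leLHS]mulrCA.
rewrite [leLHS]mulrC -[leLHS]mulrA [X in _ <= _ * X]mulrC ler_wpM2r//.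
  by rewrite mulr_ge0// wt_ge0.
by have := wt_lip u v; lra.
Qed.

(** Class in which the flow maps live: linear growth makes [b z (X y)] integrable in [y], since [b]
    is at most quadratic in its second argument. *)
Definition adm (A : R) (X : T -> T) :=
  continuous X /\ forall x, `|X x| <= A * wt x.

Lemma adm_ge0 A X : adm A X -> 0 <= A.
Proof.
move=> [_ /(_ 0)]; rewrite /wt normr0 addr0 mulr1; exact: le_trans.
Qed.

Lemma adm_wt A X x : adm A X -> wt (X x) <= (1 + A) * wt x.
Proof.
move=> [_ /(_ x) h]; rewrite mulrDl mul1r /wt in h *.
by have : 0 <= `|x| by []; lra.
Qed.

Lemma adm_wt2 A X x : adm A X -> wt (X x) ^+ 2 <= (1 + A) ^+ 2 * wt x ^+ 2.
Proof.
move=> aX; have A0 := adm_ge0 A X aX; rewrite -exprMn lerXn2r ?nnegrE ?wt_ge0 ?mulr_ge0 ?addr_ge0 ?wt_ge0//.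
exact: adm_wt.
Qed.

Lemma admW A B X : A <= B -> adm A X -> adm B X.
Proof.
by move=> AB [cX XA]; split=> // x; rewrite (le_trans (XA x))// ler_wpM2r ?wt_ge0.
Qed.

Definition m2 (X : T -> T) : R := \int[mu]_y (wt (X y) ^+ 2).

(** Velocity created at [z] by the image of [mu] under [X]. Integrating against the fixed [mu] turns
    an evolution of measures into an ordinary differential equation for maps. *)
Definition vel (X : T -> T) (z : T) : T := \row_i \int[mu]_y (b z (X y) 0 i).

Let M : R := \int[mu]_y (wt y ^+ 2).

Lemma continuous_wt2 (X : T -> T) : continuous X ->
  continuous (fun y : T => wt (X y) ^+ 2 : R).
Proof.
move=> cX y; apply: (@continuous_comp _ _ _ (fun y => wt (X y)) (fun u : R => u ^+ 2 : R)).
  apply: (@continuous_comp _ _ _ X wt); [exact: cX|exact: continuous_wt].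
exact: exprn_continuous.
Qed.

Lemma moment_ge1 : 1 <= M.
Proof.
rewrite -[leLHS](Rintegral_prob_cst mu); apply: Rintegral_le => //.
  exact: integrable_prob_cst.
by move=> x; rewrite expr_ge1 ?wt_ge0 ?wt_ge1.
Qed.

Lemma continuous_interactionX X z : continuous X -> continuous (fun y : T => b z (X y)).
Proof.
move=> cX y; apply: (@continuous_comp _ _ _ X (b z)); first exact: cX.
exact: continuous_interaction.
Qed.

Lemma integrable_wt2X A X : adm A X ->
  mu.-integrable setT (EFin \o (fun y => wt (X y) ^+ 2)).
Proof.
move=> aX; apply: (integrable_wt2 mu mu2 _ ((1 + A) ^+ 2)).
  by apply: continuous_wt2; case: aX.
by move=> y; rewrite ger0_norm ?sqr_ge0//; exact: adm_wt2.
Qed.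

Lemma integrable_interactionX A X z i : adm A X ->
  mu.-integrable setT (EFin \o (fun y => b z (X y) 0 i)).
Proof.
move=> aX; apply: (integrable_dom mu _ (fun y => Cb * wt z * wt (X y) ^+ 2)).
- apply: continuous_measurable_rV; apply: continuous_coord.
  by apply: continuous_interactionX; case: aX.
- by apply: integrable_scale; exact: integrable_wt2X aX.
- by move=> y; rewrite (le_trans (coord_norm_le _ _))// -mulrA b_growth.
Qed.

Lemma m2_le A X : adm A X -> m2 X <= (1 + A) ^+ 2 * M.
Proof.
move=> aX; rewrite -RintegralZl//; apply: Rintegral_le.
- exact: integrable_wt2X aX.
- exact: integrable_scale.
- by move=> y; exact: adm_wt2.
Qed.

Lemma vel_bound A X z : adm A X -> `|vel X z| <= Cb * wt z * m2 X.
Proof.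
move=> aX; rewrite -RintegralZl//; last exact: integrable_wt2X aX.
apply: (vec_integral_le mu (fun y => b z (X y))).
- by apply: continuous_interactionX; case: aX.
- by apply: integrable_scale; exact: integrable_wt2X aX.
- by move=> y; rewrite -mulrA b_growth.
Qed.

(** [D] is a distance of the two maps in weighted sup norm. The two terms of [b_lip] integrate
    separately; the constants grow with [A], so the dependence on the map is only locally
    Lipschitz. *)
Lemma vel_diff A X Y D z z' : adm A X -> adm A Y ->
  (forall y, `|X y - Y y| <= D * wt y) ->
  `|vel X z - vel Y z'| <=
  Cb * (`|z - z'| * (1 + A) ^+ 2 + D * (2 * (1 + A)) * wt z') * M.
Proof.
move=> aX aY XY; have A0 := adm_ge0 A X aX.
have -> : vel X z - vel Y z' = \row_i \int[mu]_y ((b z (X y) - b z' (Y y)) 0 i).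
  apply/rowP => i; rewrite !mxE -RintegralB//.
  - by apply: eq_Rintegral => y _; rewrite !mxE.
  - exact: integrable_interactionX aX.
  - exact: integrable_interactionX aY.
rewrite -RintegralZl//.
apply: (vec_integral_le mu (fun y => b z (X y) - b z' (Y y))).
- by apply: continuous_sub; apply: continuous_interactionX; [case: aX|case: aY].
- exact: integrable_scale.
- move=> y; rewrite (le_trans (b_lip _ _ _ _))// -[leRHS]mulrA ler_pM2l// mulrDl.
  rewrite lerD//.
    by rewrite -mulrA ler_wpM2l// adm_wt2.
  have w : wt (X y) + wt (Y y) <= 2 * (1 + A) * wt y.
    by have := adm_wt A X y aX; have := adm_wt A Y y aY; lra.
  rewrite (_ : _ * wt y ^+ 2 = (D * wt y) * (2 * (1 + A) * wt y) * wt z').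
    by rewrite ler_wpM2r ?wt_ge0// ler_pM// addr_ge0// wt_ge0.
  by ring.
Qed.

Lemma vel_lip A X z z' : adm A X ->
  `|vel X z - vel X z'| <= Cb * (1 + A) ^+ 2 * M * `|z - z'|.
Proof.
move=> aX; rewrite (le_trans (vel_diff A X X 0 z z' aX aX _))//.
  by move=> y; rewrite subrr normr0 mul0r.
by rewrite le_eqVlt; apply/orP; left; apply/eqP; ring.
Qed.

(** Weighted sup norm. The real [sup] of an unbounded set is a default value, so [le_wnorm] and
    [wnorm_diff] carry a growth bound [A] that serves only to guarantee boundedness. *)
Definition wnorm (X : T -> T) : R := sup [set `|X x| / wt x | x in [set: T]].

Lemma wnorm_le A X : (forall x, `|X x| <= A * wt x) -> wnorm X <= A.
Proof.
move=> XA; apply: ge_sup; first by exists (`|X 0| / wt (0 : T)); exists 0.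
by move=> _ [x _ <-]; rewrite ler_pdivrMr ?wt_gt0.
Qed.

Lemma le_wnorm A X x : (forall x, `|X x| <= A * wt x) ->
  `|X x| <= wnorm X * wt x.
Proof.
move=> XA; rewrite -ler_pdivrMr ?wt_gt0//; apply: ub_le_sup; last by exists x.
by exists A => _ [y _ <-]; rewrite ler_pdivrMr ?wt_gt0.
Qed.

Lemma wnorm_diff A X Y D : (forall x, `|Y x| <= A * wt x) ->
  (forall x, `|X x - Y x| <= D * wt x) -> wnorm X <= wnorm Y + D.
Proof.
move=> YA XY; apply: wnorm_le => x; rewrite mulrDl -(subrK (Y x) (X x)) addrC.
by rewrite (le_trans (ler_normD _ _))// lerD//; exact: le_wnorm YA.
Qed.

End velocity.

(** * Picard iteration for the truncated equation *)

Section picard.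
Context {R : realType} {d : nat}.
Notation T := 'rV[R]_d.
Variables (mu : probability T R) (b : T -> T -> T) (Cb : R).
Hypothesis Cb0 : 0 < Cb.
Hypothesis mu2 : mu.-integrable setT (EFin \o (fun x : T => wt x ^+ 2)).
Hypothesis b_growth : forall z y, `|b z y| <= Cb * (wt z * wt y ^+ 2).
Hypothesis b_lip : forall z y z' y', `|b z y - b z' y'| <=
  Cb * (`|z - z'| * wt y ^+ 2 + `|y - y'| * (wt y + wt y') * wt z').
Variable rad : R -> R.
Hypothesis rad_cont : continuous rad.
Hypothesis rad_ge0 : forall t, 0 <= t -> 0 <= rad t.
Hypothesis rad_ndecr : forall s t, 0 <= s -> s <= t -> rad s <= rad t.

Let M : R := \int[mu]_y (wt y ^+ 2).
Notation vel := (vel mu b).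

(** Equal to 1 when [wnorm X <= rad t], to 0 when [wnorm X >= 1 + rad t], and 1-Lipschitz in
    [wnorm X]. It makes the field Lipschitz in the map on bounded time intervals. The radius stays a
    parameter, to be fixed once the a priori bounds are known. *)
Definition cutoff t (X : T -> T) : R :=
  Num.max 0 (Num.min 1 (1 + rad t - wnorm X)).

Definition field t (X : T -> T) (x : T) : T := cutoff t X *: vel X (X x).

(** For a growth bound [B], [speed] bounds the field, [slope] is its Lipschitz constant in position
    and [modulus] its Lipschitz constant in the map: the 3 collects the terms of [vel_diff], and
    [speed] accounts for the variation of the cutoff. *)
Definition speed B := Cb * (1 + B) ^+ 3 * M.
Definition slope B := Cb * (1 + B) ^+ 2 * M.
Definition modulus B := 3 * slope B + speed B.

Let M0 : 0 <= M. Proof. exact: le_trans (moment_ge1 mu mu2). Qed.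

Lemma speed_ge0 B : 0 <= B -> 0 <= speed B.
Proof. by move=> B0; rewrite !mulr_ge0 ?exprn_ge0 ?addr_ge0// ltW. Qed.

Lemma slope_gt0 B : 0 <= B -> 0 < slope B.
Proof.
move=> B0; rewrite !mulr_gt0 ?exprn_gt0 ?ltr_wpDr//.
exact: lt_le_trans (moment_ge1 mu mu2).
Qed.

Lemma modulus_gt0 B : 0 <= B -> 0 < modulus B.
Proof. by move=> B0; rewrite ltr_wpDr ?speed_ge0// mulr_gt0// slope_gt0. Qed.

Lemma clamp_lip (u v : R) :
  `|Num.max 0 (Num.min 1 u) - Num.max 0 (Num.min 1 v)| <= `|u - v|.
Proof.
have uv := ler_norm (u - v); have vu := ler_norm (v - u).
rewrite distrC in vu; rewrite ler_norml.
have c (x : R) : [\/ Num.max 0 (Num.min 1 x) = 0 /\ x <= 0,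
    Num.max 0 (Num.min 1 x) = x /\ 0 <= x <= 1 |
    Num.max 0 (Num.min 1 x) = 1 /\ 1 <= x].
  have [x1|x1] := lerP 1 x; first by rewrite max_r//; exact: Or33.
  have [x0|x0] := lerP 0 x; first by apply: Or32; split => //=; exact: ltW.
  by apply: Or31; split => //=; exact: ltW.
by have [[-> ?]|[-> ?]|[-> ?]] := c u; have [[-> ?]|[-> ?]|[-> ?]] := c v; lra.
Qed.

Lemma cutoff_ge0 t X : 0 <= cutoff t X.
Proof. by rewrite /cutoff le_max lexx. Qed.

Lemma cutoff_le1 t X : cutoff t X <= 1.
Proof. by rewrite /cutoff ge_max ler01/= ge_min lexx. Qed.

Lemma cutoff_eq1 t X : wnorm X <= rad t -> cutoff t X = 1.
Proof.
move=> h; rewrite /cutoff min_l; last by lra.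
by rewrite max_r.
Qed.

Lemma cutoff_adm t A X : cutoff t X != 0 -> adm A X -> adm (1 + rad t) X.
Proof.
move=> c0 [cX XA]; split=> // x.
rewrite (le_trans (le_wnorm A X x XA))// ler_wpM2r ?wt_ge0//.
rewrite leNgt; apply: contra c0 => h; apply/eqP; rewrite /cutoff max_l//.
by rewrite ge_min; apply/orP; right; lra.
Qed.

Lemma cutoff_diff t A A' X Y D : adm A X -> adm A' Y ->
  (forall x, `|X x - Y x| <= D * wt x) -> `|cutoff t X - cutoff t Y| <= D.
Proof.
move=> [_ aX] [_ aY] XY; rewrite (le_trans (clamp_lip _ _))//.
have h1 := wnorm_diff _ _ _ _ aY XY.
have YX x : `|Y x - X x| <= D * wt x by rewrite distrC.
have h2 := wnorm_diff _ _ _ _ aX YX.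
by rewrite ler_norml; lra.
Qed.

Lemma cutoff_time s t X : `|cutoff t X - cutoff s X| <= `|rad t - rad s|.
Proof.
rewrite (le_trans (clamp_lip _ _))//.
by rewrite (_ : 1 + rad t - wnorm X - _ = rad t - rad s)//; ring.
Qed.

Section bounds.
Variables (S t : R).
Hypothesis t0 : 0 <= t.
Hypothesis tS : t <= S.
Let B := 1 + rad S.

Let B0 : 0 <= B.
Proof. by rewrite addr_ge0// rad_ge0// (le_trans t0). Qed.

Lemma cutoff_admS A X : cutoff t X != 0 -> adm A X -> adm B X.
Proof.
move=> c0 aX; apply: admW (cutoff_adm _ _ _ c0 aX).
by rewrite lerD2l rad_ndecr.
Qed.

Lemma adm_vel_bound X x : adm B X -> `|vel X (X x)| <= speed B * wt x.
Proof.
move=> aX; rewrite (le_trans (vel_bound mu b Cb Cb0 mu2 b_growth b_lip B X (X x) aX))//.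
have -> : speed B * wt x = Cb * ((1 + B) * wt x) * ((1 + B) ^+ 2 * M).
  by rewrite /speed; ring.
apply: ler_pM.
- by rewrite mulr_ge0 ?wt_ge0// ltW.
- by apply: Rintegral_ge0 => y _; exact: sqr_ge0.
- by rewrite ler_pM2l// adm_wt.
- exact: m2_le.
Qed.

Lemma field_bound A X x : adm A X -> `|field t X x| <= speed B * wt x.
Proof.
move=> aX; have [c0|c0] := eqVneq (cutoff t X) 0.
  by rewrite /field c0 scale0r normr0 mulr_ge0 ?wt_ge0 ?speed_ge0.
rewrite normrZ (ger0_norm (cutoff_ge0 _ _)) -[leRHS]mul1r ler_pM ?cutoff_ge0//.
  exact: cutoff_le1.
exact/adm_vel_bound/(cutoff_admS A).
Qed.

Lemma field_lip A X x y : adm A X ->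
  `|field t X x - field t X y| <= slope B * `|X x - X y|.
Proof.
move=> aX; have [c0|c0] := eqVneq (cutoff t X) 0.
  by rewrite /field c0 !scale0r subrr normr0 mulr_ge0// ltW// slope_gt0.
rewrite -scalerBr normrZ (ger0_norm (cutoff_ge0 _ _)) -[leRHS]mul1r.
rewrite ler_pM ?cutoff_ge0 ?cutoff_le1//.
by apply: vel_lip => //; exact: (cutoff_admS A).
Qed.

(** Where its cutoff vanishes, a map need not satisfy the growth bound [B], hence the four cases. If
    exactly one cutoff vanishes, the other is at most [D] by the Lipschitz property; if none does,
    both maps grow at most like [B] and the product is differenced. *)
Lemma field_diff A A' X Y D x : adm A X -> adm A' Y ->
  (forall x, `|X x - Y x| <= D * wt x) ->
  `|field t X x - field t Y x| <= modulus B * D * wt x.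
Proof.
move=> aX aY XY.
have D0 : 0 <= D.
  have := XY 0; rewrite /wt normr0 addr0 mulr1; exact: le_trans.
have cD := cutoff_diff t _ _ _ _ _ aX aY XY.
have K0 : 0 <= speed B by exact: speed_ge0.
have L0 : 0 <= slope B by apply/ltW/slope_gt0.
have w0 : 0 <= D * wt x by rewrite mulr_ge0// wt_ge0.
have a0 : 0 <= 3 * slope B * (D * wt x).
  by apply: mulr_ge0 => //; apply: mulr_ge0.
have s0 : 0 <= D * (speed B * wt x).
  by apply: mulr_ge0 => //; apply: mulr_ge0 => //; exact: wt_ge0.
have -> : modulus B * D * wt x =
  3 * slope B * (D * wt x) + D * (speed B * wt x) by rewrite /modulus; ring.
have [cX|cX] := eqVneq (cutoff t X) 0; have [cY|cY] := eqVneq (cutoff t Y) 0.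
- by rewrite /field cX cY !scale0r subrr normr0 addr_ge0.
- rewrite /field cX scale0r sub0r normrN normrZ -[leLHS]add0r lerD//.
  apply: ler_pM => //.
    by rewrite cX sub0r normrN in cD.
  exact/adm_vel_bound/(cutoff_admS A').
- rewrite /field cY scale0r subr0 normrZ -[leLHS]add0r lerD//.
  apply: ler_pM => //.
    by rewrite cY subr0 in cD.
  exact/adm_vel_bound/(cutoff_admS A).
- have bX := cutoff_admS A X cX aX; have bY := cutoff_admS A' Y cY aY.
  have -> : field t X x - field t Y x =
    cutoff t X *: (vel X (X x) - vel Y (Y x)) +
    (cutoff t X - cutoff t Y) *: vel Y (Y x).
    by rewrite /field scalerBr scalerBl subrKA.
  rewrite (le_trans (ler_normD _ _))// !normrZ lerD//; last first.
    by apply: ler_pM => //; exact: adm_vel_bound.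
  rewrite (ger0_norm (cutoff_ge0 _ _)) -[leRHS]mul1r.
  apply: ler_pM; rewrite ?cutoff_ge0 ?cutoff_le1//.
  apply: (le_trans (vel_diff mu b Cb Cb0 mu2 b_growth b_lip _ _ _ _ _ _ bX bY XY)).
  have -> : 3 * slope B * (D * wt x) = Cb * (D * wt x * (1 + B) ^+ 2 +
    D * (2 * (1 + B)) * ((1 + B) * wt x)) * M by rewrite /slope; ring.
  rewrite ler_wpM2r// ler_pM2l// lerD//.
    by rewrite ler_wpM2r// sqr_ge0.
  rewrite ler_wpM2l//; last exact: adm_wt.
  by rewrite !mulr_ge0// addr_ge0.
Qed.

End bounds.

(** Composition with the positive part of time extends functions controlled only for nonnegative
    times to continuous functions on the whole line, as [prim] requires. *)
Definition tpos (t : R) := Num.max t 0.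

Lemma tpos_ge0 t : 0 <= tpos t.
Proof. by rewrite le_max lexx orbT. Qed.

Lemma tpos_id t : 0 <= t -> tpos t = t.
Proof. by move=> t0; rewrite /tpos max_l. Qed.

Lemma tpos_lip s t : `|tpos s - tpos t| <= `|s - t|.
Proof.
have uv := ler_norm (s - t); have vu := ler_norm (t - s).
rewrite distrC in vu; rewrite ler_norml.
have c (x : R) : (tpos x = x /\ 0 <= x) \/ (tpos x = 0 /\ x <= 0).
  rewrite /tpos; have [x0|x0] := leP x 0; first by right.
  by left; split => //; exact: ltW.
by have [[-> ?]|[-> ?]] := c s; have [[-> ?]|[-> ?]] := c t; lra.
Qed.

Lemma continuous_tpos : continuous tpos.
Proof. by apply: (@lip_continuous _ _ _ _ 1) => s t; rewrite mul1r tpos_lip. Qed.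

Let B S := 1 + rad S.

Let B0 S : 0 <= S -> 0 <= B S.
Proof. by move=> S0; rewrite addr_ge0// rad_ge0. Qed.

(** Invariant of the iteration: an exponential Lipschitz bound in space and a weighted Lipschitz
    bound in time on every horizon [S]. Its constants come from the truncated field alone, so they
    pass to the limit. *)
Definition good (X : R -> T -> T) := (forall x, X 0 x = x) /\
  forall S s t, 0 <= s <= S -> 0 <= t <= S -> forall x y,
    `|X t x - X t y| <= expR (slope (B S) * t) * `|x - y| /\
    `|X t x - X s x| <= speed (B S) * `|t - s| * wt x.

Lemma good_adm X S t : good X -> 0 <= t <= S -> adm (1 + speed (B S) * S) (X t).
Proof.
move=> [X0 gX] /andP[t0 tS]; have S0 := le_trans t0 tS; split.
  apply: (@lip_continuous _ _ _ _ (expR (slope (B S) * t))) => x y.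
  by have := gX S t t; rewrite t0 tS => /(_ isT isT x y)[].
move=> x; have := gX S 0 t; rewrite lexx S0 t0 tS => /(_ isT isT x x)[_].
rewrite X0 subr0 (ger0_norm t0) => h.
rewrite -(subrK x (X t x)) (le_trans (ler_normD _ _))// mulrDl mul1r addrC.
rewrite lerD ?norm_le_wt// (le_trans h)// ler_wpM2r ?wt_ge0// ler_wpM2l//.
exact/speed_ge0/B0.
Qed.

Lemma good_field_cont X x : good X ->
  continuous (fun s : R => field (tpos s) (X (tpos s)) x).
Proof.
move=> gX s0; pose S := tpos s0 + 1.
have S00 : 0 <= tpos s0 <= S by rewrite tpos_ge0 /= /S lerDl.
have S0 : 0 <= S by case/andP: S00; exact: le_trans.
pose C1 := modulus (B S) * speed (B S) * wt x.
pose C2 := `|vel (X (tpos s0)) (X (tpos s0) x)|.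
pose h s := C1 * `|tpos s - tpos s0| + `|rad (tpos s) - rad (tpos s0)| * C2.
have ch : continuous h.
  apply: continuous_add; apply: continuous_mul.
  - by move=> u; exact: cvg_cst.
  - apply: (continuous_comp_fun (fun u : R => `|u| : R)); last exact: norm_continuous.
    by apply: continuous_sub; [exact: continuous_tpos|move=> u; exact: cvg_cst].
  - apply: (continuous_comp_fun (fun u : R => `|u| : R)); last exact: norm_continuous.
    apply: continuous_sub; last by move=> u; exact: cvg_cst.
    by apply: (continuous_comp_fun rad) => //; exact: continuous_tpos.
  - by move=> u; exact: cvg_cst.
have h0 : h s0 = 0 by rewrite /h !subrr !normr0 mulr0 mul0r addr0.
apply/cvgrPdist_le => /= e e0; near=> s.
have sS : 0 <= tpos s <= S.
  rewrite tpos_ge0/=.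
  have : `|s0 - s| <= 1 by near: s; apply: cvgr_dist_le; first exact: cvg_id.
  rewrite distrC => /(le_trans (tpos_lip s s0)).
  by rewrite /S ler_norml => /andP[_]; lra.
have : `|h s0 - h s| <= e by near: s; apply: cvgr_dist_le e0; exact: ch.
rewrite h0 sub0r normrN => /(le_trans (ler_norm _)).
apply: le_trans; rewrite distrC.
(* The change of the map at a fixed cutoff radius is separated from the change of the radius at a
   fixed map. *)
have -> : field (tpos s) (X (tpos s)) x - field (tpos s0) (X (tpos s0)) x =
  (field (tpos s) (X (tpos s)) x - field (tpos s) (X (tpos s0)) x) +
  (field (tpos s) (X (tpos s0)) x - field (tpos s0) (X (tpos s0)) x).
  by rewrite subrKA.
rewrite (le_trans (ler_normD _ _))// lerD//.
  have sS' : tpos s <= S by case/andP: sS.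
  have XX y : `|X (tpos s) y - X (tpos s0) y| <=
      speed (B S) * `|tpos s - tpos s0| * wt y.
    by have [_ ] := gX.2 S (tpos s0) (tpos s) S00 sS y y.
  have := field_diff S (tpos s) (tpos_ge0 s) sS' _ _ _ _ _ x
    (good_adm _ _ _ gX sS) (good_adm _ _ _ gX S00) XX.
  by rewrite (_ : modulus _ * _ * _ = C1 * `|tpos s - tpos s0|)// /C1; ring.
rewrite -scalerBl normrZ ler_wpM2r//; exact: cutoff_time.
Unshelve. all: by end_near. Qed.

Definition picard (X : R -> T -> T) (t : R) (x : T) : T :=
  \row_i (x 0 i + prim (fun s => field (tpos s) (X (tpos s)) x 0 i) t).

Lemma picard0 X x : picard X 0 x = x.
Proof. by apply/rowP => i; rewrite mxE prim0 addr0. Qed.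

Lemma is_derive_picard X (t : R) (x : T) i : good X -> -1 < t ->
  is_derive t 1 (fun s : R => picard X s x 0 i) (field (tpos t) (X (tpos t)) x 0 i).
Proof.
move=> gX t1.
have -> : (fun s => picard X s x 0 i) = cst (x 0 i) \+
    prim (fun s => field (tpos s) (X (tpos s)) x 0 i).
  by apply/funext => s; rewrite mxE.
rewrite -[X in is_derive _ _ _ X]add0r; apply: is_deriveD.
apply: is_derive_prim => //; apply: continuous_coord.
exact: good_field_cont.
Qed.

Lemma is_derive_picard_ge0 X (t : R) (x : T) i : good X -> 0 <= t ->
  is_derive t 1 (fun s : R => picard X s x 0 i) (field t (X t) x 0 i).
Proof.
move=> gX t0; have := is_derive_picard X t x i gX.
by rewrite tpos_id//; apply; lra.
Qed.

(** The space bound reproduces itself because [slope] times [expR (slope * s)] is the derivative of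
    [expR (slope * s)]; the time bound is the bound [speed] on the field. *)
Lemma picard_good X : good X -> good (picard X).
Proof.
move=> gX; split; first exact: picard0.
move=> S s t /andP[s0 sS] /andP[t0 tS] x y; have S0 := le_trans t0 tS.
have Bp := B0 _ S0; split.
  pose F u := picard X u x - picard X u y.
  pose f u := field u (X u) x - field u (X u) y.
  pose G u := `|x - y| * expR (slope (B S) * u).
  pose g u := `|x - y| * (slope (B S) * expR (slope (B S) * u)).
  have F0 : F 0 = x - y by rewrite /F !picard0.
  have G0 : G 0 = `|x - y| by rewrite /G mulr0 expR0 mulr1.
  have h : `|F t - (x - y)| <= G t - `|x - y|.
    suff : `|F t - F 0| <= G t - G 0 by rewrite F0 G0.
    apply: (vec_increment_le F f G g 0 t t0) => u; last 1 first.
    - move=> /andP[u0 ut]; have uS := le_trans ut tS.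
      have uu : 0 <= u <= S by rewrite u0.
      rewrite (le_trans (field_lip S u u0 uS _ _ _ _ (good_adm _ _ _ gX uu)))//.
      rewrite /g mulrCA ler_wpM2l//; first exact/ltW/slope_gt0.
      by rewrite mulrC; have [] := gX.2 S u u uu uu x y.
    - move=> i /andP[u0 ut]; rewrite /F /f.
      have -> : (fun v => (picard X v x - picard X v y) 0 i) =
        (fun v => picard X v x 0 i) \- (fun v => picard X v y 0 i).
        by apply/funext => v; rewrite rV_subE.
      rewrite rV_subE; apply: is_deriveB; exact: is_derive_picard_ge0.
    - move=> _; apply: is_deriveZ; exact: is_derive_expRM.
  rewrite -/(F t) mulrC -/(G t) -(subrK (x - y) (F t)).
  by rewrite (le_trans (ler_normD _ _))// -lerBrDr.
wlog st : s t s0 sS t0 tS / s <= t.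
  move=> H; have [st|ts] := leP s t; first exact: H.
  by rewrite distrC [`|t - s|]distrC; apply: H => //; exact: ltW.
pose G u := (speed (B S) * wt x) * u.
have := vec_increment_le (fun u => picard X u x) (fun u => field u (X u) x)
  G (fun=> speed (B S) * wt x) s t st.
have -> : speed (B S) * `|t - s| * wt x = G t - G s.
  by rewrite ger0_norm ?subr_ge0// /G; ring.
apply => u; last 1 first.
- move=> /andP[su ut]; have u0 := le_trans s0 su; have uS := le_trans ut tS.
  have uu : 0 <= u <= S by rewrite u0.
  exact: (field_bound S u u0 uS _ _ _ (good_adm _ _ _ gX uu)).
- by move=> i /andP[su ut]; apply: is_derive_picard_ge0 => //; exact: le_trans su.
- move=> _; rewrite -[X in is_derive _ _ _ X]mulr1; exact: is_deriveZ.
Qed.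

Let rate S := 2 * modulus (B S).

(** Distances are weighted by an exponential in time. Integrating [modulus * D * expR (rate * s)]
    with [rate] equal to twice [modulus] gains a factor 1/2, however long the horizon. *)
Lemma picard_contraction X Y S D : good X -> good Y -> 0 <= D ->
  (forall t x, 0 <= t <= S -> `|X t x - Y t x| <= D * expR (rate S * t) * wt x) ->
  forall t x, 0 <= t <= S ->
  `|picard X t x - picard Y t x| <= D / 2 * expR (rate S * t) * wt x.
Proof.
move=> gX gY D0 XY t x /andP[t0 tS]; have S0 := le_trans t0 tS.
have Bp := B0 _ S0.
pose F u := picard X u x - picard Y u x.
pose f u := field u (X u) x - field u (Y u) x.
pose G u := (D / 2 * wt x) * expR (rate S * u).
pose g u := (D / 2 * wt x) * (rate S * expR (rate S * u)).
have F0 : F 0 = 0 by rewrite /F !picard0 subrr.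
have G0 : G 0 = D / 2 * wt x by rewrite /G mulr0 expR0 mulr1.
have h : `|F t| <= G t - D / 2 * wt x.
  suff : `|F t - F 0| <= G t - G 0 by rewrite F0 G0 subr0.
  apply: (vec_increment_le F f G g 0 t t0) => u; last 1 first.
  - move=> /andP[u0 ut]; have uS := le_trans ut tS.
    have uu : 0 <= u <= S by rewrite u0.
    have := field_diff S u u0 uS _ _ _ _ (D * expR (rate S * u)) x
      (good_adm _ _ _ gX uu) (good_adm _ _ _ gY uu) (fun y => XY u y uu).
    by rewrite (_ : _ * wt x = g u)// /g /rate; field.
  - move=> i /andP[u0 ut]; rewrite /F /f.
    have -> : (fun v => (picard X v x - picard Y v x) 0 i) =
      (fun v => picard X v x 0 i) \- (fun v => picard Y v x 0 i).
      by apply/funext => v; rewrite rV_subE.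
    rewrite rV_subE; apply: is_deriveB; exact: is_derive_picard_ge0.
  - move=> _; apply: is_deriveZ; exact: is_derive_expRM.
rewrite mulrAC -/(G t) (le_trans h)// gerBl mulr_ge0 ?wt_ge0//.
by rewrite divr_ge0.
Qed.

Fixpoint iterate n : R -> T -> T :=
  if n is n'.+1 then picard (iterate n') else fun _ x => x.

Lemma iterate_good n : good (iterate n).
Proof.
elim: n => [|n IH]; last exact: picard_good.
split=> // S s t /andP[s0 sS] /andP[t0 tS] x y; have Bp := B0 _ (le_trans t0 tS).
split => /=; last first.
  rewrite subrr normr0; apply: mulr_ge0; last exact: wt_ge0.
  by apply: mulr_ge0 => //; exact: speed_ge0.
rewrite -[leLHS]mul1r ler_wpM2r// -expR0 ler_expR mulr_ge0//.
exact/ltW/slope_gt0.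
Qed.

Let err S := speed (B S) * S.

Lemma iterate_diff n S t x : 0 <= t <= S ->
  `|iterate n.+1 t x - iterate n t x| <=
  err S * 2^-1 ^+ n * expR (rate S * t) * wt x.
Proof.
move=> tS; have S0 : 0 <= S by case/andP: tS; exact: le_trans.
have e0 : 0 <= err S by apply: mulr_ge0 => //; exact/speed_ge0/B0.
elim: n t x tS => [|n IH] t x tS; last first.
  rewrite exprS (_ : err S * _ = err S * 2^-1 ^+ n / 2); last by ring.
  apply: picard_contraction => //; [exact: (iterate_good n.+1)|exact: iterate_good|].
  by rewrite mulr_ge0// exprn_ge0// invr_ge0.
rewrite expr0 mulr1 /=; case/andP: tS => t0 tS.
have := (iterate_good 1).2 S 0 t; rewrite lexx S0 t0 => /(_ isT tS x x)[_].
rewrite (iterate_good 1).1 subr0 (ger0_norm t0) => h; apply: (le_trans h).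
rewrite ler_wpM2r ?wt_ge0// -[leLHS]mulr1 ler_pM//.
- by rewrite mulr_ge0//; exact/speed_ge0/B0.
- by rewrite ler_wpM2l//; exact/speed_ge0/B0.
- rewrite -expR0 ler_expR mulr_ge0// mulr_ge0//; exact/ltW/modulus_gt0/B0.
Qed.

Definition limit_flow (t : R) (x : T) : T := lim (iterate n t x @[n --> \oo]).

Lemma limit_flowP S t x : 0 <= t <= S ->
  iterate n t x @[n --> \oo] --> limit_flow t x /\
  forall n, `|limit_flow t x - iterate n t x| <=
    2 * (err S * expR (rate S * t) * wt x) * 2^-1 ^+ n.
Proof.
move=> tS.
have [n|l [ul lB]] := geometric_cvg (fun n => iterate n t x)
  (err S * expR (rate S * t) * wt x).
  rewrite (le_trans (iterate_diff n S t x tS))// le_eqVlt; apply/orP; left.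
  by apply/eqP; ring.
have -> : limit_flow t x = l by exact: cvg_lim ul.
by [].
Qed.

Lemma limit_flow_good : good limit_flow.
Proof.
split.
  move=> x; rewrite /limit_flow.
  rewrite (_ : (fun n => _) = cst x); first exact: lim_cst.
  by apply/funext => n; exact: (iterate_good n).1.
move=> S s t sS tS x y.
have [cs _] := limit_flowP S s x sS.
have [ct _] := limit_flowP S t x tS.
have [cy _] := limit_flowP S t y tS.
split.
  apply: (cvgr_to_le (cvg_norm (cvgB ct cy))).
  by near=> n; have [] := (iterate_good n).2 S s t sS tS x y.
apply: (cvgr_to_le (cvg_norm (cvgB ct cs))).
by near=> n; have [] := (iterate_good n).2 S s t sS tS x y.
Unshelve. all: by end_near. Qed.

(** Both sides are compared with [iterate n.+1], the left one by the contraction and the right one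
    by the rate of convergence; each costs half of [C * 2^-1 ^+ n]. *)
Lemma limit_flow_fix t x : 0 <= t -> picard limit_flow t x = limit_flow t x.
Proof.
move=> t0; have tt : 0 <= t <= t by rewrite t0 lexx.
have e0 : 0 <= err t by apply: mulr_ge0 => //; exact/speed_ge0/B0.
apply/eqP; rewrite -subr_eq0 -normr_le0.
pose C := 2 * (err t * expR (rate t * t) * wt x).
have cv : C * 2^-1 ^+ n @[n --> \oo] --> (0 : R).
  rewrite -(mulr0 C); apply: cvgMr; apply: cvg_expr.
  by rewrite ger0_norm ?invr_ge0// invf_lt1// ltr1n.
apply: (cvgr_to_ge cv); near=> n.
rewrite -(subrKA (iterate n.+1 t x)) (le_trans (ler_normD _ _))//.
have h1 : `|picard limit_flow t x - iterate n.+1 t x| <= C * 2^-1 ^+ n / 2.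
  have -> : C * 2^-1 ^+ n / 2 =
    (2 * err t * 2^-1 ^+ n) / 2 * expR (rate t * t) * wt x by rewrite /C; ring.
  apply: picard_contraction => //.
  - exact: limit_flow_good.
  - exact: iterate_good.
  - by apply: mulr_ge0; [exact: mulr_ge0|rewrite exprn_ge0// invr_ge0].
  - move=> s y st; have [_ /(_ n)] := limit_flowP t s y st.
    by rewrite (_ : 2 * _ * _ = 2 * err t * 2^-1 ^+ n * expR (rate t * s) * wt y)//; ring.
have h2 : `|iterate n.+1 t x - limit_flow t x| <= C * 2^-1 ^+ n / 2.
  rewrite distrC; have [_ /(_ n.+1)] := limit_flowP t t x tt.
  by rewrite -/C exprS (_ : C * (_ * _) = C * 2^-1 ^+ n / 2)//; ring.
by rewrite [leRHS]splitr lerD.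
Unshelve. all: by end_near. Qed.

Lemma cutoff_flow_exists : exists X : R -> T -> T, good X /\
  forall (t : R) (x : T) i, 0 <= t ->
    is_derive t 1 (fun s : R => X s x 0 i) (field t (X t) x 0 i).
Proof.
have gP := picard_good _ limit_flow_good.
(* The image under [picard] agrees with [limit_flow] for nonnegative times and is also controlled at
   small negative times, as the two-sided derivative at 0 demands. *)
exists (picard limit_flow); split => // t x i t0.
have -> : picard limit_flow t = limit_flow t.
  by apply/funext => y; exact: limit_flow_fix.
exact: is_derive_picard_ge0 limit_flow_good t0.
Qed.

End picard.

(** * Observables with gradient of linear growth *)

Section tame.
Context {R : realType} {d : nat}.
Notation T := 'rV[R]_d.

Lemma diff_dotv (f : T -> R) (x v : T) : differentiable f x ->
  'd f x v = dotv v (grad f x).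
Proof.
move=> df; rewrite {1}(row_sum_basis v) linear_sum/=.
by apply: eq_bigr => i _; rewrite linearZ/= -deriveE// mxE.
Qed.

Lemma is_derive_chain (f : T -> R) (g : R -> T) (v : T) (t : R) :
  differentiable f (g t) ->
  (forall i, is_derive t 1 (fun s : R => g s 0 i) (v 0 i)) ->
  is_derive t 1 (fun s => f (g s)) (dotv (grad f (g t)) v).
Proof.
move=> df dg.
have Dg : derivable g t 1.
  by apply/derivable_mxP => i j; rewrite ord1; have [] := dg j.
have gE : 'D_1 g t = v.
  by rewrite derive_mx//; apply/rowP => i; rewrite mxE; have [_ ->] := dg i.
have dg' : differentiable g t by exact/derivable1_diffP.
apply: DeriveDef.
  by apply/derivable1_diffP; exact: differentiable_comp.
rewrite deriveE; last exact: differentiable_comp.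
have -> : 'd (fun s => f (g s)) t = 'd f (g t) \o 'd g t :> (R -> R).
  exact: diff_comp.
have dgv : 'd g t 1 = v by rewrite -deriveE.
by rewrite /= dgv diff_dotv// dotvC.
Qed.

(** Common class for the potential and the compactly supported test functions, so that one evolution
    formula serves both. *)
Definition tame (f : T -> R) := [/\ forall x, differentiable f x,
  continuous (grad f) & exists K, forall x, `|grad f x| <= K * wt x].

Lemma tame_continuous f : tame f -> continuous f.
Proof. by move=> [df _ _] x; exact: differentiable_continuous. Qed.

Lemma is_derive_scale (x : T) (t : R) i :
  is_derive t 1 (fun s : R => (s *: x) 0 i) (x 0 i).
Proof.
have -> : (fun s : R => (s *: x) 0 i) = (fun s : R => x 0 i * s).
  by apply/funext => s; rewrite mxE mulrC.
rewrite -[X in is_derive _ _ _ X]mulr1; exact: is_deriveZ.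
Qed.

(** The gradient is integrated along the segment from 0 to [x]. *)
Lemma tame_growth f : tame f -> exists2 K, 0 <= K & forall x, `|f x| <= K * wt x ^+ 2.
Proof.
move=> [df _ [K fK]]; exists (`|f 0| + d%:R * `|K|) => [|x].
  by rewrite addr_ge0// mulr_ge0.
have := @abs_increment_le R (fun s => f (s *: x))
  (fun s => (d%:R * (`|K| * wt x * wt x)) * s)
  (fun s => dotv (grad f (s *: x)) x) (fun=> d%:R * (`|K| * wt x * wt x)) 0 1 ler01.
rewrite scale0r scale1r mulr0 subr0 mulr1 => h.
have {}h : `|f x - f 0| <= d%:R * (`|K| * wt x * wt x).
  apply: h => s /andP[s0 s1].
  - by apply: is_derive_chain => // i; exact: is_derive_scale.
  - rewrite -[X in is_derive _ _ _ X]mulr1; exact: is_deriveZ.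
  - rewrite (le_trans (dotv_le _ _))// ler_wpM2l// ler_pM ?norm_le_wt//.
    rewrite (le_trans (fK _))// (@le_trans _ _ (`|K| * wt (s *: x)))//.
      by rewrite ler_wpM2r ?wt_ge0 ?ler_norm.
    rewrite ler_wpM2l//.
    by rewrite lerD2l normrZ (ger0_norm s0) ler_piMl.
rewrite -(subrK (f 0) (f x)) (le_trans (ler_normD _ _))// mulrDl addrC lerD//.
  by rewrite ler_peMr// expr_ge1 ?wt_ge0 ?wt_ge1.
by rewrite -mulrA; rewrite -mulrA -expr2 in h.
Qed.

End tame.

(** * Transport of a measure by a flow *)

Section transport.
Context {R : realType} {d : nat}.
Notation T := 'rV[R]_d.
Variable mu : probability T R.
Hypothesis mu2 : mu.-integrable setT (EFin \o (fun x : T => wt x ^+ 2)).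

(** Dominated convergence on the window (t - 1, t + 1). *)
Lemma continuous_integral (f : R -> T -> R) :
  (forall x, continuous (fun s : R => f s x : R)) ->
  (forall s, continuous (f s)) ->
  (forall S, exists A, forall s x, s < S -> `|f s x| <= A * wt x ^+ 2) ->
  continuous (fun s : R => \int[mu]_x f s x : R).
Proof.
move=> cs cx fA t; have [A fAt] := fA (t + 1).
have It : t \in [set` `]t - 1, t + 1[] by rewrite inE/= in_itv/=; lra.
apply: (@continuity_under_integral R _ _ mu f setT measurableT (t - 1) (t + 1)
  _ _ (fun x => A * wt x ^+ 2) _ _ t It).
- move=> s; rewrite /= in_itv/= => /andP[_ st].
  by apply: (integrable_wt2 mu mu2 _ A) => // x; exact: fAt.
- by apply: aeW => x _ s _; exact: cs.
- exact: integrable_scale.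
- move=> s; rewrite /= in_itv/= => /andP[_ st].
  by apply: aeW => x _; exact: fAt.
Qed.

(** What is kept of [good] once the constants of the truncated field are forgotten. *)
Definition regular_path (X : R -> T -> T) := (forall x, X 0 x = x) /\
  forall S, 0 <= S -> exists2 A, 0 <= A & forall s t x y,
    0 <= s <= S -> 0 <= t <= S ->
    [/\ `|X t x| <= A * wt x, `|X t x - X t y| <= A * `|x - y| &
        `|X t x - X s x| <= A * `|t - s| * wt x].

Lemma regular_path_cont X t : regular_path X -> 0 <= t -> continuous (X t).
Proof.
move=> [_ rX] t0; have [A _ XA] := rX t t0.
apply: (@lip_continuous _ _ _ _ A) => x y.
by have [] := XA t t x y; rewrite ?t0/=.
Qed.

Lemma regular_path_adm X S : regular_path X -> 0 <= S ->
  exists2 A, 0 <= A & forall t, 0 <= t <= S -> adm A (X t).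
Proof.
move=> rX S0; have [A A0 XA] := rX.2 S S0; exists A => // t t0; split.
  by apply: regular_path_cont => //; case/andP: t0.
by move=> x; have [] := XA t t x x t0 t0.
Qed.

Lemma regular_path_time X x : regular_path X ->
  continuous (fun s : R => X (tpos s) x).
Proof.
move=> [_ rX] t.
have St : 0 <= tpos t + 1 by rewrite addr_ge0// tpos_ge0.
have [A A0 XA] := rX _ St.
apply: (@locally_lip_continuous_at _ _ _ _ (A * wt x)) => s st.
have tS : 0 <= tpos t <= tpos t + 1 by rewrite tpos_ge0 lerDl/=.
have sS : 0 <= tpos s <= tpos t + 1.
  rewrite tpos_ge0/=; have := le_trans (tpos_lip s t) st.
  by rewrite ler_norml => /andP[_]; lra.
have [] := XA (tpos t) (tpos s) x x tS sS.
move=> _ _ h; rewrite (le_trans h)// mulrAC ler_wpM2l ?tpos_lip//.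
by rewrite mulr_ge0 ?wt_ge0.
Qed.

Lemma tame_adm_bound f : tame f -> forall A, 0 <= A ->
  exists K, forall X, adm A X -> forall x : T, `|f (X x)| <= K * wt x ^+ 2.
Proof.
move=> tf A A0; have [K K0 fK] := tame_growth f tf.
exists (K * (1 + A) ^+ 2) => X aX x.
by rewrite (le_trans (fK _))// -mulrA ler_wpM2l// adm_wt2.
Qed.

Lemma tame_int f A X : tame f -> adm A X ->
  mu.-integrable setT (EFin \o (fun x => f (X x))).
Proof.
move=> tf aX; have [K fK] := tame_adm_bound f tf A (adm_ge0 A X aX).
apply: (integrable_wt2 mu mu2 _ K); last exact: fK.
by apply: continuous_comp_fun (tame_continuous _ tf); case: aX.
Qed.

Lemma continuous_observable f X : tame f -> regular_path X ->
  continuous (fun s : R => \int[mu]_x f (X (tpos s) x) : R).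
Proof.
move=> tf rX; apply: continuous_integral => [x|s|S].
- apply: (continuous_comp_fun f); last exact: tame_continuous.
  exact: regular_path_time.
- apply: (continuous_comp_fun f); last exact: tame_continuous.
  by apply: regular_path_cont => //; exact: tpos_ge0.
- have [A A0 aX] := regular_path_adm X (tpos S) rX (tpos_ge0 S).
  have [K fK] := tame_adm_bound f tf A A0.
  exists K => s x sS; apply: fK; apply: aX; rewrite tpos_ge0/= /tpos.
  by rewrite ge_max !le_max lexx (ltW sS) orbT.
Qed.

(** The velocity is in Lagrangian form: [v t x] belongs to the trajectory started at [x], not to the
    point [x]. *)
Definition transported (X v : R -> T -> T) :=
  [/\ forall (t : R) x i, 0 <= t ->
        is_derive t 1 (fun s : R => X s x 0 i) (v t x 0 i),
      forall x, continuous (fun s : R => v (tpos s) x),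
      forall t, 0 <= t -> continuous (v t) &
      forall S, 0 <= S -> exists2 A, 0 <= A &
        forall t x, 0 <= t <= S -> `|v t x| <= A * wt x].

Lemma flux_bound f X v S : tame f -> regular_path X -> transported X v ->
  0 <= S -> exists A, forall t x, 0 <= t <= S ->
    `|dotv (grad f (X t x)) (v t x)| <= A * wt x ^+ 2.
Proof.
move=> [df cf [K fK]] rX [_ _ _ vB] S0.
have [A A0 aX] := regular_path_adm X S rX S0.
have [A' A'0 vA] := vB S S0.
exists (d%:R * ((`|K| * (1 + A)) * A')) => t x tS.
rewrite (le_trans (dotv_le _ _))// -!mulrA ler_wpM2l//.
rewrite [leRHS](_ : _ = (`|K| * ((1 + A) * wt x)) * (A' * wt x)); last by ring.
apply: ler_pM => //; last exact: vA.
rewrite (le_trans (fK _))// (@le_trans _ _ (`|K| * wt (X t x)))//.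
  by rewrite ler_wpM2r ?wt_ge0 ?ler_norm.
by rewrite ler_wpM2l//; apply: adm_wt; exact: aX.
Qed.

Lemma continuous_flux f X v : tame f -> regular_path X -> transported X v ->
  continuous (fun s : R =>
    \int[mu]_x dotv (grad f (X (tpos s) x)) (v (tpos s) x) : R).
Proof.
move=> tf rX tX; have [_ cf _] := tf; have [_ vt vx _] := tX.
apply: continuous_integral => [x|s|S].
- apply: continuous_dotv; last exact: vt.
  by apply: continuous_comp_fun cf; exact: regular_path_time.
- apply: continuous_dotv; last by apply: vx; exact: tpos_ge0.
  by apply: continuous_comp_fun cf; apply: regular_path_cont => //; exact: tpos_ge0.
- have [A fA] := flux_bound f X v (tpos S) tf rX tX (tpos_ge0 S).
  exists A => s x sS; apply: fA; rewrite tpos_ge0/= /tpos.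
  by rewrite ge_max !le_max lexx (ltW sS) orbT.
Qed.

(** Differentiation under the integral sign, dominated through [flux_bound] on the open window (0, t
    + 1); hence the restriction to positive [t]. *)
Lemma is_derive_observable f X v (t : R) : tame f -> regular_path X ->
  transported X v -> 0 < t ->
  is_derive t 1 (fun s : R => \int[mu]_x f (X s x))
    (\int[mu]_x dotv (grad f (X t x)) (v t x)).
Proof.
move=> tf rX tX t0; have [df _ _] := tf; have [dX _ _ _] := tX.
have S0 : 0 <= t + 1 by lra.
have [A0 A00 aX] := regular_path_adm X (t + 1) rX S0.
have [A fA] := flux_bound f X v (t + 1) tf rX tX S0.
have It : [set` `]0, t + 1[] t by rewrite /= in_itv/=; lra.
have dF (s : R) (x : T) : 0 <= s ->
    is_derive s 1 (fun u : R => f (X u x)) (dotv (grad f (X s x)) (v s x)).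
  by move=> s0; apply: is_derive_chain => // i; exact: dX.
pose F s x := f (X s x).
have h1 s : [set` `]0, t + 1[] s -> mu.-integrable setT (EFin \o F s).
  rewrite /= in_itv/= => /andP[s0 st]; apply: (tame_int _ A0) => //.
  by apply: aX; rewrite !ltW.
have h2 s x : [set` `]0, t + 1[] s -> setT x -> derivable (F ^~ x) s 1.
  by rewrite /= in_itv/= => /andP[s0 st] _; have [] := dF s x (ltW s0).
have h3 (x : T) : 0 <= `|A| * wt x ^+ 2 by rewrite mulr_ge0// sqr_ge0.
have h4 : mu.-integrable setT (EFin \o (fun x => `|A| * wt x ^+ 2)).
  exact: integrable_scale.
have h5 s x : [set` `]0, t + 1[] s -> setT x -> `|partial1of2 F s x| <= `|A| * wt x ^+ 2.
  rewrite /= in_itv/= => /andP[s0 st] _; rewrite partial1of2E.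
  have [_ ->] := dF s x (ltW s0).
  rewrite (le_trans (fA s x _))//; first by rewrite !ltW.
  by rewrite ler_wpM2r ?sqr_ge0// ler_norm.
apply: DeriveDef.
  exact: (derivable_under_integral measurableT It h1 h2 h3 h4 h5).
rewrite -derive1E (differentiation_under_integral measurableT It h1 h2 h3 h4 h5).
apply: eq_Rintegral => x _; rewrite partial1of2E.
by have [_ ->] := dF t x (ltW t0).
Qed.

End transport.

(** * Global flow: the cutoff is never active *)

Section flow.
Context {R : realType} {d : nat}.
Notation T := 'rV[R]_d.
Variables (mu : probability T R) (b : T -> T -> T) (Cb : R).
Hypothesis Cb0 : 0 < Cb.
Hypothesis mu2 : mu.-integrable setT (EFin \o (fun x : T => wt x ^+ 2)).
Hypothesis b_growth : forall z y, `|b z y| <= Cb * (wt z * wt y ^+ 2).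
Hypothesis b_lip : forall z y z' y', `|b z y - b z' y'| <=
  Cb * (`|z - z'| * wt y ^+ 2 + `|y - y'| * (wt y + wt y') * wt z').
Variables (V : T -> R) (eps CV C1 c1 : R).
Hypothesis Vtame : tame V.
Hypothesis eps0 : 0 < eps.
Hypothesis V_coercive : forall x, eps * `|x| ^+ 2 - CV <= V x.
Hypothesis C10 : 0 <= C1.
Hypothesis c10 : 0 <= c1.
Hypothesis dissipative : forall A X, adm A X ->
  \int[mu]_x dotv (grad V (X x)) (vel mu b X (X x)) <=
  C1 - c1 * \int[mu]_x (`|X x| ^+ 2).

Lemma norm_sqr_le_wt (x : T) : `|x| ^+ 2 <= wt x ^+ 2.
Proof. by rewrite lerXn2r ?nnegrE ?wt_ge0 ?norm_le_wt. Qed.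

Lemma continuous_norm_sqr (X : T -> T) : continuous X ->
  continuous (fun x : T => `|X x| ^+ 2 : R).
Proof.
move=> cX; apply: (continuous_comp_fun (fun u : R => u ^+ 2 : R)).
  by apply: (continuous_comp_fun (fun u : T => `|u| : R)) => //; exact: norm_continuous.
exact: exprn_continuous.
Qed.

Lemma integrable_norm_sqr A X : adm A X ->
  mu.-integrable setT (EFin \o (fun x : T => `|X x| ^+ 2)).
Proof.
move=> aX; apply: (integrable_wt2 mu mu2 _ ((1 + A) ^+ 2)).
  by apply: continuous_norm_sqr; case: aX.
move=> x; rewrite ger0_norm ?sqr_ge0// (le_trans (norm_sqr_le_wt _))//.
exact: adm_wt2.
Qed.

Lemma continuous_vel A X : adm A X -> continuous (fun x : T => vel mu b X (X x)).
Proof.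
move=> aX; apply: continuous_comp_fun; first by case: aX.
by apply: (@lip_continuous _ _ _ _ (Cb * (1 + A) ^+ 2 * \int[mu]_y (wt y ^+ 2))) => u v; exact: vel_lip.
Qed.

Lemma integrable_dissipation A X : adm A X -> mu.-integrable setT
  (EFin \o (fun x : T => dotv (grad V (X x)) (vel mu b X (X x)))).
Proof.
move=> aX; have [_ cV [K VK]] := Vtame; have A0 := adm_ge0 A X aX.
pose A' := Cb * (1 + A) * m2 mu X.
apply: (integrable_wt2 mu mu2 _ (d%:R * (`|K| * (1 + A) * A'))).
  apply: continuous_dotv; last exact: continuous_vel aX.
  by apply: continuous_comp_fun cV; case: aX.
move=> x; rewrite (le_trans (dotv_le _ _))//.
rewrite [leRHS](_ : _ = d%:R * ((`|K| * ((1 + A) * wt x)) * (A' * wt x))).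
  rewrite ler_wpM2l//; apply: ler_pM => //; last first.
    rewrite (le_trans (vel_bound mu b Cb Cb0 mu2 b_growth b_lip A _ _ aX))//.
    rewrite /A' [leRHS]mulrAC ler_wpM2r//.
      by apply: Rintegral_ge0 => y _; exact: sqr_ge0.
    by rewrite -mulrA ler_pM2l//; exact: adm_wt aX.
  rewrite (le_trans (VK _))// (@le_trans _ _ (`|K| * wt (X x)))//.
    by rewrite ler_wpM2r ?wt_ge0 ?ler_norm.
  by rewrite ler_wpM2l//; exact: adm_wt aX.
by ring.
Qed.

Definition energy (X : R -> T -> T) (t : R) := \int[mu]_x V (X t x).

(** Combines (1 + r)^2 <= 2 + 2 r^2 with the coercivity of [V]. *)
Lemma m2_energy A X : adm A X ->
  m2 mu X <= 2 + 2 * (eps^-1 * (\int[mu]_x V (X x) + CV)).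
Proof.
move=> aX.
have -> : 2 + 2 * (eps^-1 * (\int[mu]_x V (X x) + CV)) =
    \int[mu]_x (2 + 2 * (eps^-1 * (V (X x) + CV))).
  have i1 : mu.-integrable setT (EFin \o (fun x => V (X x))) by exact: tame_int aX.
  have i2 : mu.-integrable setT (EFin \o (fun x => V (X x) + CV)).
    by apply: integrable_add => //; exact: integrable_prob_cst.
  rewrite RintegralD//; last 2 first.
  - exact: integrable_prob_cst.
  - by do 2 apply: integrable_scale.
  rewrite Rintegral_prob_cst RintegralZl//; last exact: integrable_scale.
  rewrite RintegralZl// RintegralD//; last exact: integrable_prob_cst.
  by rewrite Rintegral_prob_cst.
apply: Rintegral_le.
- exact: integrable_wt2X aX.
- apply: integrable_add; first exact: integrable_prob_cst.
  do 2 apply: integrable_scale; apply: integrable_add; last exact: integrable_prob_cst.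
  exact: tame_int aX.
- move=> x; have : `|X x| ^+ 2 <= eps^-1 * (V (X x) + CV).
    by rewrite ler_pdivlMl//; have := V_coercive (X x); lra.
  rewrite /wt; have := sqr_ge0 (`|X x| - 1); lra.
Qed.

(** A priori bounds: if the energy is at most [E0 + C1 * t], the second moment is at most
    [alpha + beta * t] by [m2_energy], and Gronwall's lemma then bounds [wt (X t x)] by
    [wt x * rad t]. This very function is taken as the cutoff radius. *)
Let E0 := \int[mu]_x V x.
Let alpha := 2 + 2 * (eps^-1 * (`|E0| + `|CV|)).
Let beta := 2 * (eps^-1 * C1).
Let rad t := expR (Cb * (alpha + beta * t) * t).

Let alpha2 : 2 <= alpha.
Proof.
by rewrite lerDl mulr_ge0// mulr_ge0// ?addr_ge0// invr_ge0 ltW.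
Qed.

Let beta0 : 0 <= beta.
Proof. by rewrite mulr_ge0// mulr_ge0// invr_ge0 ltW. Qed.

Let rad_ge0 t : 0 <= t -> 0 <= rad t.
Proof. by move=> _; exact: expR_ge0. Qed.

Let rad_ndecr s t : 0 <= s -> s <= t -> rad s <= rad t.
Proof.
move=> s0 st; have a0 : 0 <= alpha by apply: le_trans alpha2.
rewrite /rad ler_expR ler_pM//.
- by rewrite mulr_ge0 ?(ltW Cb0)// addr_ge0// mulr_ge0.
- by rewrite ler_pM2l// lerD2l ler_wpM2l.
Qed.

Let rad_cont : continuous rad.
Proof.
apply: (continuous_comp_fun (@expR R)); last exact: continuous_expR.
apply: continuous_mul; last by move=> t; exact: cvg_id.
apply: continuous_mul; first by move=> t; exact: cvg_cst.
apply: continuous_add; first by move=> t; exact: cvg_cst.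
by apply: continuous_mul; [move=> t; exact: cvg_cst|move=> t; exact: cvg_id].
Qed.

Notation fld := (field mu b rad).

Lemma good_regular X : good mu Cb rad X -> regular_path X.
Proof.
move=> gX; split; first exact: gX.1.
move=> S S0.
set B := 1 + rad S.
have B0 : 0 <= B by rewrite addr_ge0// rad_ge0.
have K0 : 0 <= speed mu Cb B by exact: speed_ge0.
have L0 : 0 < slope mu Cb B by exact: slope_gt0.
pose A1 := 1 + speed mu Cb B * S.
exists (A1 + expR (slope mu Cb B * S) + speed mu Cb B).
  rewrite addr_ge0// addr_ge0 ?expR_ge0// addr_ge0// mulr_ge0//.
have A10 : 0 <= A1 by rewrite addr_ge0// mulr_ge0.
have E0' : 0 <= expR (slope mu Cb B * S) by exact: expR_ge0.
move=> s t x y sS tS; have [h1 h2] := gX.2 S s t sS tS x y.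
have [_ h3] := good_adm mu Cb Cb0 mu2 rad rad_ge0 X S t gX tS.
split.
- by rewrite (le_trans (h3 x))// ler_wpM2r ?wt_ge0// -addrA lerDl addr_ge0.
- rewrite (le_trans h1)// ler_wpM2r// (@le_trans _ _ (expR (slope mu Cb B * S)))//.
    by rewrite ler_expR ler_pM2l//; case/andP: tS.
  by rewrite addrAC lerDr addr_ge0.
- rewrite (le_trans h2)// ler_wpM2r ?wt_ge0// ler_wpM2r//.
  by rewrite lerDr addr_ge0.
Qed.

(** The truncated flow obeys the a priori bounds from which [rad] was built, so its cutoff is
    constantly 1 and it solves the original equation. *)
Theorem flow_exists : exists2 X, regular_path X &
  transported X (fun t x => vel mu b (X t) (X t x)).
Proof.
have [X [gX dX]] := cutoff_flow_exists mu b Cb Cb0 mu2 b_growth b_lip rad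
  rad_cont rad_ge0 rad_ndecr.
have rX := good_regular X gX.
pose fl t x := fld t (X t) x.
have flc x : continuous (fun s : R => fl (tpos s) x).
  exact: (good_field_cont mu b Cb Cb0 mu2 b_growth b_lip rad rad_cont rad_ge0 rad_ndecr).
have tX : transported X fl.
  split => //.
  - move=> t t0; have [A A0 aX] := rX.2 t t0.
    have tt : 0 <= t <= t by rewrite t0 lexx.
    have aXt : adm A (X t).
      split; first exact: regular_path_cont.
      by move=> x; have [] := aX t t x x tt tt.
    apply: (@lip_continuous _ _ _ _ (slope mu Cb (1 + rad t) * A)) => x y.
    rewrite (le_trans (field_lip mu b Cb Cb0 mu2 b_growth b_lip rad rad_ge0
      rad_ndecr t t t0 (lexx t) A _ x y aXt))//.
    rewrite -mulrA ler_wpM2l//; first by apply/ltW/slope_gt0 => //; rewrite addr_ge0// rad_ge0.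
    by have [] := aX t t x y tt tt.
  - move=> S S0; exists (speed mu Cb (1 + rad S)).
      by apply: speed_ge0 => //; rewrite addr_ge0// rad_ge0.
    move=> t x /andP[t0 tS]; have [A A0 aX] := regular_path_adm X S rX S0.
    apply: (field_bound mu b Cb Cb0 mu2 b_growth b_lip rad rad_ge0 rad_ndecr S t t0 tS A).
    by apply: aX; rewrite t0.
have dE (t : R) : 0 < t -> is_derive t 1 (energy X) (\int[mu]_x dotv (grad V (X t x)) (fl t x)).
  by move=> t0; exact: is_derive_observable.
(* The cutoff does not depend on the point, so it factors out of the energy derivative; lying in
   [0, 1], it preserves an upper bound by the nonnegative [C1]. *)
have energy_le t : 0 <= t -> energy X t <= E0 + C1 * t.
  move=> t0.
  have e0 : energy X 0 = E0 by apply: eq_Rintegral => x _; rewrite gX.1.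
  rewrite -lerBlDl -e0 -[leRHS]subr0 -{2}(mulr0 C1).
  apply: (increment_le (energy X) (fun s => C1 * s)
     (fun s => \int[mu]_x dotv (grad V (X s x)) (fl s x)) (fun=> C1) 0 t t0).
  - have cE := continuous_observable mu mu2 V X Vtame rX.
    have : {within `[0, t], continuous (fun s : R => \int[mu]_x V (X (tpos s) x) : R)}.
      exact: continuous_subspaceT.
    apply: subspace_eq_continuous => s /=; rewrite inE/= in_itv/= => /andP[s0 _].
    by rewrite /from_subspace tpos_id.
  - apply: continuous_subspaceT; apply: continuous_mul.
      by move=> s; exact: cvg_cst.
    by move=> s; exact: cvg_id.
  - by move=> s /andP[s0 _]; exact: dE.
  - move=> s _; rewrite -[X in is_derive _ _ _ X]mulr1; exact: is_deriveZ.
  - move=> s /andP[/ltW s0 _].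
    have [A A0 aX] := regular_path_adm X s rX s0.
    have {}aX : adm A (X s) by apply: aX; rewrite s0 lexx.
    rewrite (_ : (\int[mu]_x _)%R = cutoff rad s (X s) *
        \int[mu]_x dotv (grad V (X s x)) (vel mu b (X s) (X s x))); last first.
      rewrite -RintegralZl//; last exact: integrable_dissipation aX.
      by apply: eq_Rintegral => x _; rewrite /fl /field dotvZr.
    have h := dissipative A (X s) aX.
    have c0 := cutoff_ge0 rad s (X s); have c1' := cutoff_le1 rad s (X s).
    have n0 : 0 <= c1 * \int[mu]_x (`|X s x| ^+ 2).
      by rewrite mulr_ge0// Rintegral_ge0// => x _; exact: sqr_ge0.
    rewrite (le_trans (ler_wpM2l c0 h))// (@le_trans _ _ (cutoff rad s (X s) * C1))//.
      by rewrite ler_wpM2l// gerBl.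
    by rewrite ler_piMl.
have m2_le t : 0 <= t -> m2 mu (X t) <= alpha + beta * t.
  move=> t0; have [A A0 aX] := regular_path_adm X t rX t0.
  have {}aX : adm A (X t) by apply: aX; rewrite t0 lexx.
  rewrite (le_trans (m2_energy A (X t) aX))// /alpha /beta.
  rewrite [leRHS](_ : _ = 2 + 2 * (eps^-1 * (`|E0| + `|CV| + C1 * t))); last by ring.
  rewrite lerD2l ler_pM2l// ler_pM2l ?invr_gt0//.
  have := energy_le t t0; rewrite /energy.
  by have := ler_norm E0; have := ler_norm CV; lra.
(* Gronwall on [0, t] with the rate [K] frozen at the final time, where it dominates [Cb] times the
   second moment at all earlier times. *)
have wt_le t x : 0 <= t -> wt (X t x) <= wt x * rad t.
  move=> t0; pose K := Cb * (alpha + beta * t).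
  have ab0 : 0 < alpha + beta * t.
    have a0 : 0 < alpha by apply: lt_le_trans alpha2.
    have bt : 0 <= beta * t by rewrite mulr_ge0.
    lra.
  have K0 : 0 < K by rewrite mulr_gt0.
  pose u s := wt (X (tpos s) x).
  have cu : continuous u.
    apply: (continuous_comp_fun (@wt R d)); last exact: continuous_wt.
    exact: regular_path_time.
  have := gronwall u K (wt x) t K0 cu.
  rewrite /rad -/K => /(_ _ t); rewrite t0 lexx /u tpos_id// => G.
  apply: G => // s /andP[s0 st]; rewrite /u (tpos_id s s0).
  have h : `|X s x - X 0 x| <= K * prim u s - K * prim u 0.
    apply: (vec_increment_le (fun r => X r x) (fun r => fl r x)
      (fun r => K * prim u r) (fun r => K * u r) 0 s s0).
    - by move=> r i /andP[r0 _]; exact: dX.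
    - move=> r /andP[r0 _]; apply: is_deriveZ; apply: is_derive_prim => //; lra.
    - move=> r /andP[r0 rs].
      have [A A0 aX] := regular_path_adm X r rX r0.
      have {}aX : adm A (X r) by apply: aX; rewrite r0 lexx.
      rewrite /fl /field normrZ (ger0_norm (cutoff_ge0 _ _ _)).
      rewrite -[leRHS]mul1r ler_pM ?cutoff_ge0 ?cutoff_le1//.
      rewrite (le_trans (vel_bound mu b Cb Cb0 mu2 b_growth b_lip A _ _ aX))//.
      rewrite /K /u tpos_id// mulrAC ler_wpM2r ?wt_ge0// ler_pM2l//.
      rewrite (le_trans (m2_le r r0))// lerD2l ler_wpM2l//.
      exact: le_trans rs st.
  rewrite prim0 mulr0 subr0 gX.1 in h.
  have := wt_lip (X s x) x; lra.
have cut1 t : 0 <= t -> cutoff rad t (X t) = 1.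
  move=> t0; apply: cutoff_eq1; apply: wnorm_le => x.
  by rewrite (le_trans (norm_le_wt _))// mulrC wt_le.
have E t : 0 <= t -> (fun x => vel mu b (X t) (X t x)) = fl t.
  by move=> t0; apply/funext => x; rewrite /fl /field cut1// scale1r.
exists X => //; split.
- by move=> t x i t0; rewrite (congr1 (fun f => f x) (E t t0)); exact: dX.
- move=> x; have := flc x; rewrite (_ : (fun s : R => fl (tpos s) x) =
    (fun s => vel mu b (X (tpos s)) (X (tpos s) x)))//.
  by apply/funext => s; rewrite -(E _ (tpos_ge0 s)).
- by move=> t t0; rewrite E//; case: tX => _ _ h _; exact: h.
- move=> S S0; have [_ _ _ /(_ S S0)[A A0 flA]] := tX; exists A => // t x tS.
  by rewrite (congr1 (fun f => f x) (E t _)) ?flA//; case/andP: tS.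
Qed.

End flow.

(** * Evolution of observables and the energy estimate *)

Section evolution.
Context {R : realType} {d : nat}.
Notation T := 'rV[R]_d.
Notation leb := (@lebesgue_measure R).
Variable mu : probability T R.
Hypothesis mu2 : mu.-integrable setT (EFin \o (fun x : T => wt x ^+ 2)).
Variables (X v : R -> T -> T).
Hypothesis rX : regular_path X.
Hypothesis tX : transported X v.

Definition flux (f : T -> R) (s : R) := \int[mu]_x dotv (grad f (X s x)) (v s x).

Let within_observable f t : tame f ->
  {within `[0, t], continuous (fun s : R => \int[mu]_x f (X s x) : R)}.
Proof.
move=> tf; have cE := continuous_observable mu mu2 f X tf rX.
have : {within `[0, t], continuous (fun s : R => \int[mu]_x f (X (tpos s) x) : R)}.
  exact: continuous_subspaceT.
apply: subspace_eq_continuous => s /=; rewrite inE/= in_itv/= => /andP[s0 _].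
by rewrite /from_subspace tpos_id.
Qed.

(** The observable and the primitive of the flux have the same derivative inside [0, t];
    [increment_le] is applied in both directions because the left endpoint is excluded. *)
Lemma observable_evolution f t : tame f -> 0 <= t ->
  \int[mu]_x f (X t x) = \int[mu]_x f x + \int[leb]_(s in `[0, t]) flux f s.
Proof.
move=> tf t0; pose g (s : R) := flux f (tpos s).
have cg : continuous g by exact: (continuous_flux mu mu2).
have -> : \int[leb]_(s in `[0, t]) flux f s = prim g t.
  rewrite (primE _ _ cg t0); apply: eq_Rintegral => s; rewrite inE/= in_itv/= => /andP[s0 _].
  by rewrite /g tpos_id.
have e0 : \int[mu]_x f x = \int[mu]_x f (X 0 x).
  by apply: eq_Rintegral => x _; rewrite rX.1.
have cF := within_observable f t tf.
have dP (s : R) : 0 <= s <= t -> is_derive s 1 (prim g) (g s).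
  by move=> /andP[s0 _]; apply: is_derive_prim => //; lra.
have cP : {within `[0, t], continuous (prim g)} by exact: derivable_within dP.
have W s : 0 < s < t -> 0 <= s <= t by move=> /andP[/ltW -> /ltW ->].
have dF (s : R) : 0 < s < t ->
    is_derive s 1 (fun s : R => \int[mu]_x f (X s x)) (flux f s).
  by move=> /andP[s0 _]; exact: is_derive_observable.
have gE s : 0 < s < t -> flux f s = g s.
  by move=> /andP[/ltW s0 _]; rewrite /g tpos_id.
have h1 := increment_le _ _ (flux f) g 0 t t0 cF cP dF
  (fun s st => dP s (W s st)).
have h2 := increment_le _ _ g (flux f) 0 t t0 cP cF
  (fun s st => dP s (W s st)) dF.
move: h1 h2; rewrite prim0 -e0 => h1 h2.
have l1 s : 0 < s < t -> flux f s <= g s by move=> /gE ->.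
have l2 s : 0 < s < t -> g s <= flux f s by move=> /gE ->.
by have := h1 l1; have := h2 l2; lra.
Qed.

Lemma flux_integrable f t : tame f -> leb.-integrable `[0, t] (EFin \o flux f).
Proof.
move=> tf.
have cg : continuous (fun s : R => flux f (tpos s)) by exact: (continuous_flux mu mu2).
have := continuous_itv_integrable _ 0 t cg.
apply: eq_integrable => // s; rewrite inE/= in_itv/= => /andP[s0 _].
by rewrite tpos_id.
Qed.

Variables (V : T -> R) (C1 c1 : R).
Hypothesis Vtame : tame V.
Hypothesis Vge0 : forall x, 0 <= V x.
Hypothesis c10 : 0 < c1.
Hypothesis dissipation : forall s, 0 <= s ->
  flux V s <= C1 - c1 * \int[mu]_x (`|X s x| ^+ 2).

Lemma moment_continuous :
  continuous (fun s : R => \int[mu]_x (`|X (tpos s) x| ^+ 2) : R).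
Proof.
apply: (continuous_integral mu mu2) => [x|s|S].
- apply: (continuous_comp_fun (fun u : R => u ^+ 2 : R)); last exact: exprn_continuous.
  apply: (continuous_comp_fun (fun u : T => `|u| : R)); last exact: norm_continuous.
  exact: regular_path_time.
- by apply: continuous_norm_sqr; apply: regular_path_cont => //; exact: tpos_ge0.
- have [A A0 aX] := regular_path_adm X (tpos S) rX (tpos_ge0 S).
  exists ((1 + A) ^+ 2) => s x sS; rewrite ger0_norm ?sqr_ge0//.
  rewrite (le_trans (norm_sqr_le_wt _))//; apply: adm_wt2; apply: aX.
  by rewrite tpos_ge0/= /tpos ge_max !le_max lexx (ltW sS) orbT.
Qed.

(** Energy balance: as the final energy is nonnegative, the dissipated moment is paid for by the
    initial energy and the source [C1 * t]. *)
Lemma moment_bound t : 0 <= t ->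
  \int[leb]_(s in `[0, t]) (\int[mu]_x (`|X s x| ^+ 2)) <=
  c1^-1 * (C1 * t + \int[mu]_x V x).
Proof.
move=> t0; pose m (s : R) := \int[mu]_x (`|X (tpos s) x| ^+ 2).
have cm : continuous m by exact: moment_continuous.
have -> : \int[leb]_(s in `[0, t]) (\int[mu]_x (`|X s x| ^+ 2)) = prim m t.
  rewrite (primE _ _ cm t0); apply: eq_Rintegral => s; rewrite inE/= in_itv/= => /andP[s0 _].
  by rewrite /m tpos_id.
have e0 : \int[mu]_x V x = \int[mu]_x V (X 0 x).
  by apply: eq_Rintegral => x _; rewrite rX.1.
pose G (s : R) := C1 * s - c1 * prim m s.
have dG (s : R) : 0 <= s <= t -> is_derive s 1 G (C1 - c1 * m s).
  move=> /andP[s0 _]; apply: is_deriveB.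
    by rewrite -[X in is_derive _ _ _ X]mulr1; exact: is_deriveZ.
  by apply: is_deriveZ; apply: is_derive_prim => //; lra.
have W s : 0 < s < t -> 0 <= s <= t by move=> /andP[/ltW -> /ltW ->].
have := increment_le _ G (flux V) (fun s => C1 - c1 * m s) 0 t t0
  (within_observable V t Vtame) (derivable_within _ _ _ _ dG).
rewrite /G prim0 -e0 => h.
have V0 : 0 <= \int[mu]_x V (X t x) by apply: Rintegral_ge0 => x _.
rewrite ler_pdivlMl//; suff : \int[mu]_x V (X t x) - \int[mu]_x V x <=
  C1 * t - c1 * prim m t - (C1 * 0 - c1 * 0) by lra.
apply: h => s st.
- by case/andP: st => s0 _; exact: is_derive_observable.
- exact/dG/W.
- by case/andP: (W _ st) => s0 _; rewrite /m tpos_id//; exact: dissipation.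
Qed.

End evolution.

(** * Integrability of the weights e^(-t) t^p on the half-line *)

Section gamma_weights.
Context {R : realType}.
Notation leb := (@lebesgue_measure R).

(** On [1/(n+2), n+2] the integral is an increment of [F], at most 2 C; monotone convergence passes
    to the half-line. *)
Lemma bounded_primitive_integrable (f F : R -> R) (C : R) :
  (forall t : R, 0 < t -> is_derive t 1 F (f t)) ->
  (forall t : R, 0 < t -> {for t, continuous f}) ->
  (forall t, 0 < t -> 0 <= f t) -> (forall t, 0 < t -> `|F t| <= C) ->
  leb.-integrable `]0, +oo[ (EFin \o f).
Proof.
move=> dF cf f0 FC.
pose I (n : nat) : set R := `[n.+2%:R^-1, n.+2%:R]%classic.
have IE : \bigcup_n I n = `]0, +oo[%classic.
  apply/seteqP; split => [t [n _]|t]; rewrite /= in_itv/= andbT.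
    by rewrite /I/= in_itv/= => /andP[nt _]; apply: lt_le_trans nt; rewrite invr_gt0.
  move=> t0; exists (Num.truncn t + Num.truncn t^-1)%N => //; rewrite /I/= in_itv/=.
  have h1 := truncnS_gt t; have h2 := truncnS_gt t^-1.
  apply/andP; split.
    rewrite -[leRHS]invrK lef_pV2 ?posrE ?invr_gt0// ltW// (lt_le_trans h2)//.
    by rewrite ler_nat ltnS leqW// leq_addl.
  by rewrite ltW// (lt_le_trans h1)// ler_nat ltnS leqW// leq_addr.
have mf : measurable_fun (`]0, +oo[%classic : set R) f.
  apply: open_continuous_measurable_fun => // t.
  by rewrite inE/= in_itv/= andbT => t0; exact: cf.
have IS n : I n `<=` `]0, +oo[%classic by rewrite -IE; exact: bigcup_sup.
apply/integrableP; split; first exact/measurable_EFinP.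
under eq_integral => t.
  rewrite inE/= in_itv/= andbT => t0; rewrite ger0_norm ?f0//.
over.
have ndI : nondecreasing_seq I.
  move=> m n mn; apply/subsetPset => t; rewrite /I/= !in_itv/= => /andP[h1 h2].
  rewrite (le_trans _ h1) ?(le_trans h2) ?ler_nat ?ltnS//.
  by rewrite lef_pV2 ?posrE// ler_nat ltnS.
have f0I i t : I i t -> (0 <= (EFin \o f) t)%E.
  by move=> /IS; rewrite /= in_itv/= andbT lee_fin => /f0.
have cvI : (\int[leb]_(x in I i) (f x)%:E @[i --> \oo] -->
    \int[leb]_(x in \bigcup_i I i) (f x)%:E)%E.
  apply: ge0_nondecreasing_set_cvg_integral => // i; first exact: measurable_itv.
  by apply/measurable_EFinP; exact: measurable_funS mf.
rewrite IE in cvI.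
apply: (@le_lt_trans _ _ (C + C)%:E); last exact: ltry.
apply: (cvge_to_le cvI); near=> n.
have n0 : 0 < n.+2%:R^-1 :> R by rewrite invr_gt0.
rewrite (@continuous_FTC2 _ f F).
- rewrite -EFinB lee_fin; have := FC _ n0; have := FC n.+2%:R (ltr0Sn _ _).
  by rewrite !ler_norml; lra.
- by rewrite (@lt_trans _ _ 1)// ?ltr1n// invf_lt1// ltr1n.
- apply: continuous_in_subspaceT => t; rewrite inE/= in_itv/= => /andP[nt _].
  by apply: cf; exact: lt_le_trans nt.
- split.
  + by move=> t; rewrite in_itv/= => /andP[nt _]; have [] := dF t (lt_trans n0 nt).
  + apply: cvg_at_right_filter; apply: differentiable_continuous.
    by apply/derivable1_diffP; have [] := dF _ n0.
  + apply: cvg_at_left_filter; apply: differentiable_continuous.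
    by apply/derivable1_diffP; have [] := dF _ (ltr0Sn R n.+1).
- move=> t; rewrite in_itv/= => /andP[nt _]; rewrite derive1E.
  by have [_ ->] := dF t (lt_trans n0 nt).
Unshelve. all: by end_near. Qed.

(** The integrand is the derivative of - exp(- sqrt t). It behaves like t^(-1/2) at 0 and decays at
    infinity, so it can dominate at both ends at once. *)
Lemma sqrt_decay_integrable :
  leb.-integrable `]0, +oo[ (EFin \o (fun t : R => expR (- Num.sqrt t) / (2 * Num.sqrt t))).
Proof.
have dF (t : R) : 0 < t -> is_derive t 1 (fun t : R => - expR (- Num.sqrt t))
    (expR (- Num.sqrt t) / (2 * Num.sqrt t)).
  move=> t0; have ds := is_derive1_sqrt t0.
  have dN : is_derive t 1 (fun t : R => - Num.sqrt t) (- (2 * Num.sqrt t)^-1).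
    exact: is_deriveN.
  have := @is_derive1_comp _ expR (fun t => - Num.sqrt t) t _ _ _ dN.
  move=> /(_ (expR (- Num.sqrt t)) (is_derive_expR _)) h.
  rewrite -[X in is_derive _ _ _ X]opprK -mulrN; exact: is_deriveN.
apply: (bounded_primitive_integrable _ _ 1 dF).
- move=> t t0; apply: cvgM.
    apply: continuous_comp; last exact: continuous_expR.
    by apply: cvgN; exact: sqrt_continuous.
  apply: cvgV; first by rewrite mulf_neq0// gt_eqF// sqrtr_gt0.
  by apply: cvgMr; exact: sqrt_continuous.
- by move=> t t0; rewrite divr_ge0 ?expR_ge0// mulr_ge0// sqrtr_ge0.
- by move=> t t0; rewrite normrN ger0_norm ?expR_ge0// -expR0 ler_expR lerNl oppr0 sqrtr_ge0.
Qed.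

Definition gamma_weight (p t : R) : R := expR (- t) * t `^ p.

Lemma gamma_weight_ge0 p t : 0 <= gamma_weight p t.
Proof. by rewrite mulr_ge0 ?expR_ge0 ?powR_ge0. Qed.

(** From 1 + ln u <= u at u = t / (2 q). *)
Lemma powR_le_expR (q : R) : 0 < q ->
  exists2 C, 0 < C & forall t, 0 < t -> t `^ q <= C * expR (t / 2).
Proof.
move=> q0; exists (expR (q * ln (2 * q))); first exact: expR_gt0.
move=> t t0; rewrite /powR gt_eqF// -expRD ler_expR.
have q2 : 0 < 2 * q by rewrite mulr_gt0.
have h : 1 + ln (t / (2 * q)) <= t / (2 * q).
  rewrite -[leRHS](@lnK R); last by rewrite posrE divr_gt0.
  exact: expR_ge1Dx.
rewrite lnM ?posrE ?invr_gt0// lnV ?posrE// in h.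
have : q * (1 + (ln t - ln (2 * q))) <= q * (t / (2 * q)) by rewrite ler_wpM2l// ltW.
have -> : q * (t / (2 * q)) = t / 2 by field; rewrite gt_eqF.
lra.
Qed.

Lemma measurable_gamma_weight p :
  measurable_fun (`]0, +oo[%classic : set R) (gamma_weight p).
Proof.
apply: measurable_funTS; apply: measurable_funM; last exact: measurable_powR.
by apply: measurableT_comp => //; exact: measurableT_comp.
Qed.

(** The power t^(p + 1/2) is absorbed by e^(t/2), and the remaining e^(-t/2) is at most e^(1/2 -
    sqrt t) since (sqrt t - 1)^2 >= 0. *)
Lemma gamma_weight_integrable p : - 2^-1 < p ->
  leb.-integrable `]0, +oo[ (EFin \o gamma_weight p).
Proof.
move=> p0; have [|C C0 hC] := powR_le_expR (p + 2^-1); first lra.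
pose g (t : R) := 2 * C * expR 2^-1 * (expR (- Num.sqrt t) / (2 * Num.sqrt t)).
have ig : leb.-integrable `]0, +oo[ (EFin \o g).
  exact: (integrable_scale_in leb _ (measurable_itv _) _ _ sqrt_decay_integrable).
apply: (integrable_dom_in leb _ (measurable_itv _) _ g) => //.
- exact: measurable_gamma_weight.
- move=> t; rewrite /= in_itv/= andbT => t0.
  have s0 : 0 < Num.sqrt t by rewrite sqrtr_gt0.
  rewrite (ger0_norm (gamma_weight_ge0 _ _)).
  rewrite [leRHS](_ : _ = C * expR (2^-1 - Num.sqrt t) / Num.sqrt t); last first.
    by rewrite /g expRD; field; rewrite gt_eqF.
  rewrite ler_pdivlMr// /gamma_weight -mulrA -powR12_sqrt ?(ltW t0)//.
  rewrite -powRD; last by apply/implyP => _; rewrite gt_eqF.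
  rewrite powR12_sqrt ?(ltW t0)//.
  rewrite (@le_trans _ _ (expR (- t) * (C * expR (t / 2))))//.
    by rewrite ler_wpM2l ?expR_ge0// hC.
  rewrite mulrCA ler_pM2l// -expRD ler_expR.
  have := sqr_ge0 (Num.sqrt t - 1); rewrite sqrrB1 sqr_sqrtr ?(ltW t0)//; lra.
Qed.

End gamma_weights.

(** * Gaussians, with explicit dependence on the scale *)

Section gaussian.
Context {R : realType} {d : nat}.
Notation T := 'rV[R]_d.
Implicit Types (u w h : T) (s : R).

Definition gaussian s u := expR (- (s * dotv u u)).

Lemma gaussian_ge0 s u : 0 <= gaussian s u.
Proof. exact: expR_ge0. Qed.

Lemma norm_sqr_le_dotv u : `|u| ^+ 2 <= dotv u u.
Proof. by rewrite -enorm_sqr lerXn2r ?nnegrE ?enorm_ge0 ?norm_le_enorm. Qed.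

Lemma dotv_ge0 u : 0 <= dotv u u.
Proof. by rewrite -enorm_sqr sqr_ge0. Qed.

Lemma gaussian_le1 s u : 0 <= s -> gaussian s u <= 1.
Proof. by move=> s0; rewrite -expR0 ler_expR lerNl oppr0 mulr_ge0 ?dotv_ge0. Qed.

Lemma gaussian_sqr_le s u : 0 <= s -> s * `|u| ^+ 2 * gaussian s u <= 1.
Proof.
move=> s0; rewrite /gaussian expRN ler_pdivrMr ?expR_gt0// mul1r.
have := expR_ge1Dx (s * dotv u u).
have : s * `|u| ^+ 2 <= s * dotv u u by rewrite ler_wpM2l// norm_sqr_le_dotv.
lra.
Qed.

Lemma is_derive_dotv_line u h (t : R) :
  is_derive t 1 (fun t : R => dotv (u + t *: h) (u + t *: h))
    (2 * dotv (u + t *: h) h).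
Proof.
have -> : (fun t : R => dotv (u + t *: h) (u + t *: h)) =
    (fun t : R => dotv u u) \+ ((fun t : R => t) \*
       ((fun=> 2 * dotv u h) \+ (fun t : R => dotv h h * t))).
  by apply/funext => r /=; rewrite !dotvDl !dotvDr !dotvZl !dotvZr (dotvC h u); ring.
have d1 : is_derive t 1 (fun t : R => t) 1 by exact: is_derive_id.
have d2 : is_derive t 1 (fun t : R => dotv h h * t) (dotv h h).
  by rewrite -[X in is_derive _ _ _ X]mulr1; exact: is_deriveZ.
have d3 : is_derive t 1 (fun _ : R => dotv u u) 0 by exact: is_derive_cst.
have d4 : is_derive t 1 (fun _ : R => 2 * dotv u h) 0 by exact: is_derive_cst.
have := is_deriveD d3 (is_deriveM d1 (is_deriveD d4 d2)).
move/is_derive_eq; apply; rewrite !dotvDl !dotvZl /= !fctE.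
by rewrite /GRing.scale/=; ring.
Qed.

Lemma is_derive_gaussian_line s u h (t : R) :
  is_derive t 1 (fun t : R => gaussian s (u + t *: h))
    (- (2 * s * dotv (u + t *: h) h * gaussian s (u + t *: h))).
Proof.
have d1 : is_derive t 1 (fun t : R => - (s * dotv (u + t *: h) (u + t *: h)))
    (- (s * (2 * dotv (u + t *: h) h))).
  apply: is_deriveN; apply: is_deriveZ; exact: is_derive_dotv_line.
have := @is_derive1_comp _ expR (fun t => - (s * dotv (u + t *: h) (u + t *: h)))
  t _ _ (is_derive_expR _) d1.
by move/is_derive_eq; apply; rewrite /gaussian; ring.
Qed.

Lemma is_derive_line_coord u h (t : R) i :
  is_derive t 1 (fun t : R => (u + t *: h) 0 i) (h 0 i).
Proof.
have -> : (fun t : R => (u + t *: h) 0 i) = (fun=> u 0 i) \+ (fun t => h 0 i * t).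
  by apply/funext => r; rewrite !mxE mulrC.
rewrite -[X in is_derive _ _ _ X]add0r; apply: is_deriveD.
by rewrite -[X in is_derive _ _ _ X]mulr1; exact: is_deriveZ.
Qed.

Lemma is_derive_linear (c t : R) : is_derive t 1 (fun t : R => c * t) c.
Proof. by rewrite -[X in is_derive _ _ _ X]mulr1; exact: is_deriveZ. Qed.

(** With g the Gaussian at v, 2 s |v| g <= s g + s |v|^2 g <= s + 1. *)
Lemma gaussian_lip s u w : 0 <= s ->
  `|gaussian s w - gaussian s u| <= d%:R * (1 + s) * `|w - u|.
Proof.
move=> s0; pose h := w - u; have uh : u + h = w by rewrite /h addrC subrK.
have := @abs_increment_le R (fun t => gaussian s (u + t *: h))
  (fun t => d%:R * (1 + s) * `|h| * t) _ (fun=> d%:R * (1 + s) * `|h|) 0 1 ler01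
  (fun t _ => is_derive_gaussian_line s u h t)
  (fun t _ => is_derive_linear _ t).
rewrite scale1r scale0r addr0 mulr0 subr0 mulr1 uh; apply => t _.
set v := u + _; rewrite -/h normrN normrM (ger0_norm (gaussian_ge0 _ _)).
rewrite normrM (ger0_norm (mulr_ge0 _ s0))//.
rewrite (@le_trans _ _ (2 * s * (d%:R * (`|v| * `|h|)) * gaussian s v))//.
  by rewrite ler_wpM2r ?gaussian_ge0// ler_wpM2l ?mulr_ge0// dotv_le.
rewrite (_ : 2 * s * _ * _ = d%:R * (2 * `|v| * s * gaussian s v) * `|h|); last by ring.
rewrite ler_wpM2r// ler_wpM2l//.
have h1 := gaussian_sqr_le s v s0.
have h2 : s * gaussian s v <= s by rewrite ler_piMr// gaussian_le1.
have : 0 <= s * gaussian s v * (`|v| - 1) ^+ 2.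
  by rewrite mulr_ge0 ?sqr_ge0// mulr_ge0 ?gaussian_ge0.
by rewrite sqrrB1; lra.
Qed.

(** The constant is uniform in [s] because s |v|^2 g <= 1; this is what keeps the Taylor remainder
    below linear in [s]. *)
Lemma gaussian_coord_lip s u w i : 0 <= s ->
  `|gaussian s w * w 0 i - gaussian s u * u 0 i| <= (1 + 2 * d%:R) * `|w - u|.
Proof.
move=> s0; pose h := w - u; have uh : u + h = w by rewrite /h addrC subrK.
have dP (t : R) := is_deriveM (is_derive_gaussian_line s u h t)
  (is_derive_line_coord u h t i).
have := @abs_increment_le R _ (fun t => (1 + 2 * d%:R) * `|h| * t) _
  (fun=> (1 + 2 * d%:R) * `|h|) 0 1 ler01 (fun t _ => dP t)
  (fun t _ => is_derive_linear _ t).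
rewrite /= !fctE scale1r scale0r addr0 mulr0 subr0 mulr1 uh; apply => t _.
set v := u + _; rewrite -/h /GRing.scale/=.
rewrite (le_trans (ler_normD _ _))// [leRHS]mulrDl mul1r lerD//.
  rewrite normrM (ger0_norm (gaussian_ge0 _ _)) -[leRHS]mul1r.
  by rewrite ler_pM ?gaussian_ge0 ?gaussian_le1// coord_norm_le.
have g0 := gaussian_ge0 s v.
have h2 : `|2 * s * dotv v h * gaussian s v| <=
    2 * s * (d%:R * (`|v| * `|h|)) * gaussian s v.
  rewrite normrM (ger0_norm g0) normrM (ger0_norm (mulr_ge0 _ s0))//.
  by apply: ler_wpM2r => //; apply: ler_wpM2l; [exact: mulr_ge0|exact: dotv_le].
rewrite mulrN normrN normrM (le_trans (ler_pM _ _ (coord_norm_le v i) h2))//.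
rewrite [leLHS](_ : _ = 2 * d%:R * `|h| * (s * `|v| ^+ 2 * gaussian s v)); last by ring.
by rewrite ler_piMr ?gaussian_sqr_le// !mulr_ge0.
Qed.

(** Since the remainder is linear in [s], for [s = scl t] it costs a single power of 1/t, which the
    mixing weight can afford. *)
Lemma gaussian_taylor s u h : 0 <= s ->
  `|gaussian s (u + h) - gaussian s u + 2 * s * (gaussian s u * dotv u h)| <=
  (2 * d%:R * (1 + 2 * d%:R) * `|h| ^+ 2) * s.
Proof.
move=> s0; pose l := - (2 * s * (gaussian s u * dotv u h)).
have dP (t : R) := is_deriveB (is_derive_gaussian_line s u h t) (is_derive_linear l t).
have := @abs_increment_le R _ (fun t => (2 * d%:R * (1 + 2 * d%:R) * `|h| ^+ 2) * s * t) _
  (fun=> (2 * d%:R * (1 + 2 * d%:R) * `|h| ^+ 2) * s) 0 1 ler01 (fun t _ => dP t)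
  (fun t _ => is_derive_linear _ t).
rewrite /= !fctE scale1r scale0r addr0 !mulr0 !subr0 !mulr1 => H.
have -> : gaussian s (u + h) - gaussian s u + 2 * s * (gaussian s u * dotv u h) =
  gaussian s (u + h) - l - gaussian s u by rewrite /l; ring.
apply: H => t /andP[t0 t1]; set v := u + _.
have -> : - (2 * s * dotv v h * gaussian s v) - l =
    - (2 * s * \sum_(i < d) (gaussian s v * v 0 i - gaussian s u * u 0 i) * h 0 i).
  rewrite /l; under eq_bigr do rewrite mulrBl -!mulrA.
  by rewrite big_split/= sumrN -!mulr_sumr -!/(dotv _ _); ring.
rewrite normrN normrM ger0_norm ?mulr_ge0//.
rewrite (_ : _ * _ * s = 2 * s * (d%:R * ((1 + 2 * d%:R) * `|h| * `|h|))); last by ring.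
rewrite ler_wpM2l ?mulr_ge0// (le_trans (ler_norm_sum _ _ _))//.
rewrite (@le_trans _ _ (\sum_(i < d) ((1 + 2 * d%:R) * `|h| * `|h|)))//; last first.
  by rewrite sumr_const card_ord -[leLHS]mulr_natl.
apply: ler_sum => i _; rewrite normrM ler_pM ?coord_norm_le//.
rewrite (le_trans (gaussian_coord_lip s u v i s0))// ler_wpM2l ?addr_ge0//.
by rewrite /v addrAC subrr add0r normrZ ger0_norm// ler_piMl.
Qed.

End gaussian.

(** * The Bessel profile as a mixture of Gaussians *)

Section mixture.
Context {R : realType}.
Notation leb := (@lebesgue_measure R).
Variable nu : R.
Hypothesis hnu : 3 / 2 < nu.
Notation D := (`]0, +oo[%classic : set R).
Implicit Types (phi psi : R -> R).

Definition scl (t : R) := (4 * t)^-1.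

(** Average in the integration variable of the Bessel representation; with [scl t] as scale, the
    factor exp(- r^2 / (4 t)) is a Gaussian. *)
Definition mix phi := \int[leb]_(t in D) (gamma_weight (nu - 1) t * phi t).

(** Value of [mix] at [A + B * scl t]: one factor 1/(4 t) lowers the exponent nu - 1 to nu - 2,
    still above -1/2 for nu > 3/2. *)
Definition mix_bound (A B : R) :=
  A * \int[leb]_(t in D) gamma_weight (nu - 1) t +
  B / 4 * \int[leb]_(t in D) gamma_weight (nu - 2) t.

Let hnu' : 3 * 2^-1 < nu. Proof. exact: hnu. Qed.

Let nu1 : - 2^-1 < nu - 1. Proof. have := hnu'; lra. Qed.

Let nu2 : - 2^-1 < nu - 2. Proof. have := hnu'; lra. Qed.

Let mD : measurable D. Proof. exact: measurable_itv. Qed.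

Let i0 : leb.-integrable D (EFin \o gamma_weight (nu - 1)).
Proof. exact: gamma_weight_integrable. Qed.

Let i1 : leb.-integrable D (EFin \o gamma_weight (nu - 2)).
Proof. exact: gamma_weight_integrable. Qed.

Lemma scl_gt0 t : D t -> 0 < scl t.
Proof. by rewrite /= in_itv/= andbT => t0; rewrite invr_gt0 mulr_gt0. Qed.

Lemma measurable_scl : measurable_fun D scl.
Proof.
apply: open_continuous_measurable_fun => // t; rewrite inE/= in_itv/= andbT => t0.
apply: cvgV; first by rewrite mulf_neq0// gt_eqF.
by apply: cvgMr; exact: cvg_id.
Qed.

Let dom A B (t : R) := A * gamma_weight (nu - 1) t + B / 4 * gamma_weight (nu - 2) t.

Let idom A B : leb.-integrable D (EFin \o dom A B).
Proof.
apply: (integrable_add_in leb) => //; exact: (integrable_scale_in leb).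
Qed.

Let dom_le phi A B t : D t -> `|phi t| <= A + B * scl t ->
  `|gamma_weight (nu - 1) t * phi t| <= dom A B t.
Proof.
move=> Dt h; rewrite normrM (ger0_norm (gamma_weight_ge0 _ _)).
rewrite (le_trans (ler_wpM2l (gamma_weight_ge0 _ _) h))//.
move: Dt; rewrite /= in_itv/= andbT => t0.
rewrite /dom (_ : gamma_weight (nu - 1) t = t * gamma_weight (nu - 2) t).
  by rewrite /scl le_eqVlt; apply/orP; left; apply/eqP; field; rewrite gt_eqF.
rewrite /gamma_weight (_ : nu - 1 = (nu - 2) + 1); last by ring.
rewrite powRD; last by apply/implyP => _; rewrite gt_eqF.
by rewrite powRr1 ?ltW//; ring.
Qed.

Let mphi phi : measurable_fun D phi ->
  measurable_fun D (fun t => gamma_weight (nu - 1) t * phi t).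
Proof. by move=> m; apply: measurable_funM => //; exact: measurable_gamma_weight. Qed.

Lemma mix_integrable phi A B : measurable_fun D phi ->
  (forall t, D t -> `|phi t| <= A + B * scl t) ->
  leb.-integrable D (EFin \o (fun t => gamma_weight (nu - 1) t * phi t)).
Proof.
move=> m h; apply: (integrable_dom_in leb _ mD _ (dom A B)) => //.
  exact: mphi.
by move=> t Dt; apply: dom_le => //; exact: h.
Qed.

Lemma mix_le phi A B : measurable_fun D phi ->
  (forall t, D t -> `|phi t| <= A + B * scl t) -> `|mix phi| <= mix_bound A B.
Proof.
move=> m h; have -> : mix_bound A B = \int[leb]_(t in D) dom A B t.
  rewrite /dom RintegralD//; last 2 first.
  - exact: (integrable_scale_in leb).
  - exact: (integrable_scale_in leb).
  by rewrite !RintegralZl.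
apply: Rintegral_abs_le_in => //; first exact: mphi.
by move=> t Dt; apply: dom_le => //; exact: h.
Qed.

Lemma mixB phi psi A B A' B' : measurable_fun D phi -> measurable_fun D psi ->
  (forall t, D t -> `|phi t| <= A + B * scl t) ->
  (forall t, D t -> `|psi t| <= A' + B' * scl t) ->
  mix (fun t => phi t - psi t) = mix phi - mix psi.
Proof.
move=> m1 m2 h1 h2; rewrite /mix -RintegralB//.
- by apply: eq_Rintegral => t _; rewrite mulrBr.
- exact: mix_integrable h1.
- exact: mix_integrable h2.
Qed.

Lemma mix_bound_ge0 A B : 0 <= A -> 0 <= B -> 0 <= mix_bound A B.
Proof.
move=> A0 B0; rewrite addr_ge0// mulr_ge0// ?divr_ge0//;
  by apply: Rintegral_ge0 => t _; exact: gamma_weight_ge0.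
Qed.

Lemma mix_boundZ c A B : mix_bound (c * A) (c * B) = c * mix_bound A B.
Proof. by rewrite /mix_bound; ring. Qed.

Context {d : nat}.
Notation T := 'rV[R]_d.
Implicit Types u w h : T.

Lemma measurable_gaussian_scl u : measurable_fun D (fun t => gaussian (scl t) u).
Proof.
apply: measurableT_comp => //; apply: measurableT_comp => //.
by apply: measurable_funM => //; exact: measurable_scl.
Qed.

Lemma gaussian_scl_bound u t : D t -> `|gaussian (scl t) u| <= 1 + 0 * scl t.
Proof.
move=> Dt; rewrite mul0r addr0 ger0_norm ?gaussian_ge0// gaussian_le1//.
exact/ltW/scl_gt0.
Qed.

Definition gmix u := mix (fun t => gaussian (scl t) u).

(** Minus the differential of [gmix] at [u] in the direction [h]. *)
Definition dgmix u h := mix (fun t => 2 * scl t * (gaussian (scl t) u * dotv u h)).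

Lemma measurable_dgauss u h :
  measurable_fun D (fun t => 2 * scl t * (gaussian (scl t) u * dotv u h)).
Proof.
apply: measurable_funM.
  by apply: measurable_funM => //; exact: measurable_scl.
by apply: measurable_funM => //; exact: measurable_gaussian_scl.
Qed.

Lemma dgauss_bound u h t : D t ->
  `|2 * scl t * (gaussian (scl t) u * dotv u h)| <=
  0 + 2 * (d%:R * (`|u| * `|h|)) * scl t.
Proof.
move=> Dt; have s0 := scl_gt0 t Dt; rewrite add0r.
rewrite normrM (ger0_norm (mulr_ge0 _ (ltW s0)))// normrM.
rewrite (ger0_norm (gaussian_ge0 _ _)) [leRHS]mulrAC ler_wpM2l//.
  by rewrite mulr_ge0// ltW.
rewrite -[leRHS]mul1r ler_pM ?gaussian_ge0 ?dotv_le// gaussian_le1//.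
exact: ltW.
Qed.

Lemma gmix_lip u w : `|gmix w - gmix u| <= mix_bound d%:R d%:R * `|w - u|.
Proof.
rewrite -(mixB _ _ 1 0 1 0); last 4 first.
- exact: measurable_gaussian_scl.
- exact: measurable_gaussian_scl.
- exact: gaussian_scl_bound.
- exact: gaussian_scl_bound.
rewrite mulrC -mix_boundZ; apply: mix_le => [|t Dt].
  by apply: measurable_funB; exact: measurable_gaussian_scl.
rewrite (le_trans (gaussian_lip _ _ _ (ltW (scl_gt0 t Dt))))//.
by rewrite le_eqVlt; apply/orP; left; apply/eqP; ring.
Qed.

Lemma gmix_ge0 u : 0 <= gmix u.
Proof.
by apply: Rintegral_ge0 => t _; rewrite mulr_ge0 ?gamma_weight_ge0 ?gaussian_ge0.
Qed.

Lemma gmix_le u : gmix u <= mix_bound 1 0.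
Proof.
rewrite (le_trans (ler_norm _))//; apply: mix_le.
  exact: measurable_gaussian_scl.
exact: gaussian_scl_bound.
Qed.

Lemma gmix_taylor u h : `|gmix (u + h) - gmix u + dgmix u h| <=
  mix_bound 0 (2 * d%:R * (1 + 2 * d%:R)) * `|h| ^+ 2.
Proof.
have -> : gmix (u + h) - gmix u + dgmix u h =
    mix (fun t => gaussian (scl t) (u + h) - gaussian (scl t) u +
      2 * scl t * (gaussian (scl t) u * dotv u h)).
  rewrite -(mixB _ _ 1 0 1 0); last 4 first.
  - exact: measurable_gaussian_scl.
  - exact: measurable_gaussian_scl.
  - exact: gaussian_scl_bound.
  - exact: gaussian_scl_bound.
  rewrite /mix -RintegralD//.
  - by apply: eq_Rintegral => t _; rewrite [RHS]mulrDr.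
  - apply: (mix_integrable _ 2 0).
      by apply: measurable_funB; exact: measurable_gaussian_scl.
    move=> t Dt; rewrite (le_trans (ler_normB _ _))//.
    have := gaussian_scl_bound (u + h) t Dt; have := gaussian_scl_bound u t Dt; lra.
  - exact: mix_integrable (measurable_dgauss u h) (dgauss_bound u h).
rewrite mulrC -mix_boundZ mulr0; apply: mix_le => [|t Dt].
  apply: measurable_funD; last exact: measurable_dgauss.
  by apply: measurable_funB; exact: measurable_gaussian_scl.
rewrite add0r (le_trans (gaussian_taylor _ _ _ (ltW (scl_gt0 t Dt))))//.
by rewrite le_eqVlt; apply/orP; left; apply/eqP; ring.
Qed.

Lemma dgmix_lip u w h : `|dgmix w h - dgmix u h| <=
  mix_bound 0 (2 * d%:R * (1 + 2 * d%:R)) * (`|w - u| * `|h|).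
Proof.
rewrite -(mixB _ _ _ _ _ _ (measurable_dgauss w h) (measurable_dgauss u h)
  (dgauss_bound w h) (dgauss_bound u h)).
rewrite mulrC -mix_boundZ mulr0; apply: mix_le => [|t Dt].
  by apply: measurable_funB; exact: measurable_dgauss.
have s0 := ltW (scl_gt0 t Dt); rewrite -mulrBr add0r.
have -> : gaussian (scl t) w * dotv w h - gaussian (scl t) u * dotv u h =
    \sum_(i < d) (gaussian (scl t) w * w 0 i - gaussian (scl t) u * u 0 i) * h 0 i.
  under eq_bigr do rewrite mulrBl -!mulrA.
  by rewrite big_split/= sumrN -!mulr_sumr.
rewrite normrM ger0_norm ?mulr_ge0//.
rewrite [leRHS](_ : _ = 2 * scl t * (d%:R * ((1 + 2 * d%:R) * `|w - u| * `|h|))); last by ring.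
rewrite ler_wpM2l ?mulr_ge0// (le_trans (ler_norm_sum _ _ _))//.
rewrite (@le_trans _ _ (\sum_(i < d) ((1 + 2 * d%:R) * `|w - u| * `|h|)))//; last first.
  by rewrite sumr_const card_ord -[leLHS]mulr_natl.
apply: ler_sum => i _; rewrite normrM ler_pM ?coord_norm_le//.
exact: gaussian_coord_lip.
Qed.

(** For r > 0 the factors r^nu and (r/2)^(-nu) combine to 2^nu. At r = 0 the profile is defined as a
    limit, which is computed from the Lipschitz dependence of the mixture on the squared radius. *)
Lemma bessel_profileE u : bessel_profile nu (enorm u) = 2^-1 * 2 `^ nu * gmix u.
Proof.
have P r : 0 < r -> r `^ nu * besselK (- nu) r = 2^-1 * 2 `^ nu *
   mix (fun t => expR (- (scl t * r ^+ 2))).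
  move=> r0; rewrite /besselK /mix opprK.
  have -> : r `^ nu * (2^-1 * (r / 2) `^ (- nu) * \int[leb]_(t in D)
      (expR (- t - r ^+ 2 / (4 * t)) * t `^ (nu - 1))) =
    2^-1 * (r `^ nu * (r / 2) `^ (- nu)) * \int[leb]_(t in D)
      (expR (- t - r ^+ 2 / (4 * t)) * t `^ (nu - 1)) by ring.
  congr (_ * _ * _).
    have r2 : 0 < r / 2 by rewrite divr_gt0.
    have -> : r `^ nu = 2 `^ nu * (r / 2) `^ nu.
      by rewrite -powRM ?(ltW r2)// mulrC divfK.
    by rewrite powRN mulfK// gt_eqF// powR_gt0.
  apply: eq_Rintegral => t _.
  by rewrite /gamma_weight expRD /scl [r ^+ 2 / _]mulrC; ring.
rewrite /bessel_profile; case: eqP => [u0|/eqP u0]; last first.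
  rewrite P; last by rewrite lt_neqAle eq_sym u0 enorm_ge0.
  by rewrite enorm_sqr.
have duu : dotv u u = 0 by rewrite -enorm_sqr u0 expr0n.
(* Integrated form of 1 - exp(- x) <= x. *)
have m_lip q : 0 <= q ->
    `|mix (fun t => expR (- (scl t * q))) - gmix u| <= mix_bound 0 1 * q.
  move=> q0; have me v : measurable_fun D (fun t => expR (- (scl t * v))).
    do 2 apply: measurableT_comp => //.
    by apply: measurable_funM => //; exact: measurable_scl.
  have be v t : 0 <= v -> D t -> `|expR (- (scl t * v))| <= 1 + 0 * scl t.
    move=> v0 Dt; rewrite mul0r addr0 ger0_norm ?expR_ge0// -expR0 ler_expR.
    by rewrite lerNl oppr0 mulr_ge0// ltW// scl_gt0.
  have -> : gmix u = mix (fun t => expR (- (scl t * 0))).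
    by rewrite /gmix /gaussian duu.
  rewrite -(mixB _ _ _ _ _ _ (me q) (me 0) (fun t => be q t q0) (fun t => be 0 t (lexx 0))).
  rewrite mulrC -mix_boundZ mulr0 mulr1; apply: mix_le => [|t Dt].
    exact: measurable_funB.
  have s0 := ltW (scl_gt0 t Dt); have sq : 0 <= scl t * q by rewrite mulr_ge0.
  rewrite mulr0 oppr0 expR0 add0r ler0_norm ?subr_le0; last first.
    by rewrite -expR0 ler_expR lerNl oppr0.
  have := expR_ge1Dx (- (scl t * q)); lra.
apply: cvg_lim => //; apply/cvgrPdist_le => /= e e0.
pose c0 := 2^-1 * 2 `^ nu : R.
pose K := c0 * mix_bound 0 1.
have c00 : 0 <= c0 by rewrite mulr_ge0 ?powR_ge0.
have K0 : 0 <= K by rewrite mulr_ge0// mix_bound_ge0.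
near=> r.
have r0 : 0 < r by near: r; exact: nbhs_right_gt.
have r1 : r <= 1 by near: r; apply: nbhs_right_le.
have re : r <= e / (K + 1).
  by near: r; apply: nbhs_right_le; rewrite divr_gt0// ltr_wpDl.
rewrite P// -/c0 -mulrBr normrM (ger0_norm c00) distrC.
rewrite (le_trans (ler_wpM2l c00 (m_lip _ (sqr_ge0 r))))// mulrA -/K.
rewrite (@le_trans _ _ ((K + 1) * r))//; last by rewrite mulrC -ler_pdivlMr// ltr_wpDl.
by rewrite ler_pM ?sqr_ge0 ?lerDl// expr2 ler_piMl// ltW.
Unshelve. all: by end_near. Qed.

End mixture.

(** A first-order expansion with quadratic remainder identifies a directional derivative; for the
    mixture it replaces differentiation under the integral sign. *)
Lemma quadratic_is_derive {R : realType} {W : normedModType R} (f : W -> R)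
    (y v : W) (l C : R) :
  (forall t : R, `|f (t *: v + y) - f y - t * l| <= C * t ^+ 2) ->
  is_derive y v f l.
Proof.
move=> fC.
have cv : t^-1 *: (f (t *: v + y) - f y) @[t --> 0^'] --> l.
  apply/cvgrPdist_le => e e0; near=> t.
  have t0 : t != 0 by near: t; exact: nbhs_dnbhs_neq.
  have tn : 0 < `|t| by rewrite normr_gt0.
  have -> : l - t^-1 *: (f (t *: v + y) - f y) =
      - (t^-1 * (f (t *: v + y) - f y - t * l)).
    by rewrite /GRing.scale/=; field.
  rewrite normrN normrM normfV ler_pdivrMl// (le_trans (fC t))//.
  rewrite -(real_normK (num_real t)) expr2 mulrA [leRHS]mulrC ler_wpM2r//.
  have te : `|t| <= e / (`|C| + 1).
    by near: t; apply: dnbhs0_le; rewrite divr_gt0// ltr_wpDl.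
  rewrite (@le_trans _ _ ((`|C| + 1) * `|t|))//.
    by rewrite ler_wpM2r// (le_trans (ler_norm _))// lerDl.
  by rewrite mulrC -ler_pdivlMr// ltr_wpDl.
apply: DeriveDef; first by apply/cvg_ex; exists l.
exact: cvg_lim cv.
Unshelve. all: by end_near. Qed.

(** * Regularity of the Matern kernel *)

Section matern.
Context {R : realType} {d : nat}.
Notation T := 'rV[R]_d.
Variables (nu : R) (Sigma : 'M[R]_d).
Hypothesis hnu : 3 / 2 < nu.
Implicit Types x y z : T.

Let kappa := 2 `^ (1 - (d%:R / 2 + nu)) / Gamma (d%:R / 2 + nu) * (2^-1 * 2 `^ nu) : R.

Let kappa0 : 0 <= kappa.
Proof.
rewrite mulr_ge0 ?mulr_ge0 ?powR_ge0 ?invr_ge0//.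
by apply: Rintegral_ge0 => t _; rewrite mulr_ge0 ?powR_ge0 ?expR_ge0.
Qed.

Lemma maternE z : matern nu Sigma z = kappa * gmix nu (z *m Sigma^T).
Proof. by rewrite /matern bessel_profileE// mulrA. Qed.

Let Sg := d%:R * `|Sigma|.

Let Sg0 : 0 <= Sg. Proof. by rewrite mulr_ge0. Qed.

Lemma mulmx_norm_le z : `|z *m Sigma^T| <= Sg * `|z|.
Proof.
apply: rV_norm_le => [|j]; first by rewrite mulr_ge0.
rewrite mxE (le_trans (ler_norm_sum _ _ _))//.
rewrite (@le_trans _ _ (\sum_(i < d) (`|Sigma| * `|z|)))//; last first.
  by rewrite sumr_const card_ord -[leLHS]mulr_natl mulrA.
apply: ler_sum => i _; rewrite mxE normrM mulrC ler_pM ?coord_norm_le//.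
rewrite [leRHS]/Num.Def.normr/= mx_normrE.
by apply: (le_bigmax _ (fun ij : 'I_d * 'I_d => `|Sigma ij.1 ij.2|) (j, i)).
Qed.

Let CP := kappa * (mix_bound nu d%:R d%:R * Sg).

Lemma matern_lip z z' : `|matern nu Sigma z - matern nu Sigma z'| <= CP * `|z - z'|.
Proof.
rewrite !maternE -mulrBr normrM (ger0_norm kappa0) /CP -[leRHS]mulrA ler_wpM2l//.
rewrite (le_trans (gmix_lip _ hnu _ _))// -[leRHS]mulrA ler_wpM2l ?mix_bound_ge0//.
by rewrite -mulmxBl mulmx_norm_le.
Qed.

Let CP0 := kappa * mix_bound nu 1 0.

Lemma matern_bound z : `|matern nu Sigma z| <= CP0.
Proof.
rewrite maternE normrM (ger0_norm kappa0) /CP0 ler_wpM2l// ger0_norm ?gmix_ge0//.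
exact: gmix_le.
Qed.

Lemma dgmixZ (u h : T) c : dgmix nu u (c *: h) = c * dgmix nu u h.
Proof.
rewrite /dgmix /mix -RintegralZl//; last first.
  exact: (mix_integrable nu hnu _ 0 _ (measurable_dgauss u h) (dgauss_bound u h)).
by apply: eq_Rintegral => t _; rewrite dotvZr; ring.
Qed.

(** Gradient of [matern]: the sign undoes the one in [dgmix], and the chain rule maps the direction
    by [Sigma]. *)
Definition dmatern z : T :=
  \row_i (- (kappa * dgmix nu (z *m Sigma^T) (basis_vec i *m Sigma^T))).

Lemma is_derive_matern x y i :
  is_derive y (basis_vec i) (fun y => matern nu Sigma (x - y)) (- dmatern (x - y) 0 i).
Proof.
set u := (x - y) *m Sigma^T; set h := basis_vec i *m Sigma^T.
apply: (@quadratic_is_derive _ _ _ _ _ _ (kappa *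
  (mix_bound nu 0 (2 * d%:R * (1 + 2 * d%:R)) * `|h| ^+ 2))) => t.
rewrite !maternE mxE opprK -/u -/h.
have -> : (x - (t *: basis_vec i + y)) *m Sigma^T = u + (- t) *: h.
  by rewrite /u /h scaleNr scalemxAl -mulmxBl opprD addrA addrAC.
have -> : kappa * gmix nu (u + - t *: h) - kappa * gmix nu u - t * (kappa * dgmix nu u h) =
  kappa * (gmix nu (u + - t *: h) - gmix nu u + dgmix nu u (- t *: h)).
  by rewrite dgmixZ; ring.
rewrite normrM (ger0_norm kappa0) -[leRHS]mulrA ler_wpM2l//.
rewrite (le_trans (gmix_taylor _ hnu _ _))// -[leRHS]mulrA ler_wpM2l ?mix_bound_ge0 ?mulr_ge0 ?addr_ge0//.
by rewrite normrZ normrN exprMn mulrC real_normK ?num_real.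
Qed.

Let CD := kappa * (mix_bound nu 0 (2 * d%:R * (1 + 2 * d%:R)) * (Sg * Sg)).

Let mb : 0 <= mix_bound nu 0 (2 * d%:R * (1 + 2 * d%:R)).
Proof. exact: mix_bound_ge0. Qed.

Let CD0 : 0 <= CD.
Proof. by apply: mulr_ge0 => //; apply: mulr_ge0 => //; exact: mulr_ge0. Qed.

Let CPge0 : 0 <= CP.
Proof.
by apply: mulr_ge0 => //; apply: mulr_ge0 => //; exact: mix_bound_ge0.
Qed.

Let CP00 : 0 <= CP0. Proof. exact: le_trans (matern_bound 0). Qed.

Lemma dmatern_lip z z' : `|dmatern z - dmatern z'| <= CD * `|z - z'|.
Proof.
apply: rV_norm_le => [|i]; first exact: mulr_ge0.
rewrite rV_subE [X in X - _]mxE [X in _ - X]mxE -opprD normrN -mulrBr.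
rewrite normrM (ger0_norm kappa0) [leRHS](_ : _ = kappa *
  (mix_bound nu 0 (2 * d%:R * (1 + 2 * d%:R)) * ((Sg * `|z - z'|) * Sg))); last first.
  by rewrite /CD; ring.
apply: ler_wpM2l => //; apply: (le_trans (dgmix_lip _ hnu _ _ _)).
apply: ler_wpM2l => //; rewrite -mulmxBl; apply: ler_pM => //.
  exact: mulmx_norm_le.
by rewrite (le_trans (mulmx_norm_le _))// ler_piMr// norm_basis.
Qed.

(** Every Gaussian of the mixture has a critical point at the origin. With the Lipschitz bound this
    yields linear growth of the gradient. *)
Lemma dmatern0 : dmatern 0 = 0.
Proof.
apply/rowP => i; rewrite !mxE mul0mx /dgmix /mix.
under eq_Rintegral => t _.
  rewrite (_ : dotv 0 _ = 0); last first.
    by rewrite /dotv big1// => j _; rewrite mxE mul0r.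
  rewrite !mulr0; over.
by rewrite Rintegral_cst ?mul0r ?mulr0 ?oppr0//; exact: measurable_itv.
Qed.

Lemma grad_kernel x y : grad (svgd_kernel nu Sigma x) y = x - dmatern (x - y).
Proof.
apply/rowP => i; rewrite mxE rV_subE.
have d1 : is_derive y (basis_vec i) (fun v : T => 1 + dotv x v) (x 0 i).
  apply: (@quadratic_is_derive _ _ _ _ _ _ 0) => t.
  by rewrite dotvDr dotvZr dotv_basis mul0r (_ : _ - _ = 0) ?normr0//; ring.
by have [_ ->] := is_deriveD d1 (is_derive_matern x y i).
Qed.

Lemma matern_bounds : exists C, [/\ 0 <= C,
  forall z, `|matern nu Sigma z| <= C,
  forall z z', `|matern nu Sigma z - matern nu Sigma z'| <= C * `|z - z'| &
  forall z z', `|dmatern z - dmatern z'| <= C * `|z - z'|].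
Proof.
have c1 : 0 <= CP + CP0 by exact: addr_ge0.
exists (CP + CP0 + CD); split.
- exact: addr_ge0.
- by move=> z; rewrite (le_trans (matern_bound z))// -addrA addrCA lerDl addr_ge0.
- move=> z z'; rewrite (le_trans (matern_lip z z'))// ler_wpM2r//.
  by rewrite -addrA lerDl addr_ge0.
- by move=> z z'; rewrite (le_trans (dmatern_lip z z'))// ler_wpM2r// lerDr.
Qed.

End matern.

(** * The interaction b(z, y): growth and Lipschitz bounds *)

Section interaction.
Context {R : realType} {d : nat}.
Notation T := 'rV[R]_d.
Implicit Types x y z : T.
Variables (m : T -> R) (dm : T -> T) (C0 : R).
Hypothesis C00 : 0 <= C0.
Hypothesis m_bound : forall z, `|m z| <= C0.
Hypothesis m_lip : forall z z', `|m z - m z'| <= C0 * `|z - z'|.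
Hypothesis dm_lip : forall z z', `|dm z - dm z'| <= C0 * `|z - z'|.
Hypothesis dm0 : dm 0 = 0.
Variables (V : T -> R) (LV : R).
Hypothesis LV0 : 0 <= LV.
Hypothesis gradV_lip : forall x y, `|grad V x - grad V y| <= LV * `|x - y|.
Hypothesis gradV_growth : forall x, `|grad V x| <= LV * wt x.

Let k z y := 1 + dotv z y + m (z - y).

(** Integrand of the SVGD velocity, for a kernel with translation-invariant part [m] of gradient
    [dm]; the second summand is the kernel gradient in the second argument. The product of
    [dotv z y] with [grad V y] causes the growth of degree 1 in [z] and 2 in [y]. *)
Definition interaction z y : T := - (1 + dotv z y + m (z - y)) *: grad V y + (z - dm (z - y)).

Lemma kernel_bound z y : `|k z y| <= (1 + d%:R + C0) * (wt z * wt y).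
Proof.
have w1 : 1 <= wt z * wt y.
  by rewrite -[leLHS]mulr1 ler_pM ?wt_ge1.
rewrite /k (le_trans (ler_normD _ _))// [leRHS]mulrDl lerD//; last first.
  by rewrite (le_trans (m_bound _))// ler_peMr.
rewrite (le_trans (ler_normD _ _))// normr1 [leRHS]mulrDl mul1r lerD//.
by rewrite (le_trans (dotv_le _ _))// ler_wpM2l// ler_pM ?norm_le_wt.
Qed.

Lemma kernel_lip z y z' y' : `|k z y - k z' y'| <=
  (d%:R + C0) * (`|z - z'| * wt y + `|y - y'| * wt z').
Proof.
have -> : k z y - k z' y' = (dotv (z - z') y + dotv z' (y - y')) +
    (m (z - y) - m (z' - y')).
  by rewrite /k dotvBl dotvBr; ring.
rewrite (le_trans (ler_normD _ _))// [leRHS]mulrDl lerD//.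
  rewrite (le_trans (ler_normD _ _))// [leRHS]mulrDr lerD//.
    by rewrite (le_trans (dotv_le _ _))// ler_wpM2l// ler_wpM2l// norm_le_wt.
  rewrite (le_trans (dotv_le _ _))// ler_wpM2l// mulrC ler_wpM2l// norm_le_wt//.
rewrite (le_trans (m_lip _ _))// ler_wpM2l//.
have -> : z - y - (z' - y') = (z - z') - (y - y').
  by rewrite !opprD !opprK addrACA.
rewrite (le_trans (ler_normB _ _))// lerD// ler_peMr ?wt_ge1//.
Qed.

Let Cb := (d%:R + C0) * LV + (1 + d%:R + C0) * LV + 1 + 2 * C0.

Lemma interaction_const_gt0 : 0 < Cb.
Proof.
by rewrite ltr_pwDl ?mulr_ge0// ltr_wpDl// addr_ge0// mulr_ge0// ?addr_ge0.
Qed.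

Lemma interaction_growth z y : `|interaction z y| <= Cb * (wt z * wt y ^+ 2).
Proof.
set X := wt z * wt y ^+ 2.
have zX : wt z <= X by rewrite ler_peMr ?wt_ge0// expr_ge1 ?wt_ge0 ?wt_ge1.
have yX : wt y <= X.
  by rewrite (le_trans (wt_le_sqr _))// ler_peMl ?sqr_ge0 ?wt_ge1.
have X0 : 0 <= X by rewrite mulr_ge0 ?sqr_ge0 ?wt_ge0.
have h1 : `|- k z y *: grad V y| <= (1 + d%:R + C0) * LV * X.
  rewrite normrZ normrN [leRHS](_ : _ =
    (1 + d%:R + C0) * (wt z * wt y) * (LV * wt y)); last by rewrite /X; ring.
  by apply: ler_pM => //; exact: kernel_bound.
have h2 : `|z - dm (z - y)| <= X + 2 * C0 * X.
  rewrite (le_trans (ler_normB _ _))// lerD//.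
    by rewrite (le_trans _ zX) ?norm_le_wt.
  have := dm_lip (z - y) 0; rewrite dm0 !subr0 => h.
  rewrite (le_trans h)// [2 * C0]mulrC -mulrA ler_wpM2l//.
  rewrite (le_trans (ler_normB _ _))//.
  have := norm_le_wt z; have := norm_le_wt y; lra.
have h3 : 0 <= (d%:R + C0) * LV * X by rewrite !mulr_ge0// addr_ge0.
have -> : Cb * X = (d%:R + C0) * LV * X + (1 + d%:R + C0) * LV * X + X + 2 * C0 * X.
  by rewrite /Cb; ring.
have := ler_normD (- k z y *: grad V y) (z - dm (z - y)).
by rewrite -/(interaction z y); lra.
Qed.

Lemma interaction_lip z y z' y' : `|interaction z y - interaction z' y'| <=
  Cb * (`|z - z'| * wt y ^+ 2 + `|y - y'| * (wt y + wt y') * wt z').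
Proof.
set A := `|z - z'|; set B := `|y - y'|.
set X := _ * _ ^+ 2; set Y := _ * _ * _.
have A0 : 0 <= A by exact: normr_ge0.
have B0 : 0 <= B by exact: normr_ge0.
have y0 := wt_ge0 y; have y1 := wt_ge1 y; have y'0 := wt_ge0 y'.
have z'0 := wt_ge0 z'; have z'1 := wt_ge1 z'.
have AX : A <= X by rewrite ler_peMr// expr_ge1.
have BY : B <= Y.
  rewrite /Y -mulrA ler_peMr// -[leLHS]mulr1 ler_pM//.
  by rewrite (le_trans y1)// lerDl.
have Y1 : B * wt z' * wt y <= Y.
  by rewrite /Y [leRHS]mulrAC ler_wpM2l ?mulr_ge0// lerDl.
have Y2 : B * wt z' * wt y' <= Y.
  by rewrite /Y [leRHS]mulrAC ler_wpM2l ?mulr_ge0// lerDr.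
(* The product is differenced so that the kernel increment meets [grad V y] and the gradient
   increment meets [k z' y'], which produces exactly the weights of [X] and [Y]. *)
have -> : interaction z y - interaction z' y' =
    - (k z y - k z' y') *: grad V y - k z' y' *: (grad V y - grad V y')
    + ((z - z') - (dm (z - y) - dm (z' - y'))).
  rewrite /interaction -/(k z y) -/(k z' y') scalerBr !scaleNr scalerBl.
  apply/rowP => i; rewrite !mxE; ring.
have h1 : `|- (k z y - k z' y') *: grad V y| <= (d%:R + C0) * LV * (X + Y).
  rewrite normrZ normrN (le_trans (ler_pM _ _ (kernel_lip z y z' y') (gradV_growth y)))//.
  rewrite -/A -/B [leLHS](_ : _ = (d%:R + C0) * LV * (X + B * wt z' * wt y)).
    by rewrite ler_wpM2l ?lerD2l// mulr_ge0// addr_ge0.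
  by rewrite /X; ring.
have h2 : `|k z' y' *: (grad V y - grad V y')| <= (1 + d%:R + C0) * LV * Y.
  rewrite normrZ (le_trans (ler_pM _ _ (kernel_bound z' y') (gradV_lip y y')))//.
  rewrite -/B [leLHS](_ : _ = (1 + d%:R + C0) * LV * (B * wt z' * wt y')); last by ring.
  by rewrite ler_wpM2l// mulr_ge0// !addr_ge0.
have h3 : `|dm (z - y) - dm (z' - y')| <= C0 * (X + Y).
  rewrite (le_trans (dm_lip _ _))// ler_wpM2l//.
  have -> : z - y - (z' - y') = (z - z') - (y - y').
    by rewrite !opprD !opprK addrACA.
  by rewrite (le_trans (ler_normB _ _))// lerD.
have X0 : 0 <= X by exact: le_trans AX.
have Y0 : 0 <= Y by exact: le_trans BY.
have p1 : 0 <= (1 + d%:R + C0) * LV * X by rewrite !mulr_ge0// !addr_ge0.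
have p2 : 0 <= C0 * (X + Y) by rewrite mulr_ge0// addr_ge0.
rewrite (le_trans (ler_normD _ _))//.
have q1 := ler_normB (- (k z y - k z' y') *: grad V y) (k z' y' *: (grad V y - grad V y')).
have q2 := ler_normB (z - z') (dm (z - y) - dm (z' - y')).
have -> : Cb * (X + Y) = (d%:R + C0) * LV * (X + Y) +
  ((1 + d%:R + C0) * LV * X + (1 + d%:R + C0) * LV * Y) +
  (X + Y) + 2 * (C0 * (X + Y)) by rewrite /Cb; ring.
rewrite -/A in q2; lra.
Qed.

End interaction.

(** * Positive definiteness of the Matern kernel *)

Section positive_definite.
Context {R : realType} {A : Type}.

(** Quadratic form of a finite signed combination of Dirac masses; as points may repeat, no
    distinctness has to be tracked. *)
Definition qform (K : A -> A -> R) (s : seq (R * A)) : R :=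
  \sum_(p <- s) \sum_(q <- s) p.1 * q.1 * K p.2 q.2.

Definition psd (K : A -> A -> R) := forall s, 0 <= qform K s.

Lemma qform_cons K a x s : (forall x y, K x y = K y x) ->
  qform K ((a, x) :: s) =
  a ^+ 2 * K x x + 2 * a * (\sum_(q <- s) q.1 * K x q.2) + qform K s.
Proof.
move=> Ks; rewrite /qform big_cons big_cons/=.
under [X in _ + X]eq_bigr do rewrite big_cons/=.
rewrite big_split/=.
have -> : \sum_(q <- s) a * q.1 * K x q.2 = a * \sum_(q <- s) q.1 * K x q.2.
  by rewrite mulr_sumr; apply: eq_bigr => q _; rewrite mulrA.
have -> : \sum_(q <- s) q.1 * a * K q.2 x = a * \sum_(q <- s) q.1 * K x q.2.
  by rewrite mulr_sumr; apply: eq_bigr => q _; rewrite Ks; ring.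
by ring.
Qed.

Lemma cvg_seq_sum (I : Type) (r : seq I) (u : I -> nat -> R) (l : I -> R) :
  (forall i, u i n @[n --> \oo] --> l i) ->
  \sum_(i <- r) u i n @[n --> \oo] --> \sum_(i <- r) l i.
Proof.
move=> ul; elim: r => [|i r IH].
  by under eq_fun do rewrite big_nil; rewrite big_nil; exact: cvg_cst.
under eq_fun do rewrite big_cons; rewrite big_cons.
by apply: cvgD => //; exact: ul.
Qed.

End positive_definite.

Section gaussian_psd.
Context {R : realType} {d : nat}.
Notation T := 'rV[R]_d.

(** Schur product by hand: one more factor <u, w> = sum_l u_l w_l splits the form into d forms, the
    weights being multiplied by the l-th coordinates. *)
Lemma psd_dotv_exp n : psd (fun u w : T => dotv u w ^+ n).
Proof.
elim: n => [|n IH] s.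
  have -> : qform (fun u w : T => dotv u w ^+ 0) s = (\sum_(p <- s) p.1) ^+ 2.
    rewrite expr2 mulr_suml; apply: eq_bigr => p _.
    by rewrite mulr_sumr; apply: eq_bigr => q _; rewrite expr0 mulr1.
  exact: sqr_ge0.
have -> : qform (fun u w : T => dotv u w ^+ n.+1) s = \sum_(l < d)
    qform (fun u w : T => dotv u w ^+ n) [seq (p.1 * (p.2 : T) 0 l, p.2 : T) | p : R * T <- s].
  rewrite /qform; under [RHS]eq_bigr do rewrite big_map.
  rewrite [RHS]exchange_big/=; apply: eq_bigr => p _.
  under [RHS]eq_bigr do rewrite big_map.
  rewrite [RHS]exchange_big/=; apply: eq_bigr => q _.
  rewrite exprS {1}/dotv mulrA mulr_sumr mulr_suml.
  by apply: eq_bigr => l _ /=; ring.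
by apply: sumr_ge0 => l _; exact: IH.
Qed.

(** Limit of the partial sums of the exponential series, whose coefficients are nonnegative. *)
Lemma psd_exp_dotv (c : R) : 0 <= c -> psd (fun u w : T => expR (c * dotv u w)).
Proof.
move=> c0 s.
have cv : \sum_(p <- s) \sum_(q <- s)
    p.1 * q.1 * series (exp_coeff (c * dotv p.2 q.2)) n @[n --> \oo] -->
    qform (fun u w : T => expR (c * dotv u w)) s.
  apply: cvg_seq_sum => p; apply: cvg_seq_sum => q.
  by apply: cvgMr; exact: is_cvg_series_exp_coeff.
apply: (cvgr_to_ge cv); apply: nearW => n.
have -> : \sum_(p <- s) \sum_(q <- s)
    p.1 * q.1 * series (exp_coeff (c * dotv p.2 q.2)) n =
  \sum_(0 <= k < n) c ^+ k / k`!%:R * qform (fun u w : T => dotv u w ^+ k) s.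
  under eq_bigr => p _ do under eq_bigr => q _ do rewrite /series/= mulr_sumr.
  under eq_bigr => p _ do rewrite exchange_big/=.
  rewrite exchange_big/=; apply: eq_bigr => k _.
  rewrite /qform mulr_sumr; apply: eq_bigr => p _.
  rewrite mulr_sumr; apply: eq_bigr => q _.
  by rewrite /exp_coeff /= exprMn; ring.
apply: sumr_ge0 => k _; apply: mulr_ge0; last exact: psd_dotv_exp.
by rewrite divr_ge0// exprn_ge0.
Qed.

(** Up to factors depending on u alone or on w alone, which go into the weights, the Gaussian of u -
    w is exp(2 c <u, w>). *)
Lemma psd_gaussian (c : R) : 0 <= c -> psd (fun u w : T => gaussian c (u - w)).
Proof.
move=> c0 s.
have -> : qform (fun u w : T => gaussian c (u - w)) s =
    qform (fun u w : T => expR (2 * c * dotv u w))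
      [seq (p.1 * gaussian c p.2, p.2) | p <- s].
  rewrite /qform big_map; apply: eq_bigr => p _.
  rewrite big_map; apply: eq_bigr => q _ /=.
  have -> : gaussian c (p.2 - q.2) =
    gaussian c p.2 * gaussian c q.2 * expR (2 * c * dotv p.2 q.2).
    rewrite /gaussian -!expRD dotvBl !dotvBr (dotvC q.2 p.2); congr expR; ring.
  by ring.
by apply: psd_exp_dotv; rewrite mulr_ge0.
Qed.

(** A mixture of Gaussian kernels with nonnegative weight; [Sigma] merely moves the points. *)
Lemma psd_matern (nu : R) (Sigma : 'M[R]_d) : 3 / 2 < nu ->
  psd (fun z y : T => matern nu Sigma (z - y)).
Proof.
move=> hnu s; pose D := (`]0, +oo[%classic : set R).
have gi (u : T) : (@lebesgue_measure R).-integrable D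
    (EFin \o (fun t => gamma_weight (nu - 1) t * gaussian (scl t) u)).
  exact: (mix_integrable nu hnu _ 1 0 (measurable_gaussian_scl u) (gaussian_scl_bound u)).
have mD : measurable D by exact: measurable_itv.
pose kap := 2 `^ (1 - (d%:R / 2 + nu)) / Gamma (d%:R / 2 + nu) * (2^-1 * 2 `^ nu).
have -> : qform (fun z y : T => matern nu Sigma (z - y)) s =
    kap * \int[lebesgue_measure]_(t in D) (\sum_(p <- s) \sum_(q <- s)
      p.1 * q.1 * (gamma_weight (nu - 1) t * gaussian (scl t) ((p.2 - q.2) *m Sigma^T))).
  rewrite (Rintegral_sumr_in lebesgue_measure) => [|//|p]; last first.
    by apply: (integrable_sumr_in lebesgue_measure) => // q;
      apply: (integrable_scale_in lebesgue_measure).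
  rewrite /qform mulr_sumr; apply: eq_bigr => p _.
  rewrite (Rintegral_sumr_in lebesgue_measure) => [|//|q]; last first.
    exact: (integrable_scale_in lebesgue_measure).
  rewrite mulr_sumr; apply: eq_bigr => q _.
  by rewrite RintegralZl// maternE// /gmix /mix /kap; ring.
apply: mulr_ge0.
  rewrite mulr_ge0 ?mulr_ge0 ?powR_ge0 ?invr_ge0//.
  by apply: Rintegral_ge0 => t _; rewrite mulr_ge0 ?powR_ge0 ?expR_ge0.
apply: Rintegral_ge0 => t Dt.
have -> : \sum_(p <- s) \sum_(q <- s)
      p.1 * q.1 * (gamma_weight (nu - 1) t * gaussian (scl t) ((p.2 - q.2) *m Sigma^T)) =
    gamma_weight (nu - 1) t * qform (fun u w : T => gaussian (scl t) (u - w))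
      [seq (p.1, p.2 *m Sigma^T) | p <- s].
  rewrite /qform big_map mulr_sumr; apply: eq_bigr => p _.
  rewrite big_map mulr_sumr; apply: eq_bigr => q _ /=.
  by rewrite mulmxBl; ring.
apply: mulr_ge0; first exact: gamma_weight_ge0.
by apply: psd_gaussian; apply/ltW/scl_gt0.
Qed.

End gaussian_psd.

(** * Positive definiteness from finite combinations to integrals *)

Section integral_psd.
Context {dis : measure_display} {Om : measurableType dis} {R : realType}.
Variable mu : probability Om R.
Variables (K : Om -> Om -> R) (f : Om -> R).
Hypothesis Ksym : forall x y, K x y = K y x.
Hypothesis Kpsd : psd K.
Let U x := \int[mu]_y (K x y * f y).
Hypothesis iK : forall x, mu.-integrable setT (EFin \o (fun y => K x y * f y)).
Hypothesis iU : mu.-integrable setT (EFin \o (fun x => U x * f x)).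
Hypothesis iD : mu.-integrable setT (EFin \o (fun x => f x ^+ 2 * K x x)).

Let q := \int[mu]_x (U x * f x).
Let D := \int[mu]_x (f x ^+ 2 * K x x).

(* Each step replaces a Dirac mass [s f(x) delta_x] by its [mu]-average: the
   quadratic form is averaged too, up to the diagonal correction [s^2 (D - q)]. *)
Lemma qform_average N (s : R) (sg : seq (R * Om)) :
  0 <= qform K sg + 2 * N%:R * s * (\sum_(p <- sg) p.1 * U p.2) +
    N%:R ^+ 2 * s ^+ 2 * q + N%:R * s ^+ 2 * (D - q).
Proof.
elim: N sg => [|N IH] sg.
  by rewrite expr0n/= !mulr0 !mul0r !addr0; exact: Kpsd.
pose c := qform K sg + 2 * N%:R * s * (\sum_(p <- sg) p.1 * U p.2) +
    N%:R ^+ 2 * s ^+ 2 * q + N%:R * s ^+ 2 * (D - q).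
pose g x := s ^+ 2 * (f x ^+ 2 * K x x) +
   (2 * s * (\sum_(p <- sg) p.1 * (K p.2 x * f x)) +
    (2 * N%:R * s ^+ 2 * (U x * f x) + c)).
have g0 x : 0 <= g x.
  have := IH ((s * f x, x) :: sg); rewrite qform_cons// big_cons/=.
  have E : \sum_(p <- sg) p.1 * (K p.2 x * f x) = (\sum_(p <- sg) p.1 * K x p.2) * f x.
    by rewrite mulr_suml; apply: eq_bigr => p _; rewrite Ksym mulrA.
  by rewrite [X in 0 <= X -> _](_ : _ = g x)// /g E /c; ring.
have i1 : mu.-integrable setT (EFin \o (fun x => \sum_(p <- sg) p.1 * (K p.2 x * f x))).
  by apply: integrable_sumr => p; exact: integrable_scale.
have ic : mu.-integrable setT (EFin \o (fun _ : Om => c)).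
  exact: finite_measure_integrable_cst.
have i2 : mu.-integrable setT (EFin \o (fun x => 2 * N%:R * s ^+ 2 * (U x * f x) + c)).
  by apply: integrable_add => //; exact: integrable_scale.
have i3 : mu.-integrable setT (EFin \o (fun x =>
    2 * s * (\sum_(p <- sg) p.1 * (K p.2 x * f x)) +
    (2 * N%:R * s ^+ 2 * (U x * f x) + c))).
  by apply: integrable_add => //; exact: integrable_scale.
have : 0 <= \int[mu]_x g x by apply: Rintegral_ge0 => x _.
have cE : \int[mu]_x c = c.
  by rewrite Rintegral_cst//; have /= -> := probability_setT mu; rewrite mulr1.
rewrite /g RintegralD//; last exact: integrable_scale.
rewrite RintegralD//; last exact: integrable_scale.
rewrite RintegralD//; last exact: integrable_scale.
rewrite !RintegralZl// cE Rintegral_sumr; last by move=> p; exact: integrable_scale.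
under eq_bigr do rewrite RintegralZl//.
rewrite -/D -/q; under eq_bigr do rewrite -/(U _).
set W := \sum_(p <- sg) _.
by rewrite [X in 0 <= X -> _](_ : _ = qform K sg + 2 * N.+1%:R * s * W +
  N.+1%:R ^+ 2 * s ^+ 2 * q + N.+1%:R * s ^+ 2 * (D - q))// /c -/W -natr1; ring.
Qed.

(** With no initial mass and N masses of scale 1/N, [qform_average] reads 0 <= q + (D - q) / N; a
    negative q is refuted by a large N. *)
Lemma integral_psd : 0 <= q.
Proof.
rewrite leNgt; apply/negP => q0.
have [n nq] : exists n, (D - q) / - q < n.+1%:R.
  by exists (Num.truncn ((D - q) / - q)); exact: truncnS_gt.
have := qform_average n.+1 n.+1%:R^-1 [::].
rewrite /qform !big_nil mulr0 !add0r exprVn mulfV ?expf_neq0//.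
rewrite mul1r expr2 invfM mulrA mulfV// mul1r.
rewrite ltr_pdivrMr ?oppr_gt0// in nq.
have n0 : 0 < n.+1%:R :> R by [].
rewrite -(ler_pM2l n0) mulr0 mulrDr mulrA mulfV// mul1r.
lra.
Qed.

End integral_psd.

(** * Dissipation of the energy *)

Section dissipation.
Context {R : realType} {d : nat}.
Notation T := 'rV[R]_d.
Implicit Types x y z : T.
Variables (m : T -> R) (dm : T -> T) (C0 : R) (V : T -> R) (LV : R).
Hypothesis C00 : 0 <= C0.
Hypothesis m_bound : forall z, `|m z| <= C0.
Hypothesis m_lip : forall z z', `|m z - m z'| <= C0 * `|z - z'|.
Hypothesis dm_lip : forall z z', `|dm z - dm z'| <= C0 * `|z - z'|.
Hypothesis dm0 : dm 0 = 0.
Hypothesis m_sym : forall z, m (- z) = m z.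
Hypothesis m_psd : psd (fun z y : T => m (z - y)).
Hypothesis LV0 : 0 <= LV.
Hypothesis Vtame : tame V.
Hypothesis gradV_growth : forall x, `|grad V x| <= LV * wt x.
Variables (a C3 : R).
Hypothesis a0 : 0 < a.
Hypothesis confining : forall x, a * `|x| ^+ 2 - C3 <= dotv x (grad V x).

Variable mu : probability T R.
Hypothesis mu2 : mu.-integrable setT (EFin \o (fun x : T => wt x ^+ 2)).
Variables (A : R) (X : T -> T).
Hypothesis aX : adm A X.

Let g i x := grad V (X x) 0 i.
Let w x := wt (X x).
Let W2 := m2 mu X.

Let cX : continuous X. Proof. by case: aX. Qed.

Let cg i : continuous (g i).
Proof.
apply: continuous_coord; apply: continuous_comp_fun => //.
by case: Vtame.
Qed.

Let g_le i x : `|g i x| <= LV * w x.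
Proof. by rewrite (le_trans (coord_norm_le _ _)). Qed.

Let w_sqr x : w x <= w x ^+ 2. Proof. exact: wt_le_sqr. Qed.

Let w0 x : 0 <= w x. Proof. exact: wt_ge0. Qed.

Let integrable_w2 (f : T -> R) K : continuous f ->
  (forall x, `|f x| <= K * w x ^+ 2) -> mu.-integrable setT (EFin \o f).
Proof.
move=> cf fK; apply: (integrable_dom mu f (fun x => K * w x ^+ 2)) => //.
  exact: continuous_measurable_rV.
by apply: integrable_scale; exact: integrable_wt2X aX.
Qed.

Let ig i : mu.-integrable setT (EFin \o g i).
Proof.
apply: (integrable_w2 _ LV) => // x; rewrite (le_trans (g_le i x))//.
by rewrite ler_wpM2l.
Qed.

Let iXg j i : mu.-integrable setT (EFin \o (fun x => X x 0 j * g i x)).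
Proof.
apply: (integrable_w2 _ LV).
  by apply: continuous_mul => //; exact: continuous_coord.
move=> x; rewrite normrM mulrC (_ : _ * w x ^+ 2 = (LV * w x) * w x); last by ring.
apply: ler_pM => //; rewrite (le_trans (coord_norm_le _ _))//; exact: norm_le_wt.
Qed.

Let Uz i z := \int[mu]_y (m (z - X y) * g i y).
Let Dz i z := \int[mu]_y (dm (z - X y) 0 i).

Let cm z : continuous (fun y => m (z - X y)).
Proof.
apply: (continuous_comp_fun m); last exact: lip_continuous m_lip.
by apply: continuous_sub; [exact: continuous_const|exact: cX].
Qed.

Let cdm z : continuous (fun y => dm (z - X y)).
Proof.
apply: (continuous_comp_fun dm); last exact: lip_continuous dm_lip.
by apply: continuous_sub; [exact: continuous_const|exact: cX].
Qed.

Let img i z : mu.-integrable setT (EFin \o (fun y => m (z - X y) * g i y)).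
Proof.
apply: (integrable_w2 _ (C0 * LV)); first exact: continuous_mul.
move=> y; rewrite normrM -mulrA ler_pM// (le_trans (g_le i y))//.
by rewrite ler_wpM2l.
Qed.

Let dm_le z : `|dm z| <= C0 * `|z|.
Proof. by have := dm_lip z 0; rewrite dm0 !subr0. Qed.

Let idm i z : mu.-integrable setT (EFin \o (fun y => dm (z - X y) 0 i)).
Proof.
apply: (integrable_w2 _ (C0 * (`|z| + 1))); first exact: continuous_coord.
move=> y; rewrite (le_trans (coord_norm_le _ _))// (le_trans (dm_le _))//.
rewrite -mulrA ler_wpM2l// (le_trans (ler_normB _ _))// mulrDl mul1r lerD//.
  by rewrite ler_peMr// expr_ge1 ?wt_ge0 ?wt_ge1.
by rewrite (le_trans (norm_le_wt _))//; exact: w_sqr.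
Qed.

Let M j i := \int[mu]_y (X y 0 j * g i y).
Let G i := \int[mu]_y g i y.

(** The velocity sorted by its sources: [G] from the constant part of the kernel, [M] from the
    bilinear part, [Uz] from the Matern part; [z] and [Dz] come from the kernel gradient. *)
Lemma vel_coord z i : vel mu (interaction m dm V) X z 0 i =
  - G i + (\sum_j - z 0 j * M j i + (- Uz i z + (z 0 i - Dz i z))).
Proof.
rewrite mxE.
pose h y := -1 * g i y + (\sum_j - z 0 j * (X y 0 j * g i y) +
  (-1 * (m (z - X y) * g i y) + (z 0 i + -1 * dm (z - X y) 0 i))).
have -> : \int[mu]_y interaction m dm V z (X y) 0 i = \int[mu]_y h y.
  apply: eq_Rintegral => y _; rewrite /interaction.
  have E (u v : T) c : (- c *: u + v) 0 i = - c * u 0 i + v 0 i by rewrite !mxE.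
  rewrite E rV_subE -/(g i y) /h /dotv.
  have -> : \sum_j - z 0 j * (X y 0 j * g i y) = - (\sum_j z 0 j * X y 0 j) * g i y.
    by rewrite mulNr mulr_suml -sumrN; apply: eq_bigr => j _; ring.
  move: (m _) (dm _ 0 i) (\sum_j _) => ? ? ?; ring.
have j1 : mu.-integrable setT (EFin \o (fun y => -1 * dm (z - X y) 0 i)).
  exact: integrable_scale.
have j2 : mu.-integrable setT (EFin \o (fun y => z 0 i + -1 * dm (z - X y) 0 i)).
  by apply: integrable_add => //; exact: integrable_prob_cst.
have j3 : mu.-integrable setT (EFin \o (fun y => -1 * (m (z - X y) * g i y))).
  exact: integrable_scale.
have j4 j : mu.-integrable setT (EFin \o (fun y => - z 0 j * (X y 0 j * g i y))).
  exact: integrable_scale.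
rewrite /h RintegralD//; last 2 first.
- exact: integrable_scale.
- by apply: integrable_add; [exact: integrable_sumr|exact: integrable_add].
rewrite RintegralD//; last 2 first.
- exact: integrable_sumr.
- exact: integrable_add.
rewrite RintegralD// RintegralD//; last exact: integrable_prob_cst.
rewrite Rintegral_prob_cst !RintegralZl// Rintegral_sumr//.
under eq_bigr do rewrite RintegralZl//.
by rewrite -/(G i) -/(Uz i z) -/(Dz i z) !mulN1r.
Qed.

Let Dz_lip i z z' : `|Dz i z - Dz i z'| <= C0 * `|z - z'|.
Proof.
rewrite /Dz -RintegralB//.
rewrite -[leRHS](Rintegral_prob_cst mu); apply: Rintegral_abs_le.
- apply: continuous_measurable_rV; apply: continuous_sub; exact: continuous_coord.
- exact: integrable_prob_cst.
- move=> y; rewrite -rV_subE (le_trans (coord_norm_le _ _))//.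
  by rewrite (le_trans (dm_lip _ _))// opprB addrA subrK.
Qed.

Let Uz_lip i z z' : `|Uz i z - Uz i z'| <= C0 * (LV * W2) * `|z - z'|.
Proof.
rewrite /Uz -RintegralB//.
have -> : C0 * (LV * W2) * `|z - z'| = \int[mu]_y (C0 * LV * `|z - z'| * w y ^+ 2).
  by rewrite RintegralZl//; [rewrite /W2 /m2 -/(w _); ring|exact: integrable_wt2X aX].
apply: Rintegral_abs_le.
- by apply: continuous_measurable_rV; apply: continuous_sub; exact: continuous_mul.
- by apply: integrable_scale; exact: integrable_wt2X aX.
- move=> y; rewrite -mulrBl normrM.
  rewrite (_ : _ * w y ^+ 2 = (C0 * `|z - z'|) * (LV * w y ^+ 2)); last by ring.
  apply: ler_pM => //.
    by rewrite (le_trans (m_lip _ _))// opprB addrA subrK.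
  by rewrite (le_trans (g_le i y))// ler_wpM2l.
Qed.

Let iUg i : mu.-integrable setT (EFin \o (fun x => Uz i (X x) * g i x)).
Proof.
apply: (integrable_w2 _ (C0 * (LV * W2) * LV)).
  apply: continuous_mul => //; apply: continuous_comp_fun cX _.
  exact: lip_continuous (Uz_lip i).
move=> x; rewrite normrM -mulrA ler_pM//.
  have -> : C0 * (LV * W2) = \int[mu]_y (C0 * LV * w y ^+ 2).
    by rewrite RintegralZl//; [rewrite /W2 /m2 -/(w _); ring|exact: integrable_wt2X aX].
  apply: Rintegral_abs_le.
  - by apply: continuous_measurable_rV; exact: continuous_mul.
  - by apply: integrable_scale; exact: integrable_wt2X aX.
  - move=> y; rewrite normrM -mulrA ler_pM// (le_trans (g_le i y))//.
    by rewrite ler_wpM2l.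
by rewrite (le_trans (g_le i x))// ler_wpM2l.
Qed.

Let Dg_pt i x y : `|g i x * dm (X x - X y) 0 i| <=
  LV * C0 * (2 * w x ^+ 2 + w y ^+ 2).
Proof.
rewrite normrM (_ : _ * _ * _ = LV * (C0 * (2 * w x ^+ 2 + w y ^+ 2))); last by ring.
rewrite (@le_trans _ _ ((LV * w x) * (C0 * (w x + w y))))//.
  apply: ler_pM => //; rewrite (le_trans (coord_norm_le _ _))//.
  rewrite (le_trans (dm_le _))// ler_wpM2l// (le_trans (ler_normB _ _))//.
  by rewrite lerD ?norm_le_wt.
rewrite (_ : _ * _ = LV * (C0 * (w x * (w x + w y)))); last by ring.
rewrite ler_wpM2l// ler_wpM2l//.
have := sqr_ge0 (w x - w y); have := sqr_ge0 (w x); have := sqr_ge0 (w y).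
by move: (w x) (w y) => p r; lra.
Qed.

Let Dg_le i x : `|g i x * Dz i (X x)| <= LV * C0 * (2 * w x ^+ 2 + W2).
Proof.
rewrite -RintegralZl//.
have -> : LV * C0 * (2 * w x ^+ 2 + W2) =
    \int[mu]_y (LV * C0 * (2 * w x ^+ 2 + w y ^+ 2)).
  rewrite RintegralZl// ?RintegralD// ?Rintegral_prob_cst//.
  - exact: integrable_prob_cst.
  - exact: integrable_wt2X aX.
  - by apply: integrable_add; [exact: integrable_prob_cst|exact: integrable_wt2X aX].
apply: Rintegral_abs_le => //.
- apply: continuous_measurable_rV; apply: continuous_mul.
    exact: continuous_const.
  exact: continuous_coord.
- apply: integrable_scale; apply: integrable_add; first exact: integrable_prob_cst.
  exact: integrable_wt2X aX.
Qed.

Let cDg i : continuous (fun x => g i x * Dz i (X x)).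
Proof.
apply: continuous_mul => //; apply: continuous_comp_fun cX _.
exact: lip_continuous (Dz_lip i).
Qed.

Let iDom : mu.-integrable setT (EFin \o (fun x => LV * C0 * (2 * w x ^+ 2 + W2))).
Proof.
apply: integrable_scale; apply: integrable_add; last exact: integrable_prob_cst.
by apply: integrable_scale; exact: integrable_wt2X aX.
Qed.

Let iDg i : mu.-integrable setT (EFin \o (fun x => g i x * Dz i (X x))).
Proof.
by apply: integrable_dom iDom (Dg_le i) => //; exact: continuous_measurable_rV.
Qed.

(** The Matern gradient term has no sign; it costs a multiple of the second moment, the 3 being the
    2 + 1 of [Dg_pt]. *)
Let intDg i : `|\int[mu]_x (g i x * Dz i (X x))| <= 3 * (LV * C0) * W2.
Proof.
have -> : 3 * (LV * C0) * W2 = \int[mu]_x (LV * C0 * (2 * w x ^+ 2 + W2)).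
  rewrite RintegralZl// ?RintegralD// ?Rintegral_prob_cst ?RintegralZl//.
  - by have -> : (\int[mu]_x w x ^+ 2)%R = W2 by []; ring.
  - exact: integrable_wt2X aX.
  - by apply: integrable_scale; exact: integrable_wt2X aX.
  - exact: integrable_prob_cst.
  - by apply: integrable_add; [apply: integrable_scale; exact: integrable_wt2X aX
      |exact: integrable_prob_cst].
by apply: Rintegral_abs_le => //; exact: continuous_measurable_rV.
Qed.

(** Tested against [g i], each part of the kernel becomes a quadratic form: - G_i^2, minus the sum
    over j of M_ji^2, and minus the Matern form. All these nonpositive terms are dropped except -
    M_ii^2. *)
Let coord_dissipation i :
  let h x := g i x * vel mu (interaction m dm V) X (X x) 0 i in
  mu.-integrable setT (EFin \o h) /\
  \int[mu]_x h x <= - (M i i) ^+ 2 + M i i + 3 * (LV * C0) * W2.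
Proof.
pose h' x := - G i * g i x + (\sum_j - M j i * (X x 0 j * g i x) +
  (-1 * (Uz i (X x) * g i x) + (X x 0 i * g i x + -1 * (g i x * Dz i (X x))))).
move=> h; have -> : h = h'.
  apply/funext => x; rewrite /h vel_coord /h'.
  have -> : \sum_j - M j i * (X x 0 j * g i x) = (\sum_j - X x 0 j * M j i) * g i x.
    by rewrite mulr_suml; apply: eq_bigr => j _; ring.
  by move: (Uz _ _) (Dz _ _) (G i) (\sum_j _) (g i x) => ? ? ? ? ?; ring.
have j1 : mu.-integrable setT (EFin \o (fun x => -1 * (g i x * Dz i (X x)))).
  exact: integrable_scale.
have j2 : mu.-integrable setT (EFin \o (fun x =>
  X x 0 i * g i x + -1 * (g i x * Dz i (X x)))) by exact: integrable_add.
have j3 : mu.-integrable setT (EFin \o (fun x => -1 * (Uz i (X x) * g i x))).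
  exact: integrable_scale.
have j4 j : mu.-integrable setT (EFin \o (fun x => - M j i * (X x 0 j * g i x))).
  exact: integrable_scale.
have j5 : mu.-integrable setT (EFin \o (fun x => - G i * g i x)).
  exact: integrable_scale.
have j6 := integrable_add _ _ _ j3 j2.
have j7 := integrable_add _ _ _ (integrable_sumr mu _ (index_enum 'I_d) _ j4) j6.
split; first exact: integrable_add.
rewrite /h' RintegralD// RintegralD//; last exact: integrable_sumr.
rewrite RintegralD// RintegralD// !RintegralZl// Rintegral_sumr//.
under eq_bigr do rewrite RintegralZl// -/(M _ _).
(* Positive definiteness in integral form, for the Matern kernel pulled back by [X]. *)
have q0 : 0 <= \int[mu]_x (Uz i (X x) * g i x).
  apply: (integral_psd mu (fun x y => m (X x - X y)) (g i)) => //.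
  - by move=> x y; rewrite -m_sym opprB.
  - move=> s; have := m_psd [seq (p.1, X p.2) | p <- s].
    rewrite /qform big_map; congr (_ <= _); apply: eq_bigr => p _.
    by rewrite big_map.
  - exact: iUg.
  - apply: (integrable_w2 _ (LV ^+ 2 * C0)) => [|x].
      have c1 : continuous (fun x => m (X x - X x)).
        apply: (continuous_comp_fun m); last exact: lip_continuous m_lip.
        exact: continuous_sub.
      have c2 : continuous (fun x => g i x ^+ 2 : R).
        by apply: (continuous_comp_fun (fun u : R => u ^+ 2 : R)) => //; exact: exprn_continuous.
      exact: (continuous_mul _ _ c2 c1).
    rewrite normrM normrX [leRHS]mulrAC; apply: ler_pM => //.
    by rewrite -exprMn lerXn2r ?nnegrE// mulr_ge0.
have MM : M i i ^+ 2 <= \sum_j M j i * M j i.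
  rewrite (bigD1 i)//= -expr2 lerDl sumr_ge0// => j _.
  by rewrite -expr2 sqr_ge0.
have -> : \sum_j - M j i * M j i = - \sum_j M j i * M j i.
  by rewrite -sumrN; apply: eq_bigr => j _; rewrite mulNr.
have := intDg i; rewrite ler_norml => /andP[d1 d2].
have G2 := sqr_ge0 (G i); rewrite expr2 in G2.
rewrite -/(G i) -/(M i i).
move: q0 MM d1 d2 G2; lra.
Qed.

(** Completing the square gives - M^2 + M <= ((kap + 1) / 2)^2 - kap M for every real M, so the
    quadratic dissipation yields a linear one of any slope. The sum of the M_ii is the integral of
    <X, grad V(X)>, where confinement enters. The error in [LV * C0] does not involve [kap], so it
    is beaten by a large [kap]. *)
Lemma dissipation_bound (kap : R) : 0 <= kap ->
  \int[mu]_x dotv (grad V (X x)) (vel mu (interaction m dm V) X (X x)) <=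
  (kap * C3 + d%:R * ((kap + 1) / 2) ^+ 2 + 6 * (d%:R * (LV * C0))) -
  (kap * a - 6 * (d%:R * (LV * C0))) * \int[mu]_x (`|X x| ^+ 2).
Proof.
move=> kap0.
have hi i := (coord_dissipation i).1; have hc i := (coord_dissipation i).2.
rewrite Rintegral_sumr//.
have S2 : mu.-integrable setT (EFin \o (fun x => `|X x| ^+ 2)).
  exact: integrable_norm_sqr aX.
have step : \sum_i \int[mu]_x (g i x * vel mu (interaction m dm V) X (X x) 0 i) <=
    \sum_(i < d) (((kap + 1) / 2) ^+ 2 - kap * M i i + 3 * (LV * C0) * W2).
  apply: ler_sum => i _; rewrite (le_trans (hc i))//.
  by have := sqr_ge0 (M i i - (kap + 1) / 2); rewrite sqrrB; lra.
rewrite (le_trans step)//.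
have Msum : a * \int[mu]_x (`|X x| ^+ 2) - C3 <= \sum_i M i i.
  rewrite -Rintegral_sumr//.
  have -> : a * \int[mu]_x (`|X x| ^+ 2) - C3 = \int[mu]_x (a * `|X x| ^+ 2 - C3).
    rewrite RintegralB// ?RintegralZl// ?Rintegral_prob_cst//.
    - exact: integrable_scale.
    - exact: integrable_prob_cst.
  apply: Rintegral_le.
  - apply: integrable_add; first exact: integrable_scale.
    exact: integrable_prob_cst.
  - exact: integrable_sumr.
  - by move=> x; exact: confining.
have W2le : W2 <= 2 + 2 * \int[mu]_x (`|X x| ^+ 2).
  have -> : 2 + 2 * \int[mu]_x (`|X x| ^+ 2) = \int[mu]_x (2 + 2 * `|X x| ^+ 2).
    rewrite RintegralD// ?RintegralZl// ?Rintegral_prob_cst//.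
    - exact: integrable_prob_cst.
    - exact: integrable_scale.
  apply: Rintegral_le.
  - exact: integrable_wt2X aX.
  - by apply: integrable_add; [exact: integrable_prob_cst|exact: integrable_scale].
  - by move=> x; rewrite /wt; have := sqr_ge0 (`|X x| - 1); lra.
set I2 := \int[mu]_x _ in Msum W2le *; set Q := 3 * _ * W2; set P := _ ^+ 2.
rewrite big_split/= big_split/= sumrN !sumr_const card_ord.
rewrite -[P *+ d]mulr_natl -[Q *+ d]mulr_natl -mulr_sumr.
have h1 := ler_wpM2l kap0 Msum.
have h2 : d%:R * Q <= d%:R * (3 * (LV * C0) * (2 + 2 * I2)).
  by rewrite ler_wpM2l// ler_wpM2l// !mulr_ge0.
by move: h1 h2; move: (\sum_i _) => S1; lra.
Qed.

End dissipation.

(** * Consequences of the assumptions on the potential *)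

Section potential.
Context {R : realType} {d : nat}.
Notation T := 'rV[R]_d.
Implicit Types x y z : T.

Lemma enorm_basis i : enorm (basis_vec i : T) = 1.
Proof. by rewrite /enorm dotv_basis mxE !eqxx sqrtr1. Qed.

Lemma coord_opnorm (A : 'M[R]_d) i j : `|A i j| <= opnorm A.
Proof.
have E : (basis_vec j *m A^T) 0 i = A i j.
  rewrite mxE (bigD1 j)//= big1 ?addr0 => [|k kj]; rewrite !mxE.
    by rewrite !eqxx mul1r.
  by rewrite (negPf kj) andbF mul0r.
apply: (@le_trans _ _ (enorm (basis_vec j *m A^T))).
  by rewrite -E coord_enorm_le.
apply: ub_le_sup; last by exists (basis_vec j) => //=; rewrite enorm_basis.
exists (d%:R * (d%:R * `|A|)) => _ [h /= h1 <-].
rewrite (le_trans (enorm_le _))// ler_wpM2l// (le_trans (mulmx_norm_le _ _))//.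
by rewrite ler_piMr ?mulr_ge0// (le_trans (norm_le_enorm _)).
Qed.

Variables (V : T -> R) (L : R).
Hypothesis hVpos : forall x, 0 < V x.
Hypothesis hVC3 : Ck 3 V.
Hypothesis hgrad : forall x, enorm (grad V x) <= L * (1 + enorm x).
Hypothesis hhess : forall x, opnorm (hess V x) <= L.

Lemma enorm0 : enorm (0 : T) = 0.
Proof. by rewrite /enorm /dotv big1 ?sqrtr0// => i _; rewrite mxE mul0r. Qed.

Lemma lipschitz_const_ge0 : 0 <= L.
Proof. by have := le_trans (enorm_ge0 _) (hgrad 0); rewrite enorm0 addr0 mulr1. Qed.

Let L0 := lipschitz_const_ge0.

(** One constant for the Lipschitz bound of the gradient (first summand, from the entries of the
    Hessian) and for its linear growth (second summand), including the loss between Euclidean and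
    max norm. *)
Definition growth_const := d%:R * (d%:R * L) + L * (1 + d%:R).

Lemma growth_const_ge0 : 0 <= growth_const.
Proof. by rewrite addr_ge0// ?mulr_ge0// addr_ge0. Qed.

Lemma grad_growth x : `|grad V x| <= growth_const * wt x.
Proof.
rewrite (le_trans (norm_le_enorm _))// (le_trans (hgrad _))//.
rewrite (@le_trans _ _ (L * (1 + d%:R) * wt x))//; last first.
  by rewrite ler_wpM2r ?wt_ge0// lerDr !mulr_ge0.
rewrite -mulrA ler_wpM2l// /wt.
have := enorm_le x; have : 0 <= `|x| by []; have : 0 <= d%:R :> R by []; nra.
Qed.

Lemma potential_tame : tame V.
Proof.
move: hVC3 => /= [dV gV]; split => //.
- apply: continuous_rV => i x.
  by have [dg _] := gV i; exact: differentiable_continuous.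
- by exists growth_const; exact: grad_growth.
Qed.

Lemma grad_lip x y : `|grad V x - grad V y| <= growth_const * `|x - y|.
Proof.
have [_ gV] := hVC3.
suff h : `|grad V x - grad V y| <= d%:R * (d%:R * L) * `|x - y|.
  rewrite (le_trans h)// ler_wpM2r// lerDl mulr_ge0// addr_ge0//.
apply: rV_norm_le => [|j]; first by rewrite !mulr_ge0.
pose f z := grad V z 0 j; have [df _] := gV j.
pose h := x - y; have yh : y + h = x by rewrite /h addrC subrK.
pose K := d%:R * (d%:R * L) * `|x - y|.
have dl (t : R) (i : 'I_d) : is_derive t 1 (fun t : R => (y + t *: h) 0 i) (h 0 i).
  have -> : (fun t : R => (y + t *: h) 0 i) = (fun=> y 0 i) \+ (fun t => h 0 i * t).
    by apply/funext => r; rewrite !mxE mulrC.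
  rewrite -[X in is_derive _ _ _ X]add0r; apply: is_deriveD.
  by rewrite -[X in is_derive _ _ _ X]mulr1; exact: is_deriveZ.
have := @abs_increment_le R (fun t => f (y + t *: h)) (fun t => K * t)
  (fun t => dotv (grad f (y + t *: h)) h) (fun=> K) 0 1 ler01.
rewrite scale1r scale0r addr0 mulr0 subr0 mulr1 yh rV_subE; apply => t _.
- by apply: is_derive_chain => // i; exact: dl.
- by rewrite -[X in is_derive _ _ _ X]mulr1; exact: is_deriveZ.
- rewrite (le_trans (dotv_le _ _))// /K -mulrA ler_wpM2l//.
  rewrite ler_wpM2r//; apply: rV_norm_le => [|i]; first by rewrite mulr_ge0.
  have -> : grad f (y + t *: h) 0 i = hess V (y + t *: h) i j by rewrite !mxE.
  rewrite (le_trans (coord_opnorm _ _ _))// (le_trans (hhess _))//.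
  rewrite ler_peMl// ler1n; by case: (d) i => [[]|].
Qed.

Variables (a beta0 beta1 : R).
Hypothesis ha : 0 < a.
Hypothesis hbeta0 : 0 <= beta0.
Hypothesis hdissip : forall x, - dotv x (grad V x) + d%:R <=
     - a * enorm x ^+ 2 + beta1 * enorm x + beta0.

Definition offset := beta0 + beta1 ^+ 2 / (2 * a).

Lemma norm_sqr_le_enorm x : `|x| ^+ 2 <= enorm x ^+ 2.
Proof. by rewrite lerXn2r ?nnegrE ?enorm_ge0 ?norm_le_enorm. Qed.

Let young r : beta1 * r <= a / 2 * r ^+ 2 + beta1 ^+ 2 / (2 * a).
Proof.
rewrite -subr_ge0 (_ : _ - _ = (a * r - beta1) ^+ 2 / (2 * a)).
  by rewrite divr_ge0 ?sqr_ge0// mulr_ge0// ltW.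
by field; rewrite gt_eqF.
Qed.

(** Young's inequality hides the linear term in half of the quadratic one. *)
Lemma grad_confining x : a / 2 * `|x| ^+ 2 - offset <= dotv x (grad V x).
Proof.
have := hdissip x; have := young (enorm x).
have : a / 2 * `|x| ^+ 2 <= a / 2 * enorm x ^+ 2.
  by rewrite ler_wpM2l ?norm_sqr_le_enorm// divr_ge0// ltW.
have : 0 <= d%:R :> R by [].
rewrite /offset; lra.
Qed.

(** The radial derivative is integrated from x/2 to x, and the positive V(x/2) is dropped. Starting
    at x/2 rather than at 0 keeps 1/s bounded, since the assumption controls s times the radial
    derivative. *)
Lemma potential_coercive x : a / 8 * `|x| ^+ 2 - (2 * beta0 + beta1 ^+ 2 / (2 * a)) <= V x.
Proof.
pose r := enorm x.
(* Lower bound for the radial derivative when s lies in [1/2, 1]: there s^2 >= s/2 and 1 <= 2 s,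
   whence [a / 2] and [2 * beta0]. *)
pose c := a / 2 * r ^+ 2 - beta1 * r - 2 * beta0.
have [dV _ _] := potential_tame.
have scl_der (t : R) i : is_derive t 1 (fun s : R => (s *: x) 0 i) (x 0 i).
  exact: is_derive_scale.
have dF (s : R) : is_derive s 1 (fun s : R => V (s *: x)) (dotv (grad V (s *: x)) x).
  by apply: is_derive_chain => // i.
have dG (s : R) : is_derive s 1 (fun s : R => c * s) c.
  by rewrite -[X in is_derive _ _ _ X]mulr1; exact: is_deriveZ.
have h2 : 2^-1 <= 1 :> R by rewrite invf_le1// ler1n.
have := increment_le (fun s => c * s) (fun s => V (s *: x)) (fun=> c)
  (fun s => dotv (grad V (s *: x)) x) 2^-1 1 h2
  (derivable_within _ _ _ _ (fun s _ => dG s))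
  (derivable_within _ _ _ _ (fun s _ => dF s))
  (fun s _ => dG s) (fun s _ => dF s).
rewrite scale1r mulr1 => H.
have {H} : c - c * 2^-1 <= V x - V (2^-1 *: x).
  apply: H => s /andP[s2 s1].
  have s0 : 0 < s by apply: lt_trans s2; rewrite invr_gt0.
  have := hdissip (s *: x).
  have er : enorm (s *: x) = s * r.
    rewrite /r /enorm dotvZl dotvZr mulrA -expr2 sqrtrM ?sqr_ge0//.
    by rewrite sqrtr_sqr ger0_norm// ltW.
  rewrite er dotvZl dotvC => hd.
  have dn : 0 <= d%:R :> R by [].
  have sc : s * c <= s * dotv (grad V (s *: x)) x.
    have s12 : 0 <= s - 2^-1 by rewrite subr_ge0 ltW.
    have p1 : 0 <= a * r ^+ 2 * (s * (s - 2^-1)).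
      apply: mulr_ge0; first by apply: mulr_ge0; [exact: ltW|exact: sqr_ge0].
      by apply: mulr_ge0 => //; exact: ltW.
    have p2 : 0 <= beta0 * (s - 2^-1) by exact: mulr_ge0.
    by move: hd p1 p2; rewrite /c; move: (dotv _ _) => D'; lra.
  by rewrite ler_pM2l in sc.
have Vp := ltW (hVpos (2^-1 *: x)).
have y := young r.
have n2 : a * `|x| ^+ 2 <= a * r ^+ 2 by rewrite ler_wpM2l ?norm_sqr_le_enorm// ltW.
have q : 0 <= beta1 ^+ 2 / (2 * a) by rewrite divr_ge0 ?sqr_ge0// mulr_ge0// ltW.
have y2 : beta1 * r <= a / 4 * r ^+ 2 + 2 * (beta1 ^+ 2 / (2 * a)).
  rewrite -subr_ge0 (_ : _ - _ = (a * r - 2 * beta1) ^+ 2 / (4 * a)).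
    by rewrite divr_ge0 ?sqr_ge0// mulr_ge0// ltW.
  by field; rewrite gt_eqF.
have b0 : 0 <= beta0 := hbeta0.
move: y2 q n2 Vp b0; rewrite /c; move: (beta1 ^+ 2 / (2 * a)) => Q; lra.
Qed.

End potential.

(** * Entropy inequality *)

Section entropy_inequality.
Context {dis : measure_display} {Om : measurableType dis} {R : realType}.
Variables (P Q : probability Om R) (F : Om -> R) (Z : R).
Hypothesis mF : measurable_fun setT F.
Hypothesis F0 : forall x, 0 <= F x.
Hypothesis Z1 : 1 <= Z.
Hypothesis expF : (\int[Q]_x (expR (F x))%:E <= Z%:E)%E.

(** Integrates x <= exp(x) at x = F - ln u - ln Z, with u the density dP/dQ: the exponential has
    P-integral at most 1, because the density cancels 1/u. The additive 1 is the price of this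
    elementary form of the variational principle. *)
Lemma entropy_inequality : (\int[P]_x (F x)%:E <= KL P Q + (ln Z + 1)%:E)%E.
Proof.
rewrite /KL; case: asboolP => [PQ|_]; last by rewrite addye ?leey.
pose h := Radon_Nikodym_SigmaFinite.f P Q.
have h0 x : (0 <= h x)%E by exact: Radon_Nikodym_SigmaFinite.f_ge0.
have hfin x : h x \is a fin_num by exact: Radon_Nikodym_SigmaFinite.f_fin_num.
have mh : measurable_fun setT h.
  by have := Radon_Nikodym_SigmaFinite.f_integrable PQ => /measurable_int.
pose u x := fine (h x).
have uE x : (u x)%:E = h x by rewrite fineK.
have u0 x : 0 <= u x by exact: fine_ge0.
have mu_ : measurable_fun setT u by exact: measurableT_comp.
have cov (phi : Om -> R) : measurable_fun setT phi -> (forall x, 0 <= phi x) ->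
    (\int[P]_x (phi x)%:E = \int[Q]_x (phi x * u x)%:E)%E.
  move=> mphi phi0.
  rewrite -(Radon_Nikodym_SigmaFinite.change_of_variables PQ)//.
  - by apply: eq_integral => x _; rewrite EFinM uE.
  - by apply/measurable_EFinP.
have Z0 : 0 < Z by exact: lt_le_trans Z1.
have mlnu : measurable_fun setT (fun x => ln (u x)).
  by apply: measurableT_comp => //; exact: measurable_ln.
(* Two versions of the Radon-Nikodym derivative: equal Q-almost everywhere, hence P-almost
   everywhere by absolute continuity. *)
have lnE : (\int[P]_x (ln (fine (Radon_Nikodym (charge_of_finite_measure P) Q x)))%:E =
    \int[P]_x (ln (u x))%:E)%E.
  apply: ae_eq_integral => //.
  - apply/measurable_EFinP; apply: measurableT_comp; first exact: measurable_ln.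
    apply: measurableT_comp => //.
  - exact/measurable_EFinP.
  have := null_dominates_ae_eq measurableT PQ
     (ae_eq_Radon_Nikodym_SigmaFinite PQ measurableT).
  by apply: filterS => x hx _; rewrite /u -hx.
rewrite lnE.
(* The positive part of the logarithm may have infinite integral, so the two parts are kept apart;
   the negative part has integral at most 1, which makes the subtraction legitimate. *)
pose lp x := Num.max (ln (u x)) 0; pose lm x := Num.max (- ln (u x)) 0.
have -> : (\int[P]_x (ln (u x))%:E =
    \int[P]_x (lp x)%:E - \int[P]_x (lm x)%:E)%E.
  rewrite integralE; congr (_ - _)%E; apply: eq_integral => x _.
    by rewrite funeposE EFin_max.
  by rewrite funenegE EFin_max.
have lp0 x : 0 <= lp x by rewrite le_max lexx orbT.
have lm0 x : 0 <= lm x by rewrite le_max lexx orbT.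
have mlp : measurable_fun setT lp by exact: measurable_maxr.
have mlm : measurable_fun setT lm.
  by apply: measurable_maxr => //; exact: measurableT_comp.
(* Where the density vanishes, the factor [u x] gives 0 whatever the default value of [ln 0]. *)
have uexp x : expR (- ln (u x)) * u x <= 1.
  have := u0 x; rewrite le_eqVlt => /predU1P[ux|ux]; first by rewrite -ux mulr0.
  by rewrite expRN lnK ?posrE// mulVf ?gt_eqF.
have lm1 : (\int[P]_x (lm x)%:E <= 1)%E.
  apply: (@le_trans _ _ (\int[P]_x (expR (- ln (u x)))%:E)%E).
    apply: ge0_le_integral => //.
    - by move=> x _; rewrite lee_fin.
    - exact/measurable_EFinP.
    - apply/measurable_EFinP; apply: measurableT_comp => //.
      exact: measurableT_comp.
    - move=> x _; rewrite lee_fin ge_max expR_ge0 andbT.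
      by have := @expR_ge1Dx R (- ln (u x)); lra.
  rewrite cov//; last first.
    by apply: measurableT_comp => //; exact: measurableT_comp.
  rewrite -(@probability_setT _ _ R Q) -[leRHS]mul1e -(integral_cst Q measurableT 1).
  apply: ge0_le_integral => //.
  - by move=> x _; rewrite lee_fin mulr_ge0 ?expR_ge0.
  - apply/measurable_EFinP; apply: measurable_funM => //.
    by apply: measurableT_comp => //; exact: measurableT_comp.
  - by move=> x _; rewrite lee_fin uexp.
have meF : measurable_fun setT (fun x => expR (F x - ln (u x) - ln Z)).
  by apply: measurableT_comp => //; do 2 apply: measurable_funB => //.
have eF1 : (\int[P]_x (expR (F x - ln (u x) - ln Z))%:E <= 1)%E.
  rewrite cov => [||x]; [|exact: meF|exact: expR_ge0].
  apply: (@le_trans _ _ (\int[Q]_x ((Z^-1)%:E * (expR (F x))%:E))%E).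
    apply: ge0_le_integral => //.
    - by move=> x _; rewrite lee_fin mulr_ge0 ?expR_ge0.
    - by apply/measurable_EFinP; exact: measurable_funM.
    - apply/measurable_EFinP; apply: measurable_funM => //.
      exact: measurableT_comp.
    - move=> x _; rewrite -EFinM lee_fin.
      have -> : expR (F x - ln (u x) - ln Z) * u x =
          Z^-1 * expR (F x) * (expR (- ln (u x)) * u x).
        have -> : Z^-1 = expR (- ln Z) by rewrite expRN lnK ?posrE.
        by rewrite !expRD; ring.
      by rewrite ler_piMr ?mulr_ge0 ?invr_ge0 ?expR_ge0 ?(ltW Z0) ?uexp.
  rewrite ge0_integralZl//; last 2 first.
  - by apply/measurable_EFinP; exact: measurableT_comp.
  - by rewrite lee_fin invr_ge0 ltW.
  apply: (@le_trans _ _ ((Z^-1)%:E * Z%:E)%E).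
    by apply: lee_wpmul2l => //; rewrite lee_fin invr_ge0 ltW.
  by rewrite -EFinM mulVf ?gt_eqF.
have lnZ0 : 0 <= ln Z by exact: ln_ge0.
have key : (\int[P]_x (F x)%:E + \int[P]_x (lm x)%:E <=
    \int[P]_x (lp x)%:E + (ln Z + 1)%:E)%E.
  have -> : (\int[P]_x (F x)%:E + \int[P]_x (lm x)%:E =
      \int[P]_x ((F x)%:E + (lm x)%:E))%E.
    rewrite ge0_integralD//; try by move=> x _; rewrite lee_fin.
    - exact/measurable_EFinP.
    - exact/measurable_EFinP.
  apply: (@le_trans _ _ (\int[P]_x ((lp x)%:E +
      ((ln Z)%:E + (expR (F x - ln (u x) - ln Z))%:E)))%E).
    apply: ge0_le_integral => //.
    - by move=> x _; rewrite -EFinD lee_fin addr_ge0.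
    - by apply/measurable_EFinP; exact: measurable_funD.
    - by apply/measurable_EFinP; do 2 apply: measurable_funD => //.
    - move=> x _; rewrite -!EFinD lee_fin.
      have := @expR_ge1Dx R (F x - ln (u x) - ln Z).
      have -> : ln (u x) = lp x - lm x; last by lra.
      rewrite /lp /lm; set l := ln (u x).
      by rewrite !maxEle; do 2 case: ifPn; rewrite -?ltNge => *; lra.
  rewrite ge0_integralD//; last 4 first.
  - by move=> x _; rewrite lee_fin.
  - exact/measurable_EFinP.
  - by move=> x _; rewrite -EFinD lee_fin addr_ge0 ?expR_ge0.
  - by apply/measurable_EFinP; apply: measurable_funD.
  rewrite ge0_integralD//; last exact/measurable_EFinP.
  rewrite integral_cst// [X in (_ * X)%E](@probability_setT _ _ R P) mule1.
  by rewrite EFinD leeD2l// leeD2l.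
have lmfin : (\int[P]_x (lm x)%:E)%E \is a fin_num.
  rewrite ge0_fin_numE; first exact: le_lt_trans lm1 (ltry _).
  by apply: integral_ge0 => x _; rewrite lee_fin.
by rewrite addeAC leeBrDr.
Qed.

End entropy_inequality.

(** * Integrals against product measures *)

Section products_sigma_finite.
Context {dis : measure_display} {T : measurableType dis} {R : realType}.
Variable m : {sigma_finite_measure set T -> \bar R}.

(** Cubes over an exhausting sequence of sets of finite measure. The instance is what lets Tonelli's
    theorem peel off the coordinates one by one. *)
Lemma tuple_measure_sigma_finite n : sigma_finite setT (tuple_measure m (n := n)).
Proof.
have /sigma_finiteP[F [TF ndF Foo]] := sigma_finiteT m.
pose E k n : set (n.-tuple T) := [set t | forall i, F k (tnth t i)].
exists (fun k => E k n).
  apply/esym; rewrite -subTset => t _.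
  have /choice[K KE] : forall i, exists k, F k (tnth t i).
    by move=> i; have : [set: T] (tnth t i) by []; rewrite TF => -[k _ Fk]; exists k.
  exists (\max_i K i)%N => // i.
  by move: (tnth t i) (KE i); apply/subsetPset/ndF; exact: leq_bigmax.
move=> k; have [mF Fk] := Foo k.
have mE l : measurable (E k l).
  have -> : E k l = \bigcap_(i in [set: 'I_l]) ((fun t : l.-tuple T => tnth t i) @^-1` F k).
    by apply/seteqP; split => t /= tE i => [_|]; exact: tE.
  apply: fin_bigcap_measurable => // i _.
  by rewrite -[X in measurable X]setTI; exact: measurable_tnth.
split => //; elim: n => [|n IH].
  rewrite /tuple_measure/= diracE; case: (_ \in _); exact: ltry.
rewrite /tuple_measure/= /tuple_measure_step /pushforward.
have -> : (@cons_pair _ _ n) @^-1` E k n.+1 = E k n `*` F k.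
  apply/seteqP; split => [[t x] /= tE|[t x] /= [tE Fx] i].
    split => [i|] /=; last by have := tE ord0; rewrite tnth0.
    by have := tE (lift ord0 i); rewrite tnthS.
  by case: (unliftP ord0 i) => [j|] ->; rewrite ?tnthS ?tnth0.
rewrite product_measure1E; [|exact: mE|exact: mF].
by apply: lte_mul_pinfty; rewrite ?ge0_fin_numE ?measure_ge0.
Qed.

HB.instance Definition _ n := Measure_isSigmaFinite.Build _ _ _
  (tuple_measure m (n := n)) (tuple_measure_sigma_finite n).

End products_sigma_finite.

Section products.
Context {dis : measure_display} {T : measurableType dis} {R : realType}.
Variable m : {sigma_finite_measure set T -> \bar R}.
Variables (f : T -> R) (c : R).
Hypothesis mf : measurable_fun setT f.
Hypothesis f0 : forall x, 0 <= f x.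
Hypothesis fc : (\int[m]_x (f x)%:E = c%:E)%E.

Lemma measurable_tuple_prod n :
  measurable_fun setT (fun t : n.-tuple T => \prod_(i < n) f (tnth t i)).
Proof.
have -> : (fun t : n.-tuple T => \prod_(i < n) f (tnth t i)) =
   (fun t => \prod_(i <- index_enum 'I_n) f (tnth t i)) by [].
elim: (index_enum 'I_n) => [|i r IH].
  by under eq_fun do rewrite big_nil; exact: measurable_cst.
under eq_fun do rewrite big_cons.
by apply: measurable_funM => //; apply: measurableT_comp => //; exact: measurable_tnth.
Qed.

Lemma integral_tuple_prod n :
  (\int[tuple_measure m (n := n)]_t (\prod_(i < n) f (tnth t i))%:E = (c ^+ n)%:E)%E.
Proof.
elim: n => [|n IH].
  rewrite /tuple_measure/= integral_dirac// ?diracT ?mul1e ?big_ord0//.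
  by apply/measurable_EFinP; exact: measurable_tuple_prod.
rewrite /tuple_measure/= /tuple_measure_step ge0_integral_pushforward//; last 3 first.
- exact: measurable_cons_pair.
- by apply/measurable_EFinP; exact: measurable_tuple_prod.
- by move=> t _; rewrite lee_fin prodr_ge0.
rewrite preimage_setT.
transitivity (\int[tuple_measure m (n := n) \x m]_z
    (f z.2 * \prod_(i < n) f (tnth z.1 i))%:E)%E.
  apply: eq_integral => z _; rewrite /cons_pair/= big_ord_recl tnth0.
  by congr (_ * _)%:E; apply: eq_bigr => i _; rewrite tnthS.
have mfst : measurable_fun setT (fun z : n.-tuple T * T => \prod_(i < n) f (tnth z.1 i)).
  exact: (measurableT_comp (measurable_tuple_prod n) measurable_fst).
have msnd : measurable_fun setT (fun z : n.-tuple T * T => f z.2).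
  exact: (measurableT_comp mf measurable_snd).
rewrite fubini_tonelli1/=; last 2 first.
- by apply/measurable_EFinP; exact: measurable_funM.
- by move=> z; rewrite lee_fin mulr_ge0// prodr_ge0.
transitivity (\int[tuple_measure m (n := n)]_t (c%:E * (\prod_(i < n) f (tnth t i))%:E))%E.
  apply: eq_integral => t _; rewrite /fubini_F/=.
  under eq_integral do rewrite mulrC EFinM.
  rewrite ge0_integralZl//; last 3 first.
  - exact/measurable_EFinP.
  - by move=> x _; rewrite lee_fin.
  - by rewrite lee_fin prodr_ge0.
  by rewrite fc muleC.
rewrite ge0_integralZl//; last 3 first.
- by apply/measurable_EFinP; exact: measurable_tuple_prod.
- by move=> x _; rewrite lee_fin prodr_ge0.
- by rewrite -fc integral_ge0// => x _; rewrite lee_fin.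
by rewrite IH -EFinM exprS.
Qed.

End products.

(** * Exponential moment of V/2 under the target *)

Section gibbs_moment.
Context {R : realType} {d : nat}.
Local Notation T := 'rV[R]_d.
Variables (V : T -> R) (eps C : R) (target : probability T R).
Hypothesis V_cont : continuous V.
Hypothesis V0 : forall x, 0 < V x.
Hypothesis eps0 : 0 < eps.
Hypothesis V_coercive : forall x : T, eps * `|x| ^+ 2 - C <= V x.
Hypothesis V_gibbs : gibbs V target.

(** Finiteness is read off from the normal density of variance 1/(2 e), whose integral is 1. *)
Lemma gaussian_integral (e : R) : 0 < e ->
  exists c, (\int[@lebesgue_measure R]_x (expR (- (e * x ^+ 2)))%:E = c%:E)%E.
Proof.
move=> e0; pose s := (Num.sqrt (2 * e))^-1.
have e2 : 0 < 2 * e by rewrite mulr_gt0.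
have s0 : s != 0 by rewrite invr_eq0 gt_eqF// sqrtr_gt0.
have nE x : normal_fun 0 s x = expR (- (e * x ^+ 2)).
  rewrite /normal_fun subr0 exprVn sqr_sqrtr ?ltW//; congr expR.
  by rewrite -[X in _ / X]mulr_natl; field; rewrite gt_eqF.
have := integral_normal_pdf 0 s; rewrite normal_pdfE//.
under eq_integral do rewrite EFinM nE.
have p0 := normal_peak_gt0 s0.
have mexp : measurable_fun setT (fun x : R => (expR (- (e * x ^+ 2)))%:E).
  apply/measurable_EFinP; apply: measurableT_comp => //.
  by apply: measurableT_comp => //; exact: measurable_funM.
rewrite ge0_integralZl//; last by rewrite lee_fin ltW.
set I := (X in (_ * X)%E) => IE.
have : (0 <= I)%E by apply: integral_ge0 => x _; rewrite lee_fin expR_ge0.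
move=> I0; suff : I \is a fin_num.
  by move=> /fineK IK; exists (fine I); rewrite IK.
rewrite ge0_fin_numE// ltey; apply/eqP => Ioo.
by move: IE; rewrite Ioo gt0_muley ?lte_fin.
Qed.

Lemma exp_half_potential_lebesgue :
  (\int[@lebesgue_rV R d]_x (expR (- (V x / 2)))%:E < +oo)%E.
Proof.
(* Half of the coercivity constant, divided by d + 1 to pass from the max norm to the sum of
   squares; d + 1 is never zero. *)
pose e := eps / (2 * d.+1%:R).
have e0 : 0 < e by rewrite divr_gt0// mulr_gt0.
have [c cE] := gaussian_integral e e0.
pose g (y : R) := expR (- (e * y ^+ 2)).
have g0 y : 0 <= g y by exact: expR_ge0.
have mg : measurable_fun setT g.
  apply: measurableT_comp => //; apply: measurableT_comp => //.
  exact: measurable_funM.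
have mP : measurable_fun setT (fun x : T => \prod_(i < d) g (x 0 i)).
  have -> : (fun x : T => \prod_(i < d) g (x 0 i)) =
      fun x : T => expR (- (e * dotv x x)).
    apply/funext => x; rewrite /g -expR_sum; congr expR.
    by rewrite mulr_sumr sumrN.
  apply: measurableT_comp => //; apply: measurableT_comp => //.
  apply: measurable_funM => //.
  by apply: continuous_measurable_rV; apply: continuous_dotv => x; exact: cvg_id.
have mV : measurable_fun setT V by exact: continuous_measurable_rV.
apply: (@le_lt_trans _ _ (\int[@lebesgue_rV R d]_x
    ((expR (C / 2))%:E * (\prod_(i < d) g (x 0 i))%:E))%E).
  apply: ge0_le_integral => //.
  - apply/measurable_EFinP; apply: measurableT_comp => //.
    by apply: measurableT_comp => //; exact: measurable_funM.
  - by apply/measurable_EFinP; exact: measurable_funM.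
  - move=> x _; rewrite -EFinM lee_fin /g -expR_sum -expRD ler_expR.
    rewrite sumrN -mulr_sumr.
    have xE : \sum_(i < d) x 0 i ^+ 2 = enorm x ^+ 2 by rewrite enorm_sqr.
    have : e * \sum_(i < d) x 0 i ^+ 2 <= eps / 2 * `|x| ^+ 2.
      apply: (@le_trans _ _ (e * (d.+1%:R * `|x| ^+ 2))); last first.
        by rewrite /e le_eqVlt; apply/orP; left; apply/eqP; field.
      apply: ler_wpM2l; first exact: ltW.
      rewrite xE; apply: (le_trans (enorm_sqr_le x)).
      by apply: ler_wpM2r; rewrite ?sqr_ge0 ?ler_nat.
    by have := V_coercive x; lra.
rewrite ge0_integralZl//; last 2 first.
- exact/measurable_EFinP.
- by move=> x _; rewrite lee_fin prodr_ge0.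
rewrite /lebesgue_rV ge0_integral_pushforward//; last 3 first.
- exact: measurable_row_of_tuple.
- exact/measurable_EFinP.
- by move=> x _; rewrite lee_fin prodr_ge0.
rewrite preimage_setT.
have -> : (\int[tuple_measure (@lebesgue_measure R) (n := d)]_t
   (\prod_(i < d) g (row_of_tuple t 0 i))%:E = (c ^+ d)%:E)%E.
  rewrite -(integral_tuple_prod (@lebesgue_measure R) g c mg g0 cE d).
  by apply: eq_integral => t _; congr EFin; apply: eq_bigr => i _; rewrite mxE.
by rewrite -EFinM ltry.
Qed.

(** Formally exp(V/2) exp(-V) = exp(-V/2). The Gibbs identity speaks of sets, so the integral is cut
    along the slices k <= V < k + 1, where replacing V by k + 1 costs at most a factor exp(1/2). *)
Lemma exp_half_potential_gibbs :
  exists2 Z : R, 1 <= Z & (\int[target]_x (expR (V x / 2))%:E <= Z%:E)%E.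
Proof.
have [Z Z0 targetE] := V_gibbs.
have mV : measurable_fun setT V by exact: continuous_measurable_rV.
pose A (k : nat) := V @^-1` `[k%:R, k.+1%:R[%classic.
have mA k : measurable (A k).
  by rewrite -[X in measurable X]setTI; exact: mV.
have trA : trivIset setT A.
  move=> i j _ _ [x []]; rewrite /A/= !in_itv/= => /andP[i1 i2] /andP[j1 j2].
  have := le_lt_trans i1 j2; have := le_lt_trans j1 i2.
  by rewrite !ltr_nat !ltnS => ji ij; apply/eqP; rewrite eqn_leq ij.
have UA : \bigcup_k A k = setT.
  rewrite -subTset => x _; exists (Num.truncn (V x)) => //.
  by rewrite /A /= in_itv/=; exact: truncn_itv (ltW (V0 x)).
have mexp1 : measurable_fun setT (fun x => expR (V x / 2)).
  by apply: measurableT_comp => //; exact: measurable_funM.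
have mexp2 : measurable_fun setT (fun x => expR (- V x)).
  by apply: measurableT_comp => //; exact: measurableT_comp.
have mexp3 : measurable_fun setT (fun x => expR (- (V x / 2))).
  apply: measurableT_comp => //; apply: measurableT_comp => //.
  exact: measurable_funM.
have E1 : (\int[target]_x (expR (V x / 2))%:E <=
    \int[@lebesgue_rV R d]_x ((expR 2^-1 / Z)%:E * (expR (- (V x / 2)))%:E))%E.
  rewrite -UA (ge0_integral_bigcup target)//; last first.
    by rewrite UA; exact/measurable_EFinP.
  rewrite (ge0_integral_bigcup (@lebesgue_rV R d))//; last 2 first.
  - by rewrite UA; apply/measurable_EFinP; exact: measurable_funM.
  - by move=> x _; rewrite -EFinM lee_fin mulr_ge0 ?divr_ge0 ?expR_ge0 ?ltW.
  apply: lee_nneseries => [k _ _|k _].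
    by apply: integral_ge0 => x _; rewrite lee_fin expR_ge0.
  apply: (@le_trans _ _ (\int[target]_(x in A k) (expR (k.+1%:R / 2))%:E)%E).
    apply: ge0_le_integral => //.
    - by apply: measurable_funTS; exact/measurable_EFinP.
    - move=> x; rewrite /A/= in_itv/= => /andP[_ xk].
      by rewrite lee_fin ler_expR; move: xk; lra.
  rewrite integral_cst// [X in (_ * X)%E]targetE// -ge0_integralZl//; last 2 first.
  - apply: measurable_funTS; apply/measurable_EFinP.
    exact: measurable_funM.
  - by move=> x _; rewrite lee_fin mulr_ge0 ?expR_ge0 ?invr_ge0 ?ltW.
  apply: ge0_le_integral => //.
  - by move=> x _; rewrite -EFinM lee_fin !mulr_ge0 ?expR_ge0 ?invr_ge0 ?ltW.
  - by apply: measurable_funTS; apply/measurable_EFinP; do 2 apply: measurable_funM => //.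
  - by apply: measurable_funTS; apply/measurable_EFinP; exact: measurable_funM.
  - move=> x; rewrite /A/= in_itv/= => /andP[kx _].
    rewrite -!EFinM lee_fin [leLHS]mulrCA -[leRHS]mulrA [leRHS]mulrCA.
    apply: ler_wpM2l; first by rewrite invr_ge0 ltW.
    by rewrite -!expRD ler_expR -natr1; move: kx; lra.
have I0 : (0 <= \int[@lebesgue_rV R d]_x (expR (- (V x / 2)))%:E)%E.
  by apply: integral_ge0 => x _; rewrite lee_fin expR_ge0.
have Ifin : (\int[@lebesgue_rV R d]_x (expR (- (V x / 2)))%:E)%E \is a fin_num.
  by rewrite ge0_fin_numE// exp_half_potential_lebesgue.
move: E1; rewrite ge0_integralZl//; last 2 first.
- exact/measurable_EFinP.
- by rewrite lee_fin divr_ge0 ?expR_ge0 ?ltW.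
rewrite -(fineK Ifin) -EFinM; set Z1 := _ * _ => E1.
exists (Num.max 1 Z1); first by rewrite le_max lexx.
by apply: (le_trans E1); rewrite lee_fin le_max lexx orbT.
Qed.

End gibbs_moment.

(** * Initial energy under the entropy assumption *)

Section initial_energy.
Context {dis : measure_display} {T : measurableType dis} {R : realType}.
Variables (V : T -> R) (target : probability T R) (Z : R).
Hypothesis mV : measurable_fun setT V.
Hypothesis V0 : forall x, 0 <= V x.
Hypothesis Z1 : 1 <= Z.
Hypothesis expV : (\int[target]_x (expR (V x / 2))%:E <= Z%:E)%E.

Lemma exp_half_potential_tuple N :
  (\int[tuple_prob target (n := N)]_x
     (expR (2^-1 * \sum_(i < N) V (tnth x i)))%:E <= (Z ^+ N)%:E)%E.
Proof.
have [c cE] : exists c, (\int[target]_x (expR (V x / 2))%:E = c%:E)%E.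
  exists (fine (\int[target]_x (expR (V x / 2))%:E)%E); rewrite fineK//.
  rewrite ge0_fin_numE; first exact: le_lt_trans expV (ltry _).
  by apply: integral_ge0 => x _; rewrite lee_fin expR_ge0.
have c0 : 0 <= c.
  by rewrite -lee_fin -cE; apply: integral_ge0 => x _; rewrite lee_fin expR_ge0.
rewrite (_ : integral _ _ _ = (c ^+ N)%:E); last first.
  rewrite -(@integral_tuple_prod _ _ _ target (fun x => expR (V x / 2)) c _ _ cE N).
  - apply: eq_integral => x _; rewrite -expR_sum mulr_sumr.
    by congr (expR _)%:E; apply: eq_bigr => i _; rewrite mulrC.
  - by apply: measurableT_comp => //; exact: measurable_funM.
  - by move=> x; exact: expR_ge0.
rewrite lee_fin lerXn2r ?nnegrE//; first exact: le_trans Z1.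
by rewrite -lee_fin -cE.
Qed.

Variable P0 : forall N : nat, probability (N.-tuple T) R.

(** The entropy inequality is applied to half the total energy: the entropy and [ln (Z ^+ N)] are
    both at most of order N, so division by N leaves a bound uniform in N. *)
Lemma initial_energy_bound :
  (ereal_sup [set (N%:R^-1)%:E * KL (P0 N) (tuple_prob target (n := N))
    | N in [set N : nat | (1 <= N)%N]] < +oo)%E ->
  (ereal_sup [set (\int[P0 N]_x (N%:R^-1 * \sum_(i < N) V (tnth x i))%:E)%E
    | N in [set N : nat | (2 <= N)%N]] < +oo)%E.
Proof.
set S := ereal_sup _ => Soo.
apply: (@le_lt_trans _ _ (2%:E * S + (2 * (ln Z + 1))%:E)%E); last first.
  apply: lte_add_pinfty; last by rewrite ltry.
  case: S Soo => [r|//|] _; first by rewrite -EFinM ltry.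
  by rewrite gt0_muleNy ?lte_fin.
apply: ge_ereal_sup => _ /= [N N2 <-].
have N0 : 0 < N%:R :> R by rewrite ltr0n; apply: leq_trans N2.
have mSum : measurable_fun setT (fun x : N.-tuple T => \sum_(i < N) V (tnth x i)).
  apply: measurable_sum => i; apply: measurableT_comp => //.
  exact: measurable_tnth.
have Sum0 (x : N.-tuple T) : 0 <= \sum_(i < N) V (tnth x i).
  by rewrite sumr_ge0.
have ZN : 1 <= Z ^+ N by exact: exprn_ege1.
have mF : measurable_fun setT (fun x : N.-tuple T => 2^-1 * \sum_(i < N) V (tnth x i)).
  exact: measurable_funM.
have F0 (x : N.-tuple T) : 0 <= 2^-1 * \sum_(i < N) V (tnth x i) by rewrite mulr_ge0.
have := entropy_inequality (P0 N) (tuple_prob target (n := N)) _ (Z ^+ N) mF F0 ZN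
  (exp_half_potential_tuple N).
set K := KL _ _ => FK.
have KS : ((N%:R^-1)%:E * K <= S)%E.
  by apply: ereal_sup_ubound; exists N => //=; exact: ltnW.
have -> : (\int[P0 N]_x (N%:R^-1 * \sum_(i < N) V (tnth x i))%:E =
    (2 * N%:R^-1)%:E * \int[P0 N]_x (2^-1 * \sum_(i < N) V (tnth x i))%:E)%E.
  rewrite -ge0_integralZl; last 4 first.
  - by [].
  - by apply/measurable_EFinP; apply: mF.
  - by move=> x _; rewrite lee_fin F0.
  - by rewrite lee_fin mulr_ge0// invr_ge0 ltW.
  apply: eq_integral => x _; rewrite -EFinM; congr EFin.
  by rewrite mulrACA mulfV// mul1r.
apply: (@le_trans _ _ ((2 * N%:R^-1)%:E * (K + (ln (Z ^+ N) + 1)%:E))%E).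
  by apply: lee_wpmul2l => //; rewrite lee_fin mulr_ge0// invr_ge0 ltW.
rewrite muleDr ?fin_num_adde_defl// leeD//.
  by rewrite EFinM -muleA lee_wpmul2l// lee_fin.
rewrite -EFinM lee_fin lnXn ?(lt_le_trans ltr01)// -mulrA ler_wpM2l//.
have -> : N%:R^-1 * (ln Z *+ N + 1) = ln Z + N%:R^-1.
  by rewrite -(mulr_natl (ln Z)); field; rewrite gt_eqF.
rewrite lerD2l.
by rewrite invf_le1// ler1n ltnW.
Qed.

End initial_energy.

(** * Empirical measures *)

Section empirical_measure.
Context {R : realType} {d : nat}.
Local Notation T := 'rV[R]_d.

Lemma empirical_pushforward N (x y : N.-tuple T) (X : T -> T) :
  (forall i, tnth y i = X (tnth x i)) -> empirical y = pushforward (empirical x) X.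
Proof.
move=> yE; apply/funext => A; rewrite /pushforward /empirical /mscale /= /msum.
congr (_ * _)%E; apply: eq_bigr => i _.
by rewrite /= !diracE -!tnth_nth yE.
Qed.

Lemma ge0_integral_empirical N (x : N.-tuple T) (f : T -> R) :
  measurable_fun setT f -> (forall z, 0 <= f z) ->
  (\int[empirical x]_z (f z)%:E = (N%:R^-1 * \sum_(i < N) f (tnth x i))%:E)%E.
Proof.
move=> mf f0; have mfE : measurable_fun setT (EFin \o f) by exact/measurable_EFinP.
have fE0 z : [set: T] z -> (0 <= (f z)%:E)%E by rewrite lee_fin.
rewrite ge0_integral_mscale// ge0_integral_measure_sum// EFinM -sumEFin.
congr (_ * _)%E; apply: eq_bigr => i _.
by rewrite integral_dirac// diracT mul1e -tnth_nth.
Qed.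

Lemma empirical_setT N (x : N.+1.-tuple T) : empirical x setT = 1%E.
Proof.
rewrite -[LHS]mul1e -(integral_cst (empirical x) measurableT 1).
rewrite (ge0_integral_empirical _ x (fun=> 1))//.
by rewrite sumr_const card_ord mulVf// pnatr_eq0.
Qed.

(** A probability only for nonempty configurations, hence the index [N.+1]. *)
HB.instance Definition _ N (x : N.+1.-tuple T) :=
  Measure_isProbability.Build _ _ _ (empirical x) (empirical_setT N x).

Lemma integrable_empirical N (x : N.-tuple T) (f : T -> R) :
  measurable_fun setT f -> (empirical x).-integrable setT (EFin \o f).
Proof.
move=> mf; apply/integrableP; split; first exact/measurable_EFinP.
rewrite (ge0_integral_empirical _ x (fun z => `|f z|))// ?ltry//.
exact: measurableT_comp.
Qed.

Lemma Rintegral_empirical N (x : N.-tuple T) (f : T -> R) :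
  measurable_fun setT f ->
  \int[empirical x]_z f z = N%:R^-1 * \sum_(i < N) f (tnth x i).
Proof.
move=> mf; pose p z := Num.max (f z) 0; pose q z := Num.max (- f z) 0.
have mp : measurable_fun setT p by exact: measurable_maxr.
have mq : measurable_fun setT q.
  by apply: measurable_maxr => //; exact: measurableT_comp.
have p0 z : 0 <= p z by rewrite le_max lexx orbT.
have q0 z : 0 <= q z by rewrite le_max lexx orbT.
have fpq z : f z = p z - q z.
  by rewrite /p /q !maxEle; do 2 case: ifPn; rewrite -?ltNge => *; lra.
rewrite (_ : \int[empirical x]_z f z = \int[empirical x]_z (p z - q z)); last first.
  by apply: eq_Rintegral => z _.
rewrite RintegralB//; try exact: integrable_empirical.
rewrite /Rintegral !ge0_integral_empirical//= -mulrBr -sumrB.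
by congr (_ * _); apply: eq_bigr => i _; rewrite fpq.
Qed.

End empirical_measure.

(** * Image measures and the SVGD velocity *)

Section pushforward_probability.
Context {R : realType} {d : nat}.
Local Notation T := 'rV[R]_d.
Variables (mu : probability T R) (X : T -> T).
Hypothesis cX : continuous X.

Lemma Rintegral_pushforward (f : T -> R) : measurable_fun setT f ->
  mu.-integrable setT (EFin \o (f \o X)) ->
  fine (\int[pushforward mu X]_y (f y)%:E)%E = \int[mu]_x f (X x).
Proof.
move=> mf fX; have mX : measurable_fun setT X by exact: continuous_measurable_rV_rV.
have mfE : measurable_fun setT (EFin \o f) by exact/measurable_EFinP.
by rewrite /Rintegral (integral_pushforward mX mfE)// preimage_setT.
Qed.

End pushforward_probability.

Section velocity.
Context {R : realType} {d : nat}.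
Local Notation T := 'rV[R]_d.
Variables (nu : R) (Sigma : 'M[R]_d) (V : T -> R).
Hypothesis hnu : 3 / 2 < nu.
Let b := interaction (matern nu Sigma) (dmatern nu Sigma) V.

Lemma svgd_velocityE (rho : set T -> \bar R) x :
  svgd_velocity V (svgd_kernel nu Sigma) rho x =
  \row_i fine (\int[rho]_y (b x y 0 i)%:E)%E.
Proof.
apply/rowP => i; rewrite !mxE; congr fine; congr integral; apply/funext => y.
by rewrite grad_kernel// /b /interaction !mxE; congr (_%:E); rewrite /svgd_kernel mulNr.
Qed.

End velocity.

(** * Difference quotients on the half-line *)

Section slopes.
Context {R : realType}.
Implicit Types (F : R -> R) (D : set R).

(** Epsilon-delta form of a derivative relative to [D]; it mediates between the one-sided derivative
    at time 0 in [particle_solution] and the two-sided [is_derive]. *)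
Definition has_slope D F (t l : R) := forall e, 0 < e -> exists2 dl, 0 < dl &
  forall s, D s -> s != t -> `|s - t| < dl -> `|l - (s - t)^-1 * (F s - F t)| <= e.

Lemma has_slopeP D F (t l : R) :
  (fun s => (s - t)^-1 * (F s - F t)) @ (within D t^') --> l <-> has_slope D F t l.
Proof.
split=> [/cvgrPdist_le H e e0|H].
  have [dl /= dl0 h] := H e e0; exists dl => // s Ds st sdl; apply: h => //=.
  by rewrite distrC.
apply/cvgrPdist_le => e e0; have [dl dl0 h] := H e e0.
by exists dl => //= s sdl st Ds; apply: h => //; rewrite distrC.
Qed.

Lemma is_derive_slope F (t l : R) : is_derive t 1 F l -> has_slope setT F t l.
Proof.
move=> [dF <-] e e0; move/cvgrPdist_le: dF => /(_ e e0)[dl /= dl0 h].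
exists dl => // s _ st sdl; have := h (s - t).
rewrite /= sub0r normrN => /(_ sdl); rewrite subr_eq0 => /(_ st).
by rewrite /= [_%:A]mulr1 subrK.
Qed.

Lemma slope_is_derive F (t l : R) : has_slope setT F t l -> is_derive t 1 F l.
Proof.
move=> sF.
have H : (fun h => h^-1 *: ((F \o shift t) (h *: 1) - F t)) @ 0^' --> l.
  apply/cvgrPdist_le => e e0; have [dl dl0 h] := sF e e0.
  exists dl => // u /=; rewrite sub0r normrN => udl u0.
  have := h (u + t) I; rewrite addrK -subr_eq0 addrK => /(_ u0 udl).
  by rewrite /= [_%:A]mulr1.
apply: DeriveDef; first by apply/cvg_ex; exists l.
exact: cvg_lim.
Qed.

Lemma slope_tpos F (t l : R) : has_slope [set s | 0 <= s] F t l -> 0 < t ->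
  is_derive t 1 (F \o tpos) l.
Proof.
move=> sF t0; apply: slope_is_derive => e e0; have [dl dl0 h] := sF e e0.
exists (Num.min dl t) => [|s _ st]; first by rewrite lt_min dl0.
rewrite lt_min => /andP[sdl]; rewrite ltr_norml => /andP[sl _].
have s0 : 0 <= s by lra.
by rewrite /= !tpos_id ?(ltW t0)//; exact: h.
Qed.

Lemma slope_continuous F (f : R -> R) :
  (forall t, 0 <= t -> has_slope [set s | 0 <= s] F t (f t)) ->
  continuous (F \o tpos).
Proof.
move=> sF t; have [dl dl0 h] := sF (tpos t) (tpos_ge0 t) 1 ltr01.
apply/cvgrPdist_le => e e0.
pose A := `|f (tpos t)| + 1; have A0 : 0 < A by rewrite ltr_wpDl.
exists (Num.min dl (e / A)) => [|s /=]; first by rewrite /= lt_min dl0 divr_gt0.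
rewrite lt_min => /andP[s1 s2].
have st : `|tpos s - tpos t| <= `|t - s| by rewrite (distrC t) tpos_lip.
have [->|sNt] := eqVneq (tpos s) (tpos t); first by rewrite subrr normr0 ltW.
have := h (tpos s) (tpos_ge0 s) sNt (le_lt_trans st s1).
set q := _^-1 * _ => hq.
have -> : F (tpos t) - F (tpos s) = - ((tpos s - tpos t) * q).
  by rewrite /q mulVKf ?subr_eq0// opprB.
have qA : `|q| <= A.
  rewrite -[q](subKr (f (tpos t))) (le_trans (ler_normB _ _))// lerD2l//.
rewrite normrN normrM (@le_trans _ _ (e / A * A))//; last by rewrite divfK ?gt_eqF.
by rewrite ler_pM// (le_trans st)// ltW.
Qed.

End slopes.

(** * Uniqueness of particle trajectories *)

Section uniqueness.
Context {R : realType} {d N : nat}.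
Local Notation T := 'rV[R]_d.
Local Notation conf := ('I_N -> T).
Variable W : conf -> conf.
Hypothesis W_lip : forall M, exists2 K, 0 < K & forall p q : conf,
  (forall i, `|p i| <= M) -> (forall i, `|q i| <= M) ->
  forall i, `|W p i - W q i| <= K * \sum_j `|p j - q j|.

Definition solves (x : R -> conf) := forall t, 0 <= t -> forall i k,
  has_slope [set s | 0 <= s] (fun s => x s i 0 k) t (W (x t) i 0 k).

Lemma solves_continuous x i : solves x -> continuous (fun s : R => x (tpos s) i).
Proof.
move=> sx; apply: continuous_rV => k.
apply: (slope_continuous (fun s => x s i 0 k) (fun t => W (x t) i 0 k)) => t t0.
exact: sx.
Qed.

(** Two solutions stay in a common ball on [0, S], where the vector field is Lipschitz; Gronwall's
    lemma with zero initial distance concludes. *)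
Lemma solves_unique x y : solves x -> solves y -> x 0 = y 0 ->
  forall t, 0 <= t -> x t = y t.
Proof.
move=> sx sy xy0 S S0.
have cx i := solves_continuous x i sx; have cy i := solves_continuous y i sy.
pose g (s : R) : R := \sum_i (`|x (tpos s) i| + `|y (tpos s) i|).
have cg : continuous g.
  apply: continuous_sum => i; apply: continuous_add.
    by apply: (continuous_comp_fun (fun u : T => `|u| : R)) => //; exact: norm_continuous.
  by apply: (continuous_comp_fun (fun u : T => `|u| : R)) => //; exact: norm_continuous.
(* One bound for both trajectories on [0, S]; it selects the Lipschitz constant [K]. *)
have [c _ gM] := EVT_max S0 (continuous_subspaceT cg).
have le_g s i : 0 <= s <= S -> `|x s i| + `|y s i| <= g c.
  move=> sS; have s0 : 0 <= s by case/andP: sS.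
  rewrite (le_trans _ (gM s _))// ?in_itv//=.
  by rewrite /g tpos_id// (bigD1 i)//= lerDl sumr_ge0// => j _; rewrite addr_ge0.
have [K K0 WK] := W_lip (g c).
pose dist (s : R) : R := \sum_j `|x (tpos s) j - y (tpos s) j|.
have cD : continuous dist.
  apply: continuous_sum => i.
  apply: (continuous_comp_fun (fun u : T => `|u| : R)); last exact: norm_continuous.
  by apply: continuous_sub.
have D0 s : 0 <= dist s by exact: sumr_ge0.
have P0 t : 0 <= t -> 0 <= prim dist t.
  by move=> t0; rewrite (primE _ _ cD t0); apply: Rintegral_ge0.
have coord t i k : 0 <= t <= S -> `|(x t i - y t i) 0 k| <= K * prim dist t.
  move=> /andP[t0 tS].
  pose F (s : R) := x (tpos s) i 0 k - y (tpos s) i 0 k.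
  pose f (s : R) := W (x s) i 0 k - W (y s) i 0 k.
  have cF : continuous F by apply: continuous_sub; exact: continuous_coord.
  have dF (s : R) : 0 < s < t -> is_derive s 1 F (f s).
    move=> /andP[s0 _]; apply: is_deriveB.
      by apply: (slope_tpos (fun u => x u i 0 k)) => //; exact/sx/ltW.
    by apply: (slope_tpos (fun u => y u i 0 k)) => //; exact/sy/ltW.
  have dG (s : R) : 0 <= s <= t -> is_derive s 1 (fun s : R => K * prim dist s) (K * dist s).
    by move=> /andP[s0 _]; apply: is_deriveZ; apply: is_derive_prim => //; lra.
  have cG := derivable_within _ _ _ _ dG.
  have Wi s : 0 < s < t -> 0 <= s <= t by move=> /andP[/ltW -> /ltW ->].
  have fD s : 0 < s < t -> `|f s| <= K * dist s.
    move=> /Wi /andP[s0 st]; have sS : 0 <= s <= S by rewrite s0 (le_trans st).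
    rewrite /f -[X in `|X|]rV_subE (le_trans (coord_norm_le _ _))//.
    rewrite /dist tpos_id//; apply: WK => j.
      by rewrite (le_trans _ (le_g s j sS))// lerDl.
    by rewrite (le_trans _ (le_g s j sS))// lerDr.
  have F0 : F 0 = 0 by rewrite /F tpos_id// xy0 subrr.
  have h1 := increment_le F _ f _ 0 t t0 (continuous_subspaceT cF) cG dF
    (fun s st => dG s (Wi s st)).
  have cNF : continuous (fun s => - F s) by move=> s; apply: cvgN; exact: cF.
  have dNF (s : R) : 0 < s < t -> is_derive s 1 (fun s => - F s) (- f s).
    by move=> st; apply: is_deriveN; exact: dF.
  have h2 := increment_le (fun s => - F s) _ (fun s => - f s) _ 0 t t0
    (continuous_subspaceT cNF) cG dNF (fun s st => dG s (Wi s st)).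
  move: h1 h2; rewrite prim0 F0 mulr0 !subr0 oppr0 subr0 => h1 h2.
  have -> : (x t i - y t i) 0 k = F t by rewrite rV_subE /F tpos_id.
  rewrite ler_norml lerNl h1 ?andbT ?h2// => s st; have := fD s st;
    by rewrite ler_norml => /andP[]; lra.
(* [N.+1] in place of [N] keeps the Gronwall rate positive even when there are no particles. *)
have dist_le t : 0 <= t <= S -> dist t <= 0 + ((N.+1%:R * K) * prim dist t).
  move=> tS; have [t0 _] := andP tS; rewrite add0r.
  have KP : 0 <= K * prim dist t := mulr_ge0 (ltW K0) (P0 t t0).
  apply: (@le_trans _ _ (\sum_(j < N) (K * prim dist t))).
    rewrite /dist tpos_id//; apply: ler_sum => j _; apply: rV_norm_le => // k.
    exact: coord.
  rewrite sumr_const card_ord -mulrA -[leLHS]mulr_natl ler_wpM2r// ler_nat.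
  exact: leqnSn.
have NK : 0 < N.+1%:R * K by rewrite mulr_gt0.
have := gronwall dist _ 0 S NK cD dist_le S; rewrite S0 lexx mul0r => /(_ isT) DS.
apply/funext => i; apply/eqP; rewrite -subr_eq0 -normr_le0.
rewrite (le_trans _ DS)// /dist tpos_id// (bigD1 i)//= lerDl.
by rewrite sumr_ge0.
Qed.

End uniqueness.

Section mean_interaction.
Context {R : realType} {d N : nat}.
Local Notation T := 'rV[R]_d.
Variables (b : T -> T -> T) (Cb : R).
Hypothesis Cb0 : 0 < Cb.
Hypothesis b_lip : forall z y z' y', `|b z y - b z' y'| <=
  Cb * (`|z - z'| * wt y ^+ 2 + `|y - y'| * (wt y + wt y') * wt z').

Definition mean_interaction (p : 'I_N -> T) (i : 'I_N) : T :=
  \row_k (N%:R^-1 * \sum_j b (p i) (p j) 0 k).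

Lemma mean_interaction_lip M : exists2 K, 0 < K & forall p q : 'I_N -> T,
  (forall i, `|p i| <= M) -> (forall i, `|q i| <= M) -> forall i,
  `|mean_interaction p i - mean_interaction q i| <= K * \sum_j `|p j - q j|.
Proof.
pose B := 1 + `|M|.
have B0 : 0 < B by rewrite ltr_wpDr.
exists (3 * Cb * B ^+ 2) => [|p q pM qM i]; first by rewrite !mulr_gt0 ?exprn_gt0.
set S := \sum_j _.
have S0 : 0 <= S by exact: sumr_ge0.
have leS j : `|p j - q j| <= S by rewrite /S (bigD1 j)//= lerDl sumr_ge0.
have wB (r : 'I_N -> T) (rM : forall i, `|r i| <= M) j : wt (r j) <= B.
  by rewrite lerD2l (le_trans (rM j))// ler_norm.
have K0 : 0 <= 3 * Cb * B ^+ 2 * S.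
  by apply: mulr_ge0 => //; apply: ltW; rewrite !mulr_gt0 ?exprn_gt0.
apply: rV_norm_le => // k; rewrite rV_subE !mxE -mulrBr -sumrB.
rewrite normrM ger0_norm ?invr_ge0//.
apply: (@le_trans _ _ (N%:R^-1 * \sum_(j < N) (3 * Cb * B ^+ 2 * S))).
  rewrite ler_wpM2l ?invr_ge0// (le_trans (ler_norm_sum _ _ _))//.
  apply: ler_sum => j _; rewrite -rV_subE (le_trans (coord_norm_le _ _))//.
  rewrite (le_trans (b_lip _ _ _ _))//.
  have w1 := wB p pM j; have w2 := wB q qM j; have w3 := wB q qM i.
  have e1 : `|p i - q i| * wt (p j) ^+ 2 <= S * B ^+ 2.
    by rewrite ler_pM// ?sqr_ge0// lerXn2r ?nnegrE ?wt_ge0 ?(ltW B0).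
  have e2 : `|p j - q j| * (wt (p j) + wt (q j)) * wt (q i) <= S * (B + B) * B.
    by rewrite !ler_pM ?mulr_ge0 ?addr_ge0 ?wt_ge0// lerD.
  have -> : 3 * Cb * B ^+ 2 * S = Cb * (S * B ^+ 2 + S * (B + B) * B) by ring.
  by rewrite ler_wpM2l ?lerD// ltW.
rewrite sumr_const card_ord -[X in _ * X]mulr_natl.
have [->|N0] := eqVneq N 0%N; first by rewrite invr0 !mul0r.
by rewrite mulKf ?pnatr_eq0.
Qed.

End mean_interaction.

(** * Time-integrated Euclidean second moment *)

Section energy.
Context {R : realType} {d : nat}.
Local Notation T := 'rV[R]_d.
Local Notation leb := (@lebesgue_measure R).
Variable mu : probability T R.
Hypothesis mu2 : mu.-integrable setT (EFin \o (fun x : T => wt x ^+ 2)).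
Variables (X v : R -> T -> T).
Hypothesis rX : regular_path X.
Hypothesis tX : transported X v.

Lemma enorm_moment_continuous :
  continuous (fun s : R => \int[mu]_x (enorm (X (tpos s) x) ^+ 2) : R).
Proof.
apply: (continuous_integral mu mu2) => [x|s|S].
- under [X in continuous X]eq_fun do rewrite enorm_sqr.
  by apply: continuous_dotv; exact: regular_path_time.
- under [X in continuous X]eq_fun do rewrite enorm_sqr.
  by apply: continuous_dotv; apply: regular_path_cont => //; exact: tpos_ge0.
- have [A A0 aX] := regular_path_adm X (tpos S) rX (tpos_ge0 S).
  exists (d%:R * (1 + A) ^+ 2) => s x sS; rewrite ger0_norm ?sqr_ge0//.
  rewrite (le_trans (enorm_sqr_le _))// -mulrA ler_wpM2l//.
  rewrite (le_trans (norm_sqr_le_wt _))//; apply: adm_wt2; apply: aX.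
  by rewrite tpos_ge0/= /tpos ge_max !le_max lexx (ltW sS) orbT.
Qed.

Lemma enorm_moment_integrable t : 0 <= t ->
  mu.-integrable setT (EFin \o (fun x => enorm (X t x) ^+ 2)).
Proof.
move=> t0; have [A A0 aX] := regular_path_adm X t rX t0.
apply: (integrable_wt2 mu mu2 _ (d%:R * (1 + A) ^+ 2)) => [|x].
  under [X in continuous X]eq_fun do rewrite enorm_sqr.
  by apply: continuous_dotv; apply: regular_path_cont.
rewrite ger0_norm ?sqr_ge0// (le_trans (enorm_sqr_le _))// -mulrA ler_wpM2l//.
rewrite (le_trans (norm_sqr_le_wt _))//; apply: adm_wt2; apply: aX.
by rewrite t0 lexx.
Qed.

Variables (V : T -> R) (C1 : R).
Hypothesis Vtame : tame V.
Hypothesis Vge0 : forall x, 0 <= V x.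
Hypothesis dissipation : forall s, 0 <= s ->
  flux mu X v V s <= C1 - \int[mu]_x (`|X s x| ^+ 2).

(** This is [moment_bound] at dissipation rate 1; the factor [d] converts the max norm into
    Euclidean length. *)
Lemma enorm_moment_bound t : 0 <= t ->
  (\int[leb]_(s in `[0%R, t]) (\int[mu]_x (enorm (X s x) ^+ 2))%:E <=
   (d%:R * (C1 * t + \int[mu]_x V x))%:E)%E.
Proof.
move=> t0; pose m (s : R) := \int[mu]_x (`|X (tpos s) x| ^+ 2).
have cm : continuous m by exact: (moment_continuous mu mu2 X rX).
have diss s : 0 <= s -> flux mu X v V s <= C1 - 1 * \int[mu]_x (`|X s x| ^+ 2).
  by rewrite mul1r; exact: dissipation.
have := moment_bound mu mu2 X v rX tX V C1 1 Vtame Vge0 ltr01 diss t t0.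
rewrite invr1 mul1r.
have -> : \int[leb]_(s in `[0, t]) \int[mu]_x `|X s x| ^+ 2 = \int[leb]_(s in `[0, t]) m s.
  by apply: eq_Rintegral => s; rewrite inE/= in_itv/= => /andP[s0 _]; rewrite /m tpos_id.
move=> mB; have im := continuous_itv_integrable m 0 t cm.
have m0 s : 0 <= m s by apply: Rintegral_ge0 => x _; exact: sqr_ge0.
apply: (@le_trans _ _ (d%:R%:E * \int[leb]_(s in `[0%R, t]) (m s)%:E)%E); last first.
  rewrite -[X in (_ * X)%E]fineK; last exact: integrable_fin_num im.
  by rewrite -EFinM lee_fin ler_wpM2l.
rewrite -ge0_integralZl//; last 2 first.
- by case/integrableP: im.
- by move=> s _; rewrite lee_fin.
have -> : (\int[leb]_(s in `[0%R, t]) (\int[mu]_x (enorm (X s x) ^+ 2))%:E =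
    \int[leb]_(s in `[0%R, t]) (\int[mu]_x (enorm (X (tpos s) x) ^+ 2))%:E)%E.
  apply: eq_integral => s; rewrite inE/= in_itv/= => /andP[s0 _].
  by rewrite tpos_id.
apply: ge0_le_integral => //.
- by move=> s _; rewrite lee_fin; apply: Rintegral_ge0 => x _; exact: sqr_ge0.
- by have /integrableP[] := continuous_itv_integrable _ 0 t enorm_moment_continuous.
- by apply/measurable_EFinP/measurable_funM => //; case/integrableP: im => /measurable_EFinP.
- move=> s _.
  have [A A0 aX] := regular_path_adm X (tpos s) rX (tpos_ge0 s).
  have im2 : mu.-integrable setT (EFin \o (fun x => `|X (tpos s) x| ^+ 2)).
    by apply: (integrable_norm_sqr mu mu2 A); apply: aX; rewrite tpos_ge0 lexx.
  rewrite -EFinM lee_fin /m -RintegralZl//.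
  apply: Rintegral_le; last by move=> x; exact: enorm_sqr_le.
    exact: (enorm_moment_integrable _ (tpos_ge0 s)).
  exact: integrable_scale.
Qed.

End energy.

(** * The SVGD flow for a general initial measure *)

Section svgd_flow.
Context {R : realType} {d : nat}.
Local Notation T := 'rV[R]_d.
Variables (nu : R) (Sigma : 'M[R]_d) (V : T -> R) (L a beta0 beta1 : R).
Hypothesis hnu : 3 / 2 < nu.
Hypothesis hVpos : forall x, 0 < V x.
Hypothesis hVC3 : Ck 3 V.
Hypothesis hgrad : forall x, enorm (grad V x) <= L * (1 + enorm x).
Hypothesis hhess : forall x, opnorm (hess V x) <= L.
Hypothesis ha : 0 < a.
Hypothesis hbeta0 : 0 <= beta0.
Hypothesis hdissip : forall x, - dotv x (grad V x) + d%:R <=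
     - a * enorm x ^+ 2 + beta1 * enorm x + beta0.

Let b := interaction (matern nu Sigma) (dmatern nu Sigma) V.
Local Notation k := (svgd_kernel nu Sigma).

Lemma matern_sym (z : T) : matern nu Sigma (- z) = matern nu Sigma z.
Proof.
rewrite /matern; congr (_ * bessel_profile _ (Num.sqrt _)).
by rewrite mulNmx; apply: eq_bigr => i _; rewrite !mxE mulrNN.
Qed.

Lemma svgd_interaction_regular : exists2 Cb, 0 < Cb &
  (forall z y, `|b z y| <= Cb * (wt z * wt y ^+ 2)) /\
  (forall z y z' y', `|b z y - b z' y'| <=
    Cb * (`|z - z'| * wt y ^+ 2 + `|y - y'| * (wt y + wt y') * wt z')).
Proof.
have [C0 [C00 mB mL dmL]] := matern_bounds nu Sigma hnu.
have LV0 := growth_const_ge0 V L hgrad.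
have gG := grad_growth V L hgrad; have gL := grad_lip V L hVC3 hgrad hhess.
exists ((d%:R + C0) * @growth_const R d L + (1 + d%:R + C0) * @growth_const R d L + 1 + 2 * C0).
  exact: interaction_const_gt0.
split.
  exact: (interaction_growth _ _ C0 C00 mB dmL (dmatern0 nu Sigma) V _ LV0 gG).
exact: (interaction_lip _ _ C0 C00 mB mL dmL V _ LV0 gL gG).
Qed.

(** [C1] is chosen before [mu], from the kernel and the potential alone; this makes the later bounds
    uniform in N and in the initial configuration. *)
Lemma svgd_flow : exists2 C1, 0 <= C1 & forall mu : probability T R,
  mu.-integrable setT (EFin \o (fun x : T => wt x ^+ 2)) ->
  exists X, [/\ regular_path X,
    transported X (fun t x => vel mu b (X t) (X t x)) &
    forall s, 0 <= s -> flux mu X (fun t x => vel mu b (X t) (X t x)) V s <=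
      C1 - \int[mu]_x (`|X s x| ^+ 2)].
Proof.
have [C0 [C00 mB mL dmL]] := matern_bounds nu Sigma hnu.
have LV0 := growth_const_ge0 V L hgrad; set LV := @growth_const R d L in LV0.
have gG := grad_growth V L hgrad.
have Vt := potential_tame V L hVC3 hgrad.
have [Cb Cb0 [bG bL]] := svgd_interaction_regular.
pose D := 6 * (d%:R * (LV * C0)).
have D0 : 0 <= D by rewrite /D !mulr_ge0.
(* Makes the net dissipation rate [kap * (a / 2) - D] equal to 1, where [a / 2] is the confinement
   constant of [grad_confining]. *)
pose kap := (D + 1) / (a / 2).
have kap0 : 0 <= kap by rewrite /kap !divr_ge0 ?addr_ge0// ltW.
pose C3 := offset a beta0 beta1.
have C30 : 0 <= C3 by rewrite addr_ge0// divr_ge0 ?sqr_ge0// mulr_ge0// ltW.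
pose C1 := kap * C3 + d%:R * ((kap + 1) / 2) ^+ 2 + D.
have C10 : 0 <= C1.
  by rewrite /C1 !addr_ge0//; apply: mulr_ge0 => //; rewrite ?sqr_ge0.
have kapa : kap * (a / 2) - D = 1.
  by rewrite /kap divfK ?gt_eqF ?divr_gt0// addrAC subrr add0r.
have ha2 : 0 < a / 2 by rewrite divr_gt0.
exists C1 => // mu mu2.
have diss A X : adm A X ->
    \int[mu]_x dotv (grad V (X x)) (vel mu b X (X x)) <= C1 - \int[mu]_x (`|X x| ^+ 2).
  move=> aX; have := dissipation_bound _ _ C0 V LV C00 mB mL dmL (dmatern0 nu Sigma)
    matern_sym (psd_matern nu Sigma hnu) LV0 Vt gG (a / 2) C3
    (grad_confining V a beta0 beta1 ha hdissip) mu mu2 A X aX kap kap0.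
  by rewrite -/D kapa mul1r.
have diss1 A X : adm A X ->
    \int[mu]_x dotv (grad V (X x)) (vel mu b X (X x)) <= C1 - 1 * \int[mu]_x (`|X x| ^+ 2).
  by rewrite mul1r; exact: diss.
have a8 : 0 < a / 8 by rewrite divr_gt0.
have [X rX tX] := flow_exists mu b Cb Cb0 mu2 bG bL V _ _ C1 1 Vt a8
  (potential_coercive V L hVpos hVC3 hgrad a beta0 beta1 ha hbeta0 hdissip) C10 ler01 diss1.
exists X; split => // s s0; have [A A0 aX] := regular_path_adm X s rX s0.
by apply: (diss A); apply: aX; rewrite s0 lexx.
Qed.

Lemma measurable_interaction z i : measurable_fun setT (fun y => b z y 0 i).
Proof.
have [Cb Cb0 [_ bL]] := svgd_interaction_regular.
apply: continuous_measurable_rV; apply: continuous_coord.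
exact: (continuous_interaction b Cb Cb0 bL).
Qed.

Lemma svgd_velocity_pushforward (mu : probability T R) A X z :
  mu.-integrable setT (EFin \o (fun x : T => wt x ^+ 2)) -> adm A X ->
  svgd_velocity V k (pushforward mu X) z = vel mu b X z.
Proof.
move=> mu2 aX; have [Cb Cb0 [bG bL]] := svgd_interaction_regular.
rewrite (svgd_velocityE nu Sigma V hnu); apply/rowP => i; rewrite [LHS]mxE [RHS]mxE.
apply: Rintegral_pushforward; first by case: aX.
  exact: measurable_interaction.
exact: (integrable_interactionX mu b Cb Cb0 mu2 bG bL A X z i aX).
Qed.

Lemma svgd_velocity_empirical N (y : N.-tuple T) i :
  svgd_velocity V k (empirical y) (tnth y i) = mean_interaction b (tnth y) i.
Proof.
rewrite (svgd_velocityE nu Sigma V hnu); apply/rowP => l; rewrite [LHS]mxE [RHS]mxE.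
exact: (Rintegral_empirical N y _ (measurable_interaction _ _)).
Qed.

Lemma particle_solution_solves N (x0 : N.-tuple T) x :
  particle_solution V k x0 x -> solves (mean_interaction b) (fun t => tnth (x t)).
Proof.
move=> [_ dx] t t0 i l; apply/has_slopeP; have := dx t t0 i.
rewrite svgd_velocity_empirical => xt.
have cl : continuous (fun u : T => u 0 l : R).
  by apply: (continuous_coord id) => u; exact: cvg_id.
have := cvg_comp _ _ xt (cl _).
rewrite (_ : _ \o _ = fun s => (s - t)^-1 * (tnth (x s) i 0 l - tnth (x t) i 0 l))//.
by apply/funext => s; rewrite /= !mxE.
Qed.

Lemma particle_solution_unique N (x0 : N.-tuple T) x y :
  particle_solution V k x0 x -> particle_solution V k x0 y ->
  forall t, 0 <= t -> y t = x t.
Proof.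
move=> sx sy t t0; apply: eq_from_tnth => i.
have [Cb Cb0 [_ bL]] := svgd_interaction_regular.
have := solves_unique (mean_interaction b) (mean_interaction_lip b Cb Cb0 bL) _ _
  (particle_solution_solves N x0 y sy) (particle_solution_solves N x0 x sx).
by rewrite sx.1 sy.1 => /(_ erefl t t0) ->.
Qed.

(** The image of the empirical measure of [x0] under [X t] is the empirical measure of the images of
    the atoms, so the flow followed along the atoms is the particle system. *)
Lemma flow_particle_solution N (x0 : N.+1.-tuple T) X :
  regular_path X ->
  transported X (fun t x => vel (empirical x0) b (X t) (X t x)) ->
  particle_solution V k x0 (fun t => [tuple of map (X t) x0]).
Proof.
move=> rX tX; split=> [|t t0 i].
  by apply: eq_from_tnth => i; rewrite tnth_map rX.1.
have [A A0 aX] := regular_path_adm X t rX t0.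
have mu2 : (empirical x0).-integrable setT (EFin \o (fun x : T => wt x ^+ 2)).
  apply: integrable_empirical; apply: continuous_measurable_rV.
  by apply: (continuous_wt2 id) => x; exact: cvg_id.
rewrite (empirical_pushforward _ x0 _ (X t)) => [|j]; last by rewrite tnth_map.
rewrite (svgd_velocity_pushforward (empirical x0) A)//; last by apply: aX; rewrite t0 lexx.
apply: cvg_rV => l.
have [dX _ _ _] := tX.
have := is_derive_slope _ _ _ (dX t (tnth x0 i) l t0) => sl.
have : has_slope [set s | 0 <= s] (fun s => X s (tnth x0 i) 0 l) t
    (vel (empirical x0) b (X t) (X t (tnth x0 i)) 0 l).
  by move=> e e0; have [dl dl0 h] := sl e e0; exists dl => // s _; exact: h.
move=> /has_slopeP; rewrite tnth_map.
rewrite (_ : (fun s => (s - t)^-1 * _) =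
  fun s => ((s - t)^-1 *: (tnth [tuple of map (X s) x0] i - X t (tnth x0 i))) 0 l)//.
by apply/funext => s; rewrite !mxE tnth_map.
Qed.

(** By uniqueness every solution is the flow followed along the atoms of [x0], and the moment
    estimate of the flow applies to it. *)
Lemma particle_energy C1 N (x0 : N.+1.-tuple T) X (y : R -> N.+1.-tuple T) :
  regular_path X ->
  transported X (fun t x => vel (empirical x0) b (X t) (X t x)) ->
  (forall s, 0 <= s ->
     flux (empirical x0) X (fun t x => vel (empirical x0) b (X t) (X t x)) V s <=
      C1 - \int[empirical x0]_x (`|X s x| ^+ 2)) ->
  particle_solution V k x0 y -> forall S, 0 < S ->
  (\int[lebesgue_measure]_(t in `[0%R, S])
     (N.+1%:R^-1 * \sum_(i < N.+1) enorm (tnth (y t) i) ^+ 2)%:E <=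
   (d%:R * (C1 * S + N.+1%:R^-1 * \sum_(i < N.+1) V (tnth x0 i)))%:E)%E.
Proof.
move=> rX tX diss sy S S0.
have Vt := potential_tame V L hVC3 hgrad.
have mV : measurable_fun setT V.
  by apply: continuous_measurable_rV; exact: tame_continuous.
have mu2 : (empirical x0).-integrable setT (EFin \o (fun x : T => wt x ^+ 2)).
  apply: integrable_empirical; apply: continuous_measurable_rV.
  by apply: (continuous_wt2 id) => x; exact: cvg_id.
have := enorm_moment_bound (empirical x0) mu2 X _ rX tX V C1 Vt
  (fun x => ltW (hVpos x)) diss S (ltW S0).
rewrite (Rintegral_empirical _ x0 V mV); congr (_ <= _)%E.
apply: eq_integral => t; rewrite inE/= in_itv/= => /andP[t0 _]; congr EFin.
have me : measurable_fun setT (fun x => enorm (X t x) ^+ 2).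
  apply: continuous_measurable_rV; under [X in continuous X]eq_fun do rewrite enorm_sqr.
  by apply: continuous_dotv; exact: regular_path_cont.
rewrite (Rintegral_empirical _ x0 _ me); congr (_ * _); apply: eq_bigr => i _.
rewrite (particle_solution_unique _ x0 _ y (flow_particle_solution N x0 X rX tX) sy t t0).
by rewrite tnth_map.
Qed.

End svgd_flow.

(** * Compactly supported test functions *)

Section test_functions.
Context {R : realType} {d : nat}.
Local Notation T := 'rV[R]_d.

Lemma grad_off_support (f : T -> R) x :
  ~ closure [set x | f x != 0] x -> grad f x = 0.
Proof.
move=> xN.
have nf : \forall y \near x, f y = 0.
  have [B Bx BN] : exists2 B, nbhs x B & ~ ([set x | f x != 0] `&` B !=set0).
    apply: contrapT => H; apply: xN => B Bx; apply: contrapT => BN.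
    by apply: H; exists B.
  apply: filterS Bx => y By; apply: contrapT => /eqP fy.
  by apply: BN; exists y.
apply/rowP => i; rewrite !mxE.
have -> : 'D_(basis_vec i) f x = 'D_(basis_vec i) (fun=> 0 : R) x.
  exact: near_eq_derive.
by rewrite derive_cst.
Qed.

(** The gradient vanishes off the support and is bounded on it by compactness. *)
Lemma test_function_tame (f : T -> R) : Ck 1 f ->
  compact (closure [set x | f x != 0]) -> tame f.
Proof.
move=> [df cf] cK.
have cg : continuous (grad f) by apply: continuous_rV => i; exact: cf.
split => //.
pose K := closure [set x | f x != 0].
have [M MK] : exists M, forall x, K x -> `|grad f x| <= M.
  have cgK : compact (grad f @` K).
    by apply: continuous_compact => //; exact: continuous_subspaceT.
  have [M [_ MK]] := compact_bounded cgK.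
  exists (M + 1) => x Kx; apply: (MK (M + 1)); first by rewrite ltrDl.
  by exists x.
exists `|M| => x; have [Kx|NKx] := pselect (K x).
  rewrite (le_trans (MK x Kx))// (le_trans (ler_norm _))//.
  by rewrite ler_peMr// wt_ge1.
by rewrite grad_off_support// normr0 mulr_ge0// wt_ge0.
Qed.

End test_functions.

(** * The mean-field equation *)

Section mean_field.
Context {R : realType} {d : nat}.
Local Notation T := 'rV[R]_d.
Local Notation leb := (@lebesgue_measure R).

Lemma second_moment_wt2 (mu : probability T R) : (second_moment mu < +oo)%E ->
  mu.-integrable setT (EFin \o (fun x : T => wt x ^+ 2)).
Proof.
move=> mom.
have ce : continuous (fun x : T => enorm x ^+ 2 : R).
  under [X in continuous X]eq_fun do rewrite enorm_sqr.
  by apply: continuous_dotv => x; exact: cvg_id.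
have ie : mu.-integrable setT (EFin \o (fun x : T => enorm x ^+ 2)).
  apply/integrableP; split.
    by apply/measurable_EFinP; exact: continuous_measurable_rV.
  apply: le_lt_trans mom; rewrite le_eqVlt; apply/orP; left; apply/eqP.
  by apply: eq_integral => x _ /=; rewrite ger0_norm// sqr_ge0.
apply: (integrable_dom mu _ (fun x => 2 + 2 * enorm x ^+ 2)).
- by apply: continuous_measurable_rV; apply: (continuous_wt2 id) => x; exact: cvg_id.
- apply: integrable_add; first exact: integrable_prob_cst.
  exact: integrable_scale.
- move=> x; rewrite ger0_norm ?sqr_ge0//.
  have := norm_sqr_le_enorm x; have := sqr_ge0 (`|x| - 1).
  by rewrite /wt; nra.
Qed.

Variables (V : T -> R) (k : T -> T -> R) (mu0 : probability T R).
Hypothesis mu2 : mu0.-integrable setT (EFin \o (fun x : T => wt x ^+ 2)).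
Variables (X w : R -> T -> T).
Let v t x := w t (X t x).
Hypothesis rX : regular_path X.
Hypothesis tX : transported X v.
Hypothesis cw : forall t, 0 <= t -> continuous (w t).
Hypothesis velE : forall t z, 0 <= t ->
  svgd_velocity V k (pushforward mu0 (X t)) z = w t z.

Lemma flow_mean_field_solution : exists2 mu : R -> probability T R,
  mean_field_solution V k mu0 mu &
  forall t, 0 <= t ->
    second_moment (mu t) = (\int[mu0]_x (enorm (X t x) ^+ 2))%:E.
Proof.
have mX t : measurable_fun setT (X (tpos t)).
  apply: continuous_measurable_rV_rV; apply: regular_path_cont => //.
  exact: tpos_ge0.
(* Thanks to [tpos] this is a measurable map for every real [t], so the image is a probability at
   negative times too. *)
pose f t : {mfun T >-> T} := mfun_Sub (mem_set (mX t)).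
have fE t : 0 <= t -> f t = X t :> (T -> T).
  by move=> t0; rewrite /f mfun_valP /= tpos_id.
pose mu t : probability T R := distribution mu0 (f t).
have muE t : 0 <= t -> mu t = pushforward mu0 (X t) :> (set T -> \bar R).
  by move=> t0; rewrite -fE.
have momE t : 0 <= t ->
    second_moment (mu t) = (\int[mu0]_x (enorm (X t x) ^+ 2))%:E.
  move=> t0; rewrite /second_moment muE// ge0_integral_pushforward//.
  - rewrite preimage_setT /Rintegral fineK//; apply: integrable_fin_num => //.
    exact: (enorm_moment_integrable mu0 mu2 X rX).
  - by rewrite -(tpos_id t t0); exact: mX.
  - apply/measurable_EFinP; apply: continuous_measurable_rV.
    under [X in continuous X]eq_fun do rewrite enorm_sqr.
    by apply: continuous_dotv => x; exact: cvg_id.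
  - by move=> x _; rewrite lee_fin sqr_ge0.
exists mu => //; split.
- move=> A mA; rewrite muE// /pushforward; congr (mu0 _).
  by apply/seteqP; split => x /=; rewrite rX.1.
- by move=> t t0; rewrite momE// ltry.
- move=> phi Cphi Kphi flx t t0.
  have tphi := test_function_tame phi Cphi Kphi.
  have flxE s : 0 <= s -> flx s = flux mu0 X v phi s.
    move=> s0; have [_ cg _] := tphi; have [_ _ cv _] := tX.
    have [A fA] := flux_bound phi X v s tphi rX tX s0.
    rewrite /flx /flux -(Rintegral_pushforward mu0 (X s) (regular_path_cont X s rX s0)
      (fun z => dotv (grad phi z) (w s z))).
    - rewrite /Rintegral muE//; congr fine; congr integral; apply/funext => z.
        exact: (congr1 (fun g : set T -> \bar R => g z) (muE s s0)).
      by rewrite velE.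
    - apply: continuous_measurable_rV; apply: continuous_dotv => //; exact: cw.
    - apply: (integrable_wt2 mu0 mu2 _ A) => [|x]; last by apply: fA; rewrite s0 lexx.
      apply: continuous_dotv; last exact: cv.
      by apply: continuous_comp_fun => //; exact: regular_path_cont.
  split.
    have := flux_integrable mu0 mu2 X v rX tX phi t tphi.
    apply: eq_integrable => // s; rewrite inE/= in_itv/= => /andP[s0 _].
    by rewrite flxE.
  have -> : \int[leb]_(s in `[0, t]) flx s = \int[leb]_(s in `[0, t]) flux mu0 X v phi s.
    by apply: eq_Rintegral => s; rewrite inE/= in_itv/= => /andP[s0 _]; exact: flxE.
  rewrite -(observable_evolution mu0 mu2 X v rX tX phi t tphi t0).
  rewrite -(Rintegral_pushforward mu0 (X t) (regular_path_cont X t rX t0) phi).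
  - by rewrite /Rintegral; congr fine; congr integral; exact: muE.
  - by apply: continuous_measurable_rV; exact: tame_continuous.
  - have [A A0 aX] := regular_path_adm X t rX t0.
    by apply: (tame_int mu0 mu2 phi A) => //; apply: aX; rewrite t0 lexx.
Qed.

End mean_field.

(** * Particle system, initial energy and mean-field equation together *)

Theorem lemma4p2 (R : realType) (d : nat) (hd : (0 < d)%N)
  (* (i) *)
  (nu : R) (hnu : 3 / 2 < nu) (Sigma : 'M[R]_d) (hSigma : pos_def Sigma)
  (H : rkhs (svgd_kernel nu Sigma))
  (* (ii) *)
  (V : 'rV[R]_d -> R) (target : probability 'rV[R]_d R)
  (htarget : gibbs V target)
  (hVpos : forall x, 0 < V x) (hVC3 : Ck 3 V)
  (L : R) (hgrad : forall x, enorm (grad V x) <= L * (1 + enorm x))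
  (hhess : forall x, opnorm (hess V x) <= L)
  (a beta0 beta1 : R) (ha : 0 < a) (hbeta0 : 0 <= beta0) (hbeta1 : 0 <= beta1)
  (hdissip : forall x, - dotv x (grad V x) + d%:R <=
     - a * enorm x ^+ 2 + beta1 * enorm x + beta0)
  (hlangevin : langevin_contractive V)
  (hKGM : exists CKGM : R, forall rho : probability 'rV[R]_d R,
     (second_moment rho < +oo)%E ->
     (wasserstein 2 rho target <=
        CKGM%:E *
        maxe 1 (poweR (KSD V H rho) (1 - r_exponent d nu)) *
        poweR (KSD V H rho) (r_exponent d nu))%E)
  (* (iii) *)
  (P0 : forall N : nat, probability (N.-tuple 'rV[R]_d) R)
  (mu0 : probability 'rV[R]_d R)
  (hKL : (ereal_sup [set (N%:R^-1)%:E * KL (P0 N) (tuple_prob target (n := N))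
            | N in [set N : nat | (1 <= N)%N]] < +oo)%E)
  (alpha beta c C0 : R)
  (halpha : 0 < alpha) (hbeta : 0 < beta) (hc : 0 < c) (hC0 : 0 < C0)
  (hinit : forall N : nat, (1 <= N)%N ->
     (P0 N [set x | (c * N%:R `^ (- alpha))%:E
                      < wasserstein 2 (empirical x) mu0] <=
      if N == 1%N then +oo else (C0 * (ln N%:R) `^ (- beta))%:E)%E)
  (hmu0_density : has_density mu0)
  (hmu0_moment : (second_moment mu0 < +oo)%E)
  (hmu0_KL : (KL mu0 target < +oo)%E) :
  (forall N : nat, (2 <= N)%N -> forall x0 : N.-tuple 'rV[R]_d,
     exists x : R -> N.-tuple 'rV[R]_d,
       particle_solution V (svgd_kernel nu Sigma) x0 x /\
       forall y : R -> N.-tuple 'rV[R]_d,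
         particle_solution V (svgd_kernel nu Sigma) x0 y ->
         forall t, 0 <= t -> y t = x t) /\
  exists2 C : R, 0 < C &
    [/\ forall N : nat, (2 <= N)%N -> forall (x0 : N.-tuple 'rV[R]_d)
          (x : R -> N.-tuple 'rV[R]_d),
          particle_solution V (svgd_kernel nu Sigma) x0 x ->
          forall T : R, 0 < T ->
          ((\int[lebesgue_measure]_(t in `[0%R, T])
              (N%:R^-1 * \sum_(i < N) enorm (tnth (x t) i) ^+ 2)%:E) <=
           (C * T + C / N%:R * \sum_(i < N) V (tnth x0 i))%:E)%E,
        (ereal_sup
           [set (\int[P0 N]_x (N%:R^-1 * \sum_(i < N) V (tnth x i))%:E)
             | N in [set N : nat | (2 <= N)%N]] < +oo)%E &
        exists2 mu : R -> probability 'rV[R]_d R,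
          mean_field_solution V (svgd_kernel nu Sigma) mu0 mu &
          forall T : R, 0 < T ->
          ((\int[lebesgue_measure]_(t in `[0%R, T]) second_moment (mu t)) <=
             (C * T)%:E + C%:E * (\int[mu0]_x (V x)%:E))%E /\
          ((C * T)%:E + C%:E * (\int[mu0]_x (V x)%:E) < +oo)%E].
Proof.
have Vt := potential_tame V L hVC3 hgrad.
have Vge0 x : 0 <= V x := ltW (hVpos x).
have mV : measurable_fun setT V.
  by apply: continuous_measurable_rV; exact: tame_continuous.
have [C1 C10 flow] := svgd_flow nu Sigma V L a beta0 beta1 hnu hVpos hVC3 hgrad hhess
  ha hbeta0 hdissip.
have d0 : 0 < d%:R :> R by rewrite ltr0n.
have unique := particle_solution_unique nu Sigma V L hnu hVC3 hgrad hhess.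
have emp2 N (x0 : N.-tuple 'rV[R]_d) :
    (empirical x0).-integrable setT (EFin \o (fun x : 'rV[R]_d => wt x ^+ 2)).
  apply: integrable_empirical; apply: continuous_measurable_rV.
  by apply: (continuous_wt2 id) => x; exact: cvg_id.
split=> [[//|N] _ x0|].
  have [X [rX tX _]] := flow _ (emp2 _ x0).
  have sX := flow_particle_solution nu Sigma V L hnu hVC3 hgrad hhess N x0 X rX tX.
  exists (fun t => [tuple of map (X t) x0]); split; first exact: sX.
  by move=> y sy; exact: (unique _ x0 _ y sX sy).
(* Dominates both [d%:R * C1], the factor of the time, and [d%:R], the factor of the initial energy;
   the added 1 keeps it positive when [C1] is 0. *)
pose C := d%:R * (C1 + 1).
have C_ge1 : d%:R <= C by rewrite /C ler_peMr ?(ltW d0)// lerDr.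
have C_geC1 : d%:R * C1 <= C by rewrite /C ler_wpM2l ?(ltW d0)// lerDl.
exists C; first by rewrite mulr_gt0// ltr_wpDl.
split.
- move=> [//|N] _ x0 y sy S S0; have [X [rX tX diss]] := flow _ (emp2 _ x0).
  have := particle_energy nu Sigma V L hnu hVpos hVC3 hgrad hhess C1 N x0 X y
    rX tX diss sy S S0.
  move=> /le_trans; apply; rewrite lee_fin mulrDr !mulrA lerD//.
    by rewrite ler_wpM2r// ltW.
  by rewrite ler_wpM2r ?sumr_ge0// ler_wpM2r// invr_ge0.
- have [Z Z1 expV] := exp_half_potential_gibbs V _ _ target (tame_continuous V Vt) hVpos
    (divr_gt0 ha (ltr0n R 8)) (potential_coercive V L hVpos hVC3 hgrad a beta0 beta1 ha hbeta0 hdissip) htarget.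
  exact: (initial_energy_bound V target Z mV Vge0 Z1 expV P0 hKL).
have mu2 := second_moment_wt2 mu0 hmu0_moment.
have [X [rX tX diss]] := flow mu0 mu2.
have [Cb Cb0 [bG bL]] := svgd_interaction_regular nu Sigma V L hnu hVC3 hgrad hhess.
pose b := interaction (matern nu Sigma) (dmatern nu Sigma) V.
(* Eulerian field of the mean-field flow; along the flow it is the velocity in [tX]. *)
pose w t := vel mu0 b (X t).
have admX t : 0 <= t -> exists A, adm A (X t).
  move=> t0; have [A _ aX] := regular_path_adm X t rX t0.
  by exists A; apply: aX; rewrite t0 lexx.
have cw t : 0 <= t -> continuous (w t).
  move=> /admX[A aX]; apply: lip_continuous => z z'.
  exact: (vel_lip mu0 b Cb Cb0 mu2 bG bL A (X t) z z' aX).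
have wE t z : 0 <= t ->
    svgd_velocity V (svgd_kernel nu Sigma) (pushforward mu0 (X t)) z = w t z.
  move=> /admX[A aX].
  exact: (svgd_velocity_pushforward nu Sigma V L hnu hVC3 hgrad hhess mu0 A (X t) z mu2 aX).
have [mu mf momE] := flow_mean_field_solution V (svgd_kernel nu Sigma) mu0 mu2 X w rX tX cw wE.
exists mu => // S S0.
have iV : mu0.-integrable setT (EFin \o V).
  have [K K0 VK] := tame_growth V Vt.
  by apply: (integrable_wt2 mu0 mu2 _ K) => //; exact: tame_continuous.
have VE : (\int[mu0]_x (V x)%:E = (\int[mu0]_x V x)%:E)%E.
  by rewrite fineK//; exact: integrable_fin_num iV.
have V0 : 0 <= \int[mu0]_x V x by exact: Rintegral_ge0.
rewrite VE -EFinM -EFinD ltry; split => //.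
have := enorm_moment_bound mu0 mu2 X _ rX tX V C1 Vt Vge0 diss S (ltW S0).
have -> : (\int[lebesgue_measure]_(t in `[0%R, S]) second_moment (mu t) =
    \int[lebesgue_measure]_(t in `[0%R, S]) (\int[mu0]_x (enorm (X t x) ^+ 2))%:E)%E.
  by apply: eq_integral => t; rewrite inE/= in_itv/= => /andP[t0 _]; exact: momE.
move=> /le_trans; apply; rewrite lee_fin mulrDr !mulrA lerD//.
  by rewrite ler_wpM2r// ltW.
by rewrite ler_wpM2r.
Qed.
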